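(* Let $G$ be a Lie group with Lie algebra $\mathfrak g$, $\Gamma\subset G$ a cocompact lattice, and $\sigma$ a closed left-invariant 2-form on $G$. Assume that $\sigma$ is symplectic and let $H(\mu)=|\mu|^2/2$ for some fixed positive definite inner product in $\mathfrak g^*$, regarded as a left-invariant Hamiltonian on $T^*G\cong G\times\mathfrak g^*$ and hence as a Hamiltonian on $T^*(\Gamma\backslash G)$, equipped with the twisted symplectic form $\omega_\sigma=dp\wedge dq+\tau^*\sigma$. Then there exists $k_0>0$ such that for all $k<k_0$ the hypersurface $\Sigma_k=H^{-1}(k)\subset T^*(\Gamma\backslash G)$ is stable.
   Context: $\tau:T^*(\Gamma\backslash G)\to\Gamma\backslash G$ is the projection; $T^*G$ is identified with $G\times\mathfrak g^*$ by left translations. Only $k>0$ (nonempty regular levels) is considered. A closed hypersurface $\Sigma$ in a symplectic manifold $(V,\omega)$ is *stable* if there is a 1-form $\lambda$ on $\Sigma$ which is nonzero on $\ker(\omega|_\Sigma)$ and satisfies $\ker(\omega|_\Sigma)\subset\ker(d\lambda)$. *)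

(* Defs.v *)
From HB Require Import structures.
From mathcomp Require Export all_boot all_order all_algebra.
From mathcomp Require Export all_classical all_reals all_analysis.
Export Order.TTheory GRing.Theory Num.Theory.
Export numFieldNormedType.Exports.

Set Implicit Arguments.
Unset Strict Implicit.
Unset Printing Implicit Defensive.

#[export] Set Implicit Arguments.
#[export] Unset Strict Implicit.
#[export] Unset Printing Implicit Defensive.

Local Open Scope classical_set_scope.
Local Open Scope ring_scope.

(* C^k and C^infinity functions on an open subset of a finite-dimensional
   normed space. *)
Fixpoint Ck (R : realType) (E F : normedModType R) (k : nat)
    (U : set E) (f : E -> F) : Prop :=
  if k is k'.+1 then
    (forall x, U x -> differentiable f x) /\
    (forall v, Ck k' U (fun x => 'D_v f x))
  else forall x, U x -> {for x, continuous f}.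

Definition Csmooth (R : realType) (E F : normedModType R)
    (U : set E) (f : E -> F) : Prop :=
  forall k, Ck k U f.

(* Manifolds modelled on E.  [cto] and [cfrom] are total functions, meaningful
   only on [cdom] and [cimg]. *)
Record chart (M E : Type) := Chart {
  cdom : set M;
  cto : M -> E;
  cfrom : E -> M }.

Definition cimg (M E : Type) (c : chart M E) : set E := cto c @` cdom c.

(* A space with an atlas and a preferred chart around each point.  The tangent
   space at p is E itself, a vector being given by its coordinates in the chart
   [chart_at p]. *)
Record charted (R : realType) (E : normedModType R) := Charted {
  carrier :> topologicalType;
  atlas : set (chart carrier E);
  chart_at : carrier -> chart carrier E }.

Definition is_chart (M : topologicalType) (R : realType) (E : normedModType R)
    (c : chart M E) : Prop :=
  [/\ open (cdom c),
      open (cimg c),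
      forall p, cdom c p -> cfrom c (cto c p) = p,
      forall p, cdom c p -> {for p, continuous (cto c)} &
      forall x, cimg c x -> {for x, continuous (cfrom c)}].

Definition smooth_manifold (R : realType) (E : normedModType R)
    (M : charted E) : Prop :=
  [/\ hausdorff_space M,
      @second_countable M,
      forall p : M, atlas (chart_at p) /\ cdom (chart_at p) p,
      forall c : chart M E, atlas c -> is_chart c &
      forall c c' : chart M E, atlas c -> atlas c' ->
        Csmooth (cimg c `&` cfrom c @^-1` cdom c') (cto c' \o cfrom c)].

Definition vchart (E : Type) : chart E E := Chart setT id id.

Definition vec (R : realType) (E : normedModType R) : charted E :=
  @Charted R E E [set vchart E] (fun=> vchart E).

Definition prod_chart (M N E F : Type) (c : chart M E) (d : chart N F) :
    chart (M * N) (E * F) :=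
  Chart (cdom c `*` cdom d)
    (fun p => (cto c p.1, cto d p.2)) (fun x => (cfrom c x.1, cfrom d x.2)).

Definition prod_mfd (R : realType) (E F : normedModType R)
    (M : charted E) (N : charted F) : charted (E * F)%type :=
  @Charted R (E * F)%type (M * N)%type
    [set e | exists c d, [/\ atlas c, atlas d & e = prod_chart c d]]
    (fun p => prod_chart (chart_at p.1) (chart_at p.2)).

Definition smooth_on (R : realType) (E F : normedModType R)
    (M : charted E) (N : charted F) (O : set M) (f : M -> N) : Prop :=
  (forall p, O p -> {for p, continuous f}) /\
  (forall (a : chart M E) (b : chart N F), atlas a -> atlas b ->
     Csmooth (cimg a `&` cfrom a @^-1` (O `&` f @^-1` cdom b))
       (cto b \o f \o cfrom a)).

Definition local_diffeo (R : realType) (E F : normedModType R)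
    (M : charted E) (N : charted F) (f : M -> N) : Prop :=
  smooth_on setT f /\
  forall p : M, exists (O : set M) (s : N -> M),
    [/\ open O, O p, open (f @` O), smooth_on (f @` O) s &
        forall x, O x -> s (f x) = x].

(* The tangent map T_p M -> T_(f p) N. *)
Definition tmap (R : realType) (E F : normedModType R)
    (M : charted E) (N : charted F) (f : M -> N) (p : M) (v : E) : F :=
  'd (cto (chart_at (f p)) \o f \o cfrom (chart_at p))
     (cto (chart_at p) p) v.

(* Fields of (not yet linear, nor smooth) functions of one, resp. two, tangent
   vectors. *)
Definition form1 (R : realType) (E : normedModType R) (M : charted E) :=
  M -> E -> R.
Definition form2 (R : realType) (E : normedModType R) (M : charted E) :=
  M -> E -> E -> R.

Definition pull1 (R : realType) (E F : normedModType R)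
    (M : charted E) (N : charted F) (f : M -> N) (a : form1 N) : form1 M :=
  fun p v => a (f p) (tmap f p v).
Definition pull2 (R : realType) (E F : normedModType R)
    (M : charted E) (N : charted F) (f : M -> N) (w : form2 N) : form2 M :=
  fun p u v => w (f p) (tmap f p u) (tmap f p v).

(* Components of a form in a chart: the pullback by the inverse of the chart. *)
Definition comp1 (R : realType) (E : normedModType R) (M : charted E)
    (c : chart M E) (a : form1 M) : form1 (vec E) :=
  @pull1 R E E (vec E) M (cfrom c) a.
Definition comp2 (R : realType) (E : normedModType R) (M : charted E)
    (c : chart M E) (w : form2 M) : form2 (vec E) :=
  @pull2 R E E (vec E) M (cfrom c) w.

Definition smooth_form2 (R : realType) (E : normedModType R) (M : charted E)
    (w : form2 M) : Prop :=
  [/\ forall (p : M) (u : E), linear (w p u : E -> R^o),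
      forall (p : M) (u : E), linear (fun v => w p v u : R^o),
      forall (p : M) (u : E), w p u u = 0 &
      forall (c : chart M E) (u v : E), atlas c ->
        Csmooth (cimg c) (fun x : E => comp2 c w x u v : R^o)].

(* Exterior derivatives on a vector space (constant fields commute, so only the
   derivative terms of the invariant formula remain), and on a manifold. *)
Definition dvec1 (R : realType) (E : normedModType R) (a : form1 (vec E))
    (x u v : E) : R :=
  'D_u (fun y : E => a y v : R^o) x - 'D_v (fun y : E => a y u : R^o) x.
Definition dvec2 (R : realType) (E : normedModType R) (w : form2 (vec E))
    (x u v z : E) : R :=
  'D_u (fun y : E => w y v z : R^o) x - 'D_v (fun y : E => w y u z : R^o) x
  + 'D_z (fun y : E => w y u v : R^o) x.

Definition d1 (R : realType) (E : normedModType R) (M : charted E)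
    (a : form1 M) : form2 M :=
  fun p u v => dvec1 (comp1 (chart_at p) a) (cto (chart_at p) p) u v.
Definition closed_form2 (R : realType) (E : normedModType R) (M : charted E)
    (w : form2 M) : Prop :=
  forall (p : M) (u v z : E),
    dvec2 (comp2 (chart_at p) w) (cto (chart_at p) p) u v z = 0.

Definition nondegenerate (R : realType) (E : normedModType R) (M : charted E)
    (w : form2 M) : Prop :=
  forall (p : M) (u : E), (forall v, w p u v = 0) -> u = 0.

Definition symplectic (R : realType) (E : normedModType R) (M : charted E)
    (w : form2 M) : Prop :=
  [/\ smooth_form2 w, closed_form2 w & nondegenerate w].

(* Compact, without boundary, and locally the zero set of a smooth function
   with nonzero differential. *)
Definition closed_hypersurface (R : realType) (E : normedModType R)
    (M : charted E) (S : set M) : Prop :=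
  compact S /\
  forall p : M, S p -> exists (O : set M) (f : M -> vec R^o),
    [/\ open O, O p, smooth_on O f, S `&` O = O `&` [set x | f x = 0] &
        exists v : E, tmap f p v <> 0].

(* Immersions of open subsets of R^m into M with values in S.  When S is an
   m-dimensional submanifold these are exactly the local diffeomorphisms from
   open subsets of R^m to S; forms on S and their differentials are computed
   by pulling back along them. *)
Definition patch (R : realType) (E : normedModType R) (M : charted E)
    (S : set M) (m : nat) (U : set 'rV[R]_m) (phi : vec 'rV[R]_m -> M) : Prop :=
  [/\ open U, smooth_on (U : set (vec _)) phi,
      forall x : vec 'rV[R]_m, U x -> injective (tmap phi x) &
      phi @` U `<=` S].

(* A 1-form lambda on S is given at p in S by a linear form on T_p M, of which
   only the restriction to T_p S is ever used; it is smooth as a form on S.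
   [m] is the dimension of S. *)
Definition stable (R : realType) (E : normedModType R) (M : charted E)
    (m : nat) (w : form2 M) (S : set M) : Prop :=
  closed_hypersurface S /\
  exists lambda : form1 M,
    (forall p : M, S p -> linear (lambda p : E -> R^o)) /\
    forall (U : set 'rV[R]_m) (phi : vec 'rV[R]_m -> M), patch S U phi ->
      (forall v : 'rV[R]_m,
         Csmooth U (fun x : 'rV[R]_m => pull1 phi lambda x v : R^o)) /\
      (forall x v : 'rV[R]_m, U x ->
         (forall u, pull2 phi w x v u = 0) -> v <> 0 ->
         pull1 phi lambda x v <> 0 /\
         (forall u, dvec1 (pull1 phi lambda) x v u = 0)).

Record lie_group (R : realType) (n : nat) := LieGroup {
  lie_mfd :> charted 'rV[R]_n;
  lmul : lie_mfd -> lie_mfd -> lie_mfd;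
  lone : lie_mfd;
  linv : lie_mfd -> lie_mfd;
  lmulA : associative lmul;
  lmul1g : left_id lone lmul;
  lmulVg : left_inverse lone linv lmul;
  lie_smooth : smooth_manifold lie_mfd;
  lmul_smooth :
    @smooth_on R _ _ (prod_mfd lie_mfd lie_mfd) lie_mfd setT
      (fun p => lmul p.1 p.2);
  linv_smooth : smooth_on setT linv }.

Definition left_invariant2 (R : realType) (n : nat) (G : lie_group R n)
    (w : form2 G) : Prop :=
  forall g : G, pull2 (lmul g) w = w.

Definition discrete_subgroup (R : realType) (n : nat) (G : lie_group R n)
    (Gamma : set G) : Prop :=
  [/\ Gamma (lone G),
      forall x y, Gamma x -> Gamma y -> Gamma (lmul x y),
      forall x, Gamma x -> Gamma (linv x) &
      exists O : set G, [/\ open O, O (lone G) &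
        Gamma `&` O `<=` [set lone G]]].

(* [Q], with the projection [pi], is the quotient manifold Gamma \ G; this
   determines (Q, pi) up to a unique diffeomorphism. *)
Definition left_quotient (R : realType) (n : nat) (G : lie_group R n)
    (Gamma : set G) (Q : charted 'rV[R]_n) (pi : G -> Q) : Prop :=
  [/\ smooth_manifold Q,
      forall q : Q, exists g : G, pi g = q,
      forall g h : G,
        pi g = pi h <-> exists2 gamma, Gamma gamma & h = lmul gamma g &
      local_diffeo pi].

(* The Lie algebra of G is T_1 G = 'rV_n; its dual is 'cV_n. *)
Definition pairing (R : realType) (n : nat) (mu : 'cV[R]_n) (xi : 'rV[R]_n) : R :=
  (xi *m mu) 0 0.

Definition inner_product (R : realType) (V : lmodType R) (b : V -> V -> R) :
    Prop :=
  [/\ forall x y, b x y = b y x,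
      forall y, linear (fun x => b x y : R^o) &
      forall x, x <> 0 -> 0 < b x x].

(* The left trivialization T_q (Gamma \ G) -> T_1 G: the inverse of the tangent
   map at 1 of h |-> pi (g h), for any g such that pi g = q. *)
Definition ltriv (R : realType) (n : nat) (G : lie_group R n)
    (Q : charted 'rV[R]_n) (pi : G -> Q) (q : Q) (w : 'rV[R]_n) : 'rV[R]_n :=
  xget 0 [set xi | exists2 g : G, pi g = q &
                     tmap (pi \o lmul g) (lone G) xi = w].

(* The 2-form on Gamma \ G whose pullback by pi is the invariant form w. *)
Definition descend2 (R : realType) (n : nat) (G : lie_group R n)
    (Q : charted 'rV[R]_n) (pi : G -> Q) (w : form2 G) : form2 Q :=
  fun q u v => xget 0 [set s : R | exists (g : G) (u' v' : 'rV[R]_n),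
    [/\ pi g = q, tmap pi g u' = u, tmap pi g v' = v & s = w g u' v']].

(* T^*(Gamma \ G), trivialized by left translations: (q, mu) stands for the
   covector mu \o ltriv pi q at q. *)
Definition cotangent (R : realType) (n : nat) (Q : charted 'rV[R]_n) :
    charted ('rV[R]_n * 'cV[R]_n)%type :=
  prod_mfd Q (vec 'cV[R]_n).

Definition tau (R : realType) (n : nat) (Q : charted 'rV[R]_n)
    (z : cotangent Q) : Q := z.1.

(* The tautological form p dq, with differential dp /\ dq. *)
Definition liouville (R : realType) (n : nat) (G : lie_group R n)
    (Q : charted 'rV[R]_n) (pi : G -> Q) : form1 (cotangent Q) :=
  fun z w => pairing z.2 (ltriv pi (tau z) (tmap (@tau R n Q) z w)).

Definition twisted_form (R : realType) (n : nat) (G : lie_group R n)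
    (Q : charted 'rV[R]_n) (pi : G -> Q) (sigma : form2 G) :
    form2 (cotangent Q) :=
  fun z u v =>
    d1 (liouville pi) z u v + pull2 (@tau R n Q) (descend2 pi sigma) z u v.

Definition hamiltonian (R : realType) (n : nat) (Q : charted 'rV[R]_n)
    (b : 'cV[R]_n -> 'cV[R]_n -> R) (z : cotangent Q) : R :=
  b z.2 z.2 / 2.

(* Main.v *)
From HB Require Import structures.
From mathcomp Require Import perm ring lra.
Require Import Defs.

(**
Left translations identify the cotangent bundle of the quotient with Q times
the dual g* of the Lie algebra g, and the energy depends on the momentum
mu in g* alone.  Let theta be the Maurer-Cartan form, so that
d theta = C(theta, theta) for the structure constants C ([maurer_cartan],
[bracket], [maurer_cartan_equation]).  On tangent vectors (xi, nu) of g x g*,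
the twisted form is
  omega((xi, nu), (xi', nu')) = nu(xi') - nu'(xi) + Pi_mu(xi, xi'),
  Pi_mu = sigma_1 + mu o C,
where sigma_1 is sigma at the identity ([twisted_formE]).

As sigma is symplectic, Pi_0 is nondegenerate, hence so is Pi_mu for small mu.
Let P_mu be the matrix of Pi_mu.  Inverting Pi_mu gives a 2-form on a ball of
g*,
  Omega_mu(u, v) = - u^T P_mu^-1 v,
and Omega is closed: for fixed mu the form Pi_mu(theta, theta) =
sigma + d(mu o theta) on G is closed, which by the Maurer-Cartan equation says
that the cyclic sum of Pi_mu(C(x, y), z) vanishes ([twisted_jacobi]); this is
also the condition that the inverse of the pencil P_mu, affine in mu, be closed
([closed_inverse]).  The radial primitive
  beta_mu(v) = int_0^1 t Omega_(t mu)(mu, v) dt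
of the Poincare lemma satisfies d beta = Omega ([dvec1_primitive]).  The
stabilizing form is the pullback of beta by the projection (q, mu) |-> mu
([stabilizer]).

Two facts make it stabilizing.  Let b be the inner product and B its matrix.
A nonzero vector in the kernel of omega on the level b(mu, mu) / 2 = k has
xi = c (B mu)^T and nu = c P_mu B mu with c nonzero ([patch_kernel]).
- Omega_mu(nu, v) is then c b(mu, v), which vanishes for v tangent to the
  level; so nu is in the kernel of the restriction of Omega = d beta.
- At first order P_(t mu)^-1 P_mu is the identity, whence
  beta_mu(P_mu B mu) = - b(mu, mu) / 2 + O(|mu|^3), which is negative for mu
  small and nonzero ([exists_primitive_ball]).
A level of small energy lies in a small ball of momenta and is compact, because
b dominates a multiple of the square norm ([ip_coercive]).

Smoothness of forms is that of their components in charts, so the argument also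
rests on the calculus of C^k maps: chain rule ([Ck_comp]), symmetry of second
derivatives ([schwarz]), commutation of d with pullback ([dvec1_pull]) and
differentiation under the integral sign ([Ck_param]).
*)

Local Open Scope classical_set_scope.
Local Open Scope ring_scope.

(** * Differentials and directional derivatives *)

Section Differentials.
Context (R : realType).
Implicit Types E F H : normedModType R.

(** The little-o condition that defines the differential, with explicit epsilons:
    the form in which differentiability of parametric integrals is checked. *)
Lemma diff_intro E F (f : E -> F) x (L : {linear E -> F}) :
  continuous L ->
  (forall eps : R, 0 < eps ->
     \forall h \near (0 : E), `|f (h + x) - f x - L h| <= eps * `|h|) ->
  differentiable f x /\ 'd f x = L :> (E -> F).
Proof.
move=> Lc fL.
have fo : f \o shift x = cst (f x) + L +o_ 0 id.
  apply/eqaddoP => eps eps0; have := fL _ eps0.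
  apply: filterS => h; rewrite !fctE /=.
  by rewrite opprD addrA.
have dE := diff_unique Lc fo.
by split=> //; apply/diff_locallyP; rewrite dE.
Qed.

Lemma diff_elim E F (f : E -> F) x : differentiable f x ->
  forall eps : R, 0 < eps ->
     \forall h \near (0 : E), `|f (h + x) - f x - 'd f x h| <= eps * `|h|.
Proof.
move=> df eps eps0; have /diff_locallyP[_ /eqaddoP/(_ _ eps0)] := df.
by apply: filterS => h; rewrite !fctE /= opprD addrA.
Qed.

Lemma near_eq_diff E F (f g : E -> F) x :
  (\forall y \near x, f y = g y) -> differentiable f x ->
  differentiable g x /\ 'd g x = 'd f x :> (E -> F).
Proof.
move=> fg df; apply: diff_intro; first exact: diff_continuous.
move=> eps eps0; have fgx := nbhs_singleton fg.
have := diff_elim df eps0; rewrite -fgx.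
have : \forall h \near (0 : E), f (h + x) = g (h + x).
  have c0 : (fun h : E => h + x) @ (0 : E) --> x.
    by rewrite -[X in _ --> X](add0r x); apply: cvgD; [exact: cvg_id|exact: cvg_cst].
  exact: c0 fg.
by apply: filterS2 => h ->.
Qed.

End Differentials.

Section Derive.
Context (R : realType).
Implicit Types E F H : normedModType R.

Lemma open_near E (U : set E) x : open U -> U x -> \forall y \near x, U y.
Proof. by move=> Uo Ux; apply: open_nbhs_nbhs. Qed.

Lemma linear_diff E F (L : E -> F) x : linear L -> continuous L ->
  differentiable L x /\ 'd L x = L :> (E -> F).
Proof.
move=> Ll Lc.
pose LM := GRing.isLinear.Build _ _ _ _ _ Ll.
pose LL : {linear E -> F} := HB.pack L LM.
by split; [exact: (@linear_differentiable _ _ _ LL)|exact: (@diff_lin _ _ _ LL)].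
Qed.

Lemma derive_comp E F H (f : E -> F) (g : F -> H) x v :
  differentiable f x -> differentiable g (f x) ->
  'D_v (g \o f) x = 'D_('D_v f x) g (f x).
Proof.
move=> df dg; rewrite !deriveE//; last exact: differentiable_comp.
by rewrite diff_comp.
Qed.

Lemma derive_lin E F (L : E -> F) x v : linear L -> continuous L ->
  'D_v L x = L v.
Proof. by move=> Ll Lc; have [? e] := linear_diff x Ll Lc; rewrite deriveE// e. Qed.

Lemma derive_lin_comp E F H (f : E -> F) (L : F -> H) x v :
  linear L -> continuous L -> differentiable f x ->
  'D_v (L \o f) x = L ('D_v f x).
Proof.
move=> Ll Lc df; have [dL _] := linear_diff (f x) Ll Lc.
by rewrite derive_comp// derive_lin.
Qed.

Lemma derive_linear E F (f : E -> F) x : differentiable f x ->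
  linear (fun v => 'D_v f x).
Proof. by move=> df a u v; rewrite !deriveE// linearP. Qed.

Lemma derive_pair E F H (f : E -> F) (g : E -> H) x v :
  differentiable f x -> differentiable g x ->
  'D_v (fun y => (f y, g y)) x = ('D_v f x, 'D_v g x).
Proof.
move=> df dg; rewrite !deriveE//; last exact: differentiable_pair.
by rewrite diff_pair.
Qed.

Lemma derive_mul E (f g : E -> R^o) x v :
  differentiable f x -> differentiable g x ->
  'D_v (fun y => f y * g y : R^o) x = 'D_v f x * g x + f x * 'D_v g x.
Proof.
move=> df dg; rewrite (_ : (fun y => _) = f * g) // deriveM; try exact: diff_derivable.
by rewrite addrC; congr (_ + _); exact: mulrC.
Qed.

Lemma differentiable_mul E (f g : E -> R^o) x :
  differentiable f x -> differentiable g x ->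
  differentiable (fun y => f y * g y : R^o) x.
Proof. by move=> df dg; apply: (differentiableM df dg). Qed.

Lemma differentiable_bigsum E F (I : Type) (r : seq I) (f : I -> E -> F) x :
  (forall i, differentiable (f i) x) ->
  differentiable (fun y => \sum_(i <- r) f i y) x.
Proof.
move=> df; elim: r => [|i r IH].
  rewrite (_ : (fun y => _) = cst 0); first exact: differentiable_cst.
  by apply/funext => y; rewrite big_nil.
rewrite (_ : (fun y => _) = f i + (fun y => \sum_(i <- r) f i y)).
  exact: differentiableD.
by apply/funext => y; rewrite big_cons.
Qed.

Lemma derive_bigsum E F (I : Type) (r : seq I) (f : I -> E -> F) x v :
  (forall i, differentiable (f i) x) ->
  'D_v (fun y => \sum_(i <- r) f i y) x = \sum_(i <- r) 'D_v (f i) x.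
Proof.
move=> df; elim: r => [|i r IH].
  rewrite big_nil (_ : (fun y => _) = cst 0); first exact: derive_cst.
  by apply/funext => y; rewrite big_nil.
rewrite big_cons -IH (_ : (fun y => _) = f i + (fun y => \sum_(i <- r) f i y)).
  rewrite deriveD//; first exact: diff_derivable.
  by apply: diff_derivable; exact: differentiable_bigsum.
by apply/funext => y; rewrite big_cons.
Qed.

Lemma linear_at0 E F (f : E -> F) : linear f -> f 0 = 0.
Proof.
by move=> fl; have := fl (-1) 0 0; rewrite scaleN1r oppr0 addr0 scaleN1r addNr.
Qed.

Lemma linear_sum_coord E F (I : finType) (f : E -> F) (a : I -> R) (e : I -> E) :
  linear f -> f (\sum_i a i *: e i) = \sum_i a i *: f (e i).
Proof.
move=> fl; pose fM := GRing.isLinear.Build _ _ _ _ _ fl.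
pose fL : {linear E -> F} := HB.pack f fM.
rewrite -[f]/(fL : E -> F) linear_sum; apply: eq_bigr => i _; exact: linearZ.
Qed.

End Derive.

(** * Functions of class C^k *)

Section Ck.
Context (R : realType).
Implicit Types E F H : normedModType R.

Lemma Ck_sub E F k (U V : set E) (f : E -> F) :
  U `<=` V -> Ck k V f -> Ck k U f.
Proof.
move=> UV; elim: k f => [|k IH] f /=; first by move=> h x /UV /h.
by move=> [h1 h2]; split=> [x /UV /h1//|v]; apply: IH.
Qed.

Lemma Ck_pred E F k (U : set E) (f : E -> F) : Ck k.+1 U f -> Ck k U f.
Proof.
elim: k f => [|k IH] f [h1 h2]; first by move=> x /h1 /differentiable_continuous.
by split=> // v; apply: IH.
Qed.

Lemma Ck_le0 E F k (U : set E) (f : E -> F) x :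
  Ck k U f -> U x -> {for x, continuous f}.
Proof. by elim: k => [|k IH] hf Ux; [exact: hf|exact: IH (Ck_pred hf) Ux]. Qed.

Lemma Ck_diff E F k (U : set E) (f : E -> F) x :
  Ck k.+1 U f -> U x -> differentiable f x.
Proof. by case=> h _ /h. Qed.

Lemma Ck_ext E F k (U : set E) (f g : E -> F) :
  open U -> (forall x, U x -> f x = g x) -> Ck k U f -> Ck k U g.
Proof.
move=> Uo; elim: k f g => [|k IH] f g fg /=.
  move=> h x Ux; have fgx : \forall y \near x, f y = g y.
    by apply: filterS (open_near Uo Ux).
  change (g @ x --> g x); rewrite -(fg _ Ux).
  by apply: cvg_trans (h _ Ux); apply: near_eq_cvg.
have fgn x : U x -> \forall y \near x, f y = g y.
  by move=> Ux; apply: filterS (open_near Uo Ux).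
move=> [h1 h2]; split=> [x Ux|v].
  by have [] := near_eq_diff (fgn _ Ux) (h1 _ Ux).
apply: IH (h2 v) => x Ux; apply: near_eq_derive; exact: fgn.
Qed.

Lemma Ck_local E F k (U : set E) (f : E -> F) :
  (forall x, U x -> exists V, V x /\ Ck k V f) -> Ck k U f.
Proof.
elim: k f => [|k IH] f h; first by move=> x /h [V [Vx]]; apply.
split=> [x /h [V [Vx [hV _]]]|v]; first exact: hV.
apply: IH => x /h [V [Vx hV]].
by exists V; split=> //; exact: (proj2 hV v).
Qed.

Lemma Ck_cst E F k (U : set E) (a : F) : Ck k U (fun=> a).
Proof.
elim: k a => [|k IH] a /=; first by move=> x _; apply: cst_continuous.
split=> // v; rewrite (_ : 'D_v (fun=> a) = cst 0); first exact: IH.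
by apply/funext => x; apply: derive_cst.
Qed.

Lemma Ck_lin E F k (U : set E) (L : E -> F) :
  linear L -> continuous L -> Ck k U L.
Proof.
move=> Ll Lc; case: k => [|k] /=; first by move=> x _; apply: Lc.
split=> [x _|v]; first by have [] := linear_diff x Ll Lc.
rewrite (_ : 'D_v L = cst (L v)); first exact: Ck_cst.
by apply/funext => x; apply: derive_lin.
Qed.

Lemma Ck_id E k (U : set E) : Ck k U (id : E -> E).
Proof. by apply: Ck_lin => // x; apply: cvg_id. Qed.

Lemma Ck_lin_comp E F H k (U : set E) (f : E -> F) (L : F -> H) :
  open U -> linear L -> continuous L -> Ck k U f -> Ck k U (L \o f).
Proof.
move=> Uo Ll Lc; elim: k f => [|k IH] f /=.
  by move=> h x /h fc; apply: continuous_comp => //; apply: Lc.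
move=> [h1 h2]; split=> [x Ux|v].
  by apply: differentiable_comp; [exact: h1|have [] := linear_diff (f x) Ll Lc].
apply: Ck_ext Uo _ (IH _ (h2 v)) => x Ux /=.
by rewrite derive_lin_comp//; exact: h1.
Qed.

Lemma Ck_pair E F H k (U : set E) (f : E -> F) (g : E -> H) :
  open U -> Ck k U f -> Ck k U g -> Ck k U (fun x => (f x, g x)).
Proof.
move=> Uo; elim: k f g => [|k IH] f g /=.
  by move=> hf hg x Ux; apply: cvg_pair; [exact: hf|exact: hg].
move=> [f1 f2] [g1 g2]; split=> [x Ux|v].
  by apply: differentiable_pair; [exact: f1|exact: g1].
apply: Ck_ext Uo _ (IH _ _ (f2 v) (g2 v)) => x Ux.
by rewrite derive_pair//; [exact: f1|exact: g1].
Qed.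

Lemma CkD E F k (U : set E) (f g : E -> F) :
  open U -> Ck k U f -> Ck k U g -> Ck k U (fun x => f x + g x).
Proof.
move=> Uo; elim: k f g => [|k IH] f g /=.
  by move=> hf hg x Ux; apply: cvgD; [exact: hf|exact: hg].
move=> [f1 f2] [g1 g2]; split=> [x Ux|v].
  by apply: differentiableD; [exact: f1|exact: g1].
apply: Ck_ext Uo _ (IH _ _ (f2 v) (g2 v)) => x Ux.
by rewrite [RHS]deriveD//; apply: diff_derivable; [exact: f1|exact: g1].
Qed.

Lemma Ck_sum E F k (U : set E) (I : Type) (r : seq I) (f : I -> E -> F) :
  open U -> (forall i, Ck k U (f i)) -> Ck k U (fun x => \sum_(i <- r) f i x).
Proof.
move=> Uo h; elim: r => [|i r IH].
  by apply: Ck_ext Uo _ (Ck_cst k U 0) => x _; rewrite big_nil.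
by apply: Ck_ext Uo _ (CkD Uo (h i) IH) => x _; rewrite big_cons.
Qed.

Lemma CkM E k (U : set E) (f g : E -> R^o) :
  open U -> Ck k U f -> Ck k U g -> Ck k U (fun x => f x * g x : R^o).
Proof.
move=> Uo; elim: k f g => [|k IH] f g.
  by move=> /= hf hg x Ux; apply: cvgM; [exact: hf|exact: hg].
move=> hf hg; have [f1 f2] := hf; have [g1 g2] := hg.
split=> [x Ux|v].
  by apply: differentiableM; [exact: f1|exact: g1].
apply: Ck_ext Uo _ (CkD Uo (IH _ _ (f2 v) (Ck_pred hg)) (IH _ _ (Ck_pred hf) (g2 v))) => x Ux.
by rewrite derive_mul//; [exact: f1|exact: g1].
Qed.

Lemma Ck_prod E k (U : set E) (I : Type) (r : seq I) (f : I -> E -> R^o) :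
  open U -> (forall i, Ck k U (f i)) ->
  Ck k U (fun x => \prod_(i <- r) f i x : R^o).
Proof.
move=> Uo h; elim: r => [|i r IH].
  by apply: Ck_ext Uo _ (Ck_cst k U (1:R^o)) => x _; rewrite big_nil.
by apply: Ck_ext Uo _ (CkM Uo (h i) IH) => x _; rewrite big_cons.
Qed.

Lemma CkV E k (U : set E) (f : E -> R^o) :
  open U -> (forall x, U x -> f x != 0) -> Ck k U f ->
  Ck k U (fun x => (f x)^-1 : R^o).
Proof.
move=> Uo fn0; elim: k => [|k IH] hf.
  by move=> x Ux; apply: cvgV; [exact: fn0|exact: hf].
have [f1 f2] := hf; have IH1 := IH (Ck_pred hf).
split=> [x Ux|v].
  by apply: differentiableV; [exact: f1|exact: fn0].
have h := CkM Uo (Ck_cst k U (-1 : R^o)) (CkM Uo (CkM Uo IH1 IH1) (f2 v)).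
apply: Ck_ext Uo _ h => x Ux.
rewrite [RHS]deriveE; last by apply: differentiableV; [exact: f1|exact: fn0].
rewrite diffV; [|exact: f1|exact: fn0].
rewrite deriveE; last exact: f1.
by rewrite mulN1r /= -exprVn expr2 /GRing.scale /= mulNr.
Qed.

End Ck.

(** * Composition in finite dimension *)

Section Finite.
Context (R : realType).
Implicit Types E F H : normedModType R.

(** Finite dimension as the existence of finitely many continuous coordinates.
    In the chain rule, the derivative of g in the moving direction D_v f x then
    splits into derivatives in fixed directions, the only ones that [Ck] controls. *)
Definition finite_dim E := exists (I : finType) (e : I -> E) (l : I -> E -> R^o),
  (forall i, linear (l i) /\ continuous (l i)) /\
  (forall w, w = \sum_i l i w *: e i).

Lemma finite_dim_real : finite_dim R^o.
Proof.
exists unit, (fun=> 1), (fun=> id); split=> [_|w].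
  by split=> // x; apply: cvg_id.
by rewrite big_const card_unit /= addr0 /GRing.scale /= mulr1.
Qed.

Lemma finite_dim_mx m n : finite_dim 'M[R]_(m, n).
Proof.
exists ('I_m * 'I_n)%type, (fun p => delta_mx p.1 p.2),
  (fun p (A : 'M[R]_(m, n)) => A p.1 p.2).
split=> [i|w]; first split.
- by move=> a u v; rewrite !mxE.
- exact: coord_continuous.
- by rewrite [LHS]matrix_sum_delta pair_bigA.
Qed.

Lemma finite_dim_prod E F : finite_dim E -> finite_dim F -> finite_dim (E * F)%type.
Proof.
move=> [I [e [l [ll le]]]] [J [e' [l' [ll' le']]]].
exists (I + J)%type, (fun s => match s with inl i => (e i, 0) | inr j => (0, e' j) end),
  (fun s w => match s with inl i => l i w.1 | inr j => l' j w.2 end).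
split=> [[i|j]|[w1 w2]].
- have [h1 h2] := ll i; split=> [a u v|x]; first by rewrite /= h1.
  by apply: (@continuous_comp _ _ _ fst (l i)); [exact: cvg_fst|exact: h2].
- have [h1 h2] := ll' j; split=> [a u v|x]; first by rewrite /= h1.
  by apply: (@continuous_comp _ _ _ snd (l' j)); [exact: cvg_snd|exact: h2].
rewrite big_sumType /=; apply/pair_equal_spec; split.
  rewrite /= !(big_morph fst (fun _ _ => erefl) erefl) /= -le.
  by rewrite [X in _ + X]big1 ?addr0// => i _; rewrite scaler0.
rewrite /= !(big_morph snd (fun _ _ => erefl) erefl) /= -le'.
by rewrite [X in X + _]big1 ?add0r// => i _; rewrite scaler0.
Qed.

End Finite.

Section Composition.
Context (R : realType).
Implicit Types E F H : normedModType R.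

Lemma derive_sumZ E F (I : finType) (f : E -> F) x (a : I -> R) (e : I -> E) :
  differentiable f x ->
  'D_(\sum_i a i *: e i) f x = \sum_i a i *: 'D_(e i) f x.
Proof.
move=> df; rewrite deriveE// linear_sum; apply: eq_bigr => i _.
by rewrite linearZ deriveE.
Qed.

(** Induction on k: the derivative of the composite in direction v is the sum over
    i of l_i (D_v f) times (D_(e_i) g) o f, whose second factor is again a composite
    and is C^(k-1) by induction.  Scalar values for g make these products. *)
Lemma Ck_comp_scalar E F k (U : set E) (V : set F) (f : E -> F) (g : F -> R^o) :
  finite_dim F -> open U -> (forall x, U x -> V (f x)) ->
  Ck k U f -> Ck k V g -> Ck k U (g \o f).
Proof.
move=> [I [e [l [ll le]]]] Uo UV; elim: k g => [|k IH] g.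
  by move=> fc gc x Ux; apply: continuous_comp; [exact: fc|exact/gc/UV].
move=> hf hg; have [f1 f2] := hf; have [g1 g2] := hg; split=> [x Ux|v].
  by apply: differentiable_comp; [exact: f1|exact/g1/UV].
have h i : Ck k U (fun x => l i ('D_v f x) * 'D_(e i) g (f x) : R^o).
  apply: (@CkM _ _ _ _ (l i \o 'D_v f) ('D_(e i) g \o f)) => //.
    by have [? ?] := ll i; apply: (Ck_lin_comp Uo) => //; exact: f2.
  by apply: IH; [exact: Ck_pred hf|exact: g2].
apply: Ck_ext Uo _ (Ck_sum _ Uo h) => x Ux /=.
rewrite [RHS]derive_comp; [|exact: f1|exact/g1/UV].
by rewrite [in RHS](le ('D_v f x)) derive_sumZ//; exact/g1/UV.
Qed.

Lemma Ck_coord E F k (U : set E) (I : finType) (e : I -> F) (l : I -> F -> R^o)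
    (f : E -> F) :
  (forall w, w = \sum_i l i w *: e i) -> open U ->
  (forall i, Ck k U (l i \o f)) -> Ck k U f.
Proof.
move=> le Uo h.
have h' i : Ck k U (( *:%R^~ (e i) : R^o -> F) \o (l i \o f)).
  apply: Ck_lin_comp => //.
    by move=> a u v; rewrite scalerDl scalerA.
  exact: scalel_continuous.
by apply: Ck_ext Uo _ (Ck_sum _ Uo h') => x Ux /=; rewrite [RHS]le.
Qed.

Lemma Ck_comp E F H k (U : set E) (V : set F) (f : E -> F) (g : F -> H) :
  finite_dim F -> finite_dim H -> open U -> open V -> (forall x, U x -> V (f x)) ->
  Ck k U f -> Ck k V g -> Ck k U (g \o f).
Proof.
move=> Ff [I [e [l [ll le]]]] Uo Vo UV hf hg.
apply: (Ck_coord le Uo) => i; have [? ?] := ll i.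
apply: (Ck_comp_scalar (g := l i \o g) Ff Uo UV hf).
exact: Ck_lin_comp.
Qed.

End Composition.

(** * Symmetry of second derivatives and pullback of one-forms *)

Section Schwarz.
Context (R : realType).
Implicit Types E F : normedModType R.

Lemma line_is_derive E F (f : E -> F) x u (s : R) :
  differentiable f (x + s *: u) ->
  is_derive s 1 (fun s : R => f (x + s *: u)) ('D_u f (x + s *: u)).
Proof.
move=> df; pose a (s : R) := x + s *: u.
have da : is_diff s a ( *:%R^~ u).
  by apply: is_diff_eq; rewrite /= add0r.
have dfa : differentiable (f \o a) s by apply: differentiable_comp.
apply: DeriveDef; first exact: diff_derivable dfa.
rewrite -[LHS]/('D_1 (f \o a) s) derive_comp//; congr derive.
by rewrite deriveE// diff_val scale1r.
Qed.

Lemma mvt_line E (f : E -> R^o) x u (h : R) : 0 < h ->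
  (forall s, 0 <= s <= h -> differentiable f (x + s *: u)) ->
  exists2 c, 0 < c < h & f (x + h *: u) - f x = h * 'D_u f (x + c *: u).
Proof.
move=> h0 df.
have dd s : 0 <= s <= h ->
    is_derive s 1 (fun s : R => f (x + s *: u) : R) ('D_u f (x + s *: u)).
  by move=> /df; apply: line_is_derive.
have [||c] := MVT (f := fun s => f (x + s *: u)) (df := fun s => 'D_u f (x + s *: u)) h0.
- by move=> s; rewrite in_itv /= => /andP[/ltW s0 /ltW sh]; apply: dd; rewrite s0.
- apply: derivable_within_continuous => s; rewrite in_itv /= => sh.
  by apply: ex_derive; apply: dd.
- rewrite in_itv /= scale0r addr0 subr0 => ch ->; exists c => //.
  by rewrite mulrC.
Qed.

(** The increment along u of the increment of f along v; its symmetry in u and v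
    is what forces second derivatives to commute. *)
Definition second_difference E (f : E -> R^o) x u v (h : R) : R :=
  f (x + h *: u + h *: v) - f (x + h *: u) - (f (x + h *: v) - f x).

(** The mean value theorem, applied along u and then along v, turns the second
    difference into h^2 times a mixed second derivative at a nearby point, and that
    derivative is continuous. *)
Lemma second_difference_approx E (U : set E) (f : E -> R^o) x u v :
  open U -> U x -> Ck 2 U f -> forall eps : R, 0 < eps ->
  exists2 d, 0 < d & forall h, 0 < h < d ->
   `|second_difference f x u v h - h * h * 'D_v (fun y => 'D_u f y) x|
     <= eps * (h * h).
Proof.
move=> Uo Ux [f1 f2] eps eps0.
pose g := 'D_v (fun y => 'D_u f y).
have gc : {for x, continuous g}.
  have [_ h] := f2 u; exact: (h v x Ux).
have N : \forall y \near x, U y /\ `|g x - g y| < eps.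
  apply: filterI; first exact: open_near.
  by move/cvgrPdist_lt : gc; apply.
have [r /= r0 hr] := (nbhs_normP _ _).1 N.
pose d := r / (`|u| + `|v| + 1).
have uv0 : 0 < `|u| + `|v| + 1 by rewrite ltr_pwDr// addr_ge0.
have d0 : 0 < d by rewrite divr_gt0.
have key c c' : `|c| < d -> `|c'| < d ->
   U (x + c *: u + c' *: v) /\ `|g x - g (x + c *: u + c' *: v)| < eps.
  move=> cd cd'; apply: hr => /=.
  rewrite -addrA opprD addNKr normrN.
  apply: le_lt_trans (ler_normD _ _) _; rewrite !normrZ.
  have h1 : `|c| * `|u| <= d * `|u| by rewrite ler_wpM2r// ltW.
  have h2 : `|c'| * `|v| <= d * `|v| by rewrite ler_wpM2r// ltW.
  apply: le_lt_trans (lerD h1 h2) _; rewrite -mulrDr.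
  by rewrite /d mulrAC ltr_pdivrMr// ltr_pM2l// ltrDl.
exists d => // h /andP[h0 hd0].
have lt1 s : 0 <= s <= h -> `|s| < d.
  by move=> /andP[s0 sh]; rewrite ger0_norm//; apply: le_lt_trans hd0.
have z0 : `|0 : R| < d by rewrite normr0.
have hh : `|h| < d by apply: lt1; rewrite ltW//= lexx.
(* The second difference is the increment of this function along u. *)
pose f' y := f (y + h *: v) - f y : R^o.
have df' s : 0 <= s <= h ->
    differentiable (fun y => f (y + h *: v) : R^o) (x + s *: u) /\
    differentiable f (x + s *: u).
  move=> /lt1 sh; split.
    apply: (@differentiable_comp _ _ _ _ (fun y => y + h *: v) f) => //.
    by apply: f1; have [] := key _ _ sh hh.
  by apply: f1; have [] := key _ _ sh z0; rewrite scale0r addr0.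
have [|c ch] := @mvt_line _ f' x u h h0.
  by move=> s /df' [? ?]; apply: differentiableB.
have cl : 0 <= c <= h by case/andP: ch => /ltW -> /ltW ->.
have -> : 'D_u f' (x + c *: u) =
   'D_u f (x + c *: u + h *: v) - 'D_u f (x + c *: u).
  have [d1 d2] := df' _ cl.
  rewrite [LHS]deriveB; try exact: diff_derivable.
  congr (_ - _).
  rewrite (@derive_comp _ _ _ _ (fun y => y + h *: v) f)//; last first.
    by apply: f1; have [] := key _ _ (lt1 _ cl) hh.
  congr derive; rewrite deriveE// diff_val.
  by rewrite /= addr0.
have [|c' ch'] := @mvt_line _ (fun y => 'D_u f y) (x + c *: u) v h h0.
  move=> s /lt1 sh; have [h1 _] := f2 u; apply: h1.
  by have [] := key _ _ (lt1 _ cl) sh.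
move=> -> e; rewrite /second_difference.
have -> : f (x + h *: u + h *: v) - f (x + h *: u) - (f (x + h *: v) - f x) =
   f' (x + h *: u) - f' x by [].
rewrite e -/g mulrA -mulrBr normrM.
rewrite (ger0_norm (mulr_ge0 (ltW h0) (ltW h0))) mulrC distrC.
rewrite ler_wpM2r ?mulr_ge0 ?ltW//.
have cl' : `|c'| < d by apply: lt1; case/andP: ch' => /ltW -> /ltW ->.
by have [_] := key _ _ (lt1 _ cl) cl'.
Qed.

(** Both mixed derivatives are limits of the second difference divided by h^2,
    which is symmetric in u and v. *)
Lemma schwarz E (U : set E) (f : E -> R^o) x u v :
  open U -> U x -> Ck 2 U f ->
  'D_u (fun y => 'D_v f y) x = 'D_v (fun y => 'D_u f y) x.
Proof.
move=> Uo Ux hf; apply/eqP; rewrite -subr_eq0 -normr_le0.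
apply/ler_addgt0Pl => eps eps0; rewrite addr0.
have e2 : 0 < eps / 2 by rewrite divr_gt0.
have [d1 d10 h1] := @second_difference_approx _ _ _ x u v Uo Ux hf _ e2.
have [d2 d20 h2] := @second_difference_approx _ _ _ x v u Uo Ux hf _ e2.
pose h := Num.min d1 d2 / 2.
have h0 : 0 < h by rewrite divr_gt0// lt_min d10.
have hm : h < Num.min d1 d2 by rewrite ltr_pdivrMr// ltr_pMr ?lt_min ?d10// ltr1n.
move: hm; rewrite lt_min => /andP[hd1 hd2].
have {}h1 := h1 h; have {}h2 := h2 h; rewrite h0 /= in h1 h2.
have {}h1 := h1 hd1; have {}h2 := h2 hd2.
have sym : second_difference f x v u h = second_difference f x u v h.
  rewrite /second_difference (addrAC x (h *: v)).
  move: (f (x + h *: u + h *: v) : R) (f (x + h *: u) : R) (f (x + h *: v) : R)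
    (f x : R) => a b c d; ring.
rewrite sym in h2; have hh : 0 < h * h by rewrite mulr_gt0.
rewrite -(ler_pM2r hh) -{1}(ger0_norm (ltW hh)) -normrM.
set S := second_difference _ _ _ _ _ in h1 h2.
move: h1 h2; move: ('D_u _ x : R) ('D_v _ x : R) => A B h1 h2.
rewrite (_ : _ * _ = (S - h * h * B) - (S - h * h * A)); last by ring.
apply: le_trans (ler_normB _ _) _.
rewrite (_ : eps * _ = eps / 2 * (h * h) + eps / 2 * (h * h)); last by field.
exact: lerD.
Qed.

End Schwarz.

Section Pullback.
Context (R : realType).
Implicit Types E F : normedModType R.

Lemma schwarz_vector E F (U : set E) (f : E -> F) x u v :
  finite_dim F -> open U -> U x -> Ck 2 U f ->
  'D_u (fun y => 'D_v f y) x = 'D_v (fun y => 'D_u f y) x.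
Proof.
move=> [I [e [l [ll le]]]] Uo Ux hf.
have [f1 f2] := hf.
have d i a b : l i ('D_a ('D_b f) x) = 'D_a (fun y => 'D_b (l i \o f) y) x.
  have [lli lci] := ll i; have [h _] := f2 b.
  rewrite -derive_lin_comp//; last exact: h.
  apply: near_eq_derive; apply: filterS (open_near Uo Ux) => y Uy /=.
  by rewrite [RHS]derive_lin_comp//; exact: f1.
have s i : l i ('D_u ('D_v f) x) = l i ('D_v ('D_u f) x).
  have [lli lci] := ll i.
  by rewrite !d (schwarz u v Uo Ux (Ck_lin_comp Uo lli lci hf)).
rewrite (le ('D_u ('D_v f) x)) (le ('D_v ('D_u f) x)).
by apply: eq_bigr => i _; rewrite s.
Qed.

Lemma dvec1_near E (a b : form1 (vec E)) (x u v : E) :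
  (\forall y \near x, a y = b y) -> dvec1 a x u v = dvec1 b x u v.
Proof.
by move=> ab; rewrite /dvec1; congr (_ - _); apply: near_eq_derive;
  apply: filterS ab => y ->.
Qed.

(** Differentiating a (f y) (D_w f y) produces second derivatives of f and
    derivatives of a; the former are symmetric in the two directions and cancel in
    the alternating sum. *)
Lemma dvec1_pull E F (U : set E) (V : set F) (f : E -> F)
    (a : form1 (vec F)) (x u v : E) :
  finite_dim F -> open U -> U x -> Ck 2 U f -> open V -> V (f x) ->
  (forall y, V y -> linear (a y : F -> R^o)) ->
  (forall w, differentiable (fun y : F => a y w : R^o) (f x)) ->
  dvec1 (fun y w => a (f y) ('D_w f y) : R) x u v =
  dvec1 a (f x) ('D_u f x) ('D_v f x).
Proof.
move=> Ff Uo Ux hf Vo Vfx al ad; have [I [e [l [ll le]]]] := Ff.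
have [f1 f2] := hf.
have fc : {for x, continuous f} by apply: differentiable_continuous; exact: f1.
have aE y w : V y -> a y w = \sum_i l i w * a y (e i).
  move=> Vy; rewrite [in LHS](le w).
  pose aM := GRing.isLinear.Build _ _ _ _ _ (al _ Vy).
  pose aL : {linear F -> R^o} := HB.pack (a y : F -> R^o) aM.
  rewrite -[LHS]/(aL _) linear_sum; apply: eq_bigr => i _; exact: linearZ.
have dl w i : differentiable (fun y => l i ('D_w f y)) x.
  have [lli lci] := ll i; apply: (@differentiable_comp _ _ _ _ ('D_w f) (l i)).
    by have [h _] := f2 w; exact: h.
  by have [] := linear_diff ('D_w f x) lli lci.
have dae i : differentiable (fun y => a (f y) (e i) : R^o) x.
  by apply: (@differentiable_comp _ _ _ _ f (fun y => a y (e i) : R^o)) => //; exact: f1.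
have fVn : \forall y \near x, V (f y) := fc _ (open_near Vo Vfx).
have D p w : 'D_p (fun y => a (f y) ('D_w f y) : R^o) x =
   a (f x) ('D_p ('D_w f) x) + 'D_('D_p f x) (fun y => a y ('D_w f x) : R^o) (f x).
  rewrite (@near_eq_derive _ _ _ _ (fun y => \sum_i l i ('D_w f y) * a (f y) (e i) : R^o));
    last first.
    by apply: filterS fVn => y Vy; rewrite aE.
  rewrite derive_bigsum; last first.
    by move=> i; exact: (differentiable_mul (dl w i) (dae i)).
  rewrite aE//.
  rewrite [X in _ = _ + X](@near_eq_derive _ _ _ _ (fun y =>
    \sum_i l i ('D_w f x) * a y (e i) : R^o)); last first.
    by apply: filterS (open_near Vo Vfx) => y Vy; rewrite aE.
  rewrite [X in _ = _ + X]derive_bigsum; last first.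
    by move=> i; exact: (differentiable_mul (differentiable_cst _ _) (ad (e i))).
  rewrite -big_split; apply: eq_bigr => i _ /=.
  rewrite (derive_mul _ (dl w i) (dae i)) derive_mul//.
  have [lli lci] := ll i; have [h _] := f2 w.
  rewrite (@derive_lin_comp _ _ _ _ ('D_w f) (l i))//; last exact: h.
  rewrite (_ : 'D_('D_p f x) (fun=> l i ('D_w f x)) (f x) = 0); last exact: derive_cst.
  rewrite mul0r add0r (@derive_comp _ _ _ _ f (fun y => a y (e i) : R^o))//.
  exact: f1.
rewrite /dvec1 !D (schwarz_vector _ _ Ff Uo Ux hf).
by rewrite opprD addrACA subrr add0r.
Qed.

End Pullback.

(** * Integrals over the unit interval depending on a parameter *)

Section Integral01.
Context (R : realType).
Implicit Types f g : R -> R.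

Definition int01 f : R := \int[@lebesgue_measure R]_(t in `[0, 1]) f t.

Definition cont01 f := forall t, 0 <= t <= 1 -> {for t, continuous f}.

Lemma cont01_within f : cont01 f -> {within `[0, 1], continuous f}.
Proof.
move=> fc; apply: continuous_in_subspaceT => t.
by rewrite inE /= in_itv /= => /fc.
Qed.

Lemma cont01_integrable f : cont01 f ->
  (@lebesgue_measure R).-integrable `[0, 1] (EFin \o f).
Proof.
move=> fc; apply: continuous_compact_integrable; first exact: segment_compact.
exact: cont01_within.
Qed.

Lemma int01_ext f g : (forall t, 0 <= t <= 1 -> f t = g t) -> int01 f = int01 g.
Proof.
by move=> fg; apply: eq_Rintegral => t; rewrite inE /= in_itv /=; apply: fg.
Qed.

Lemma int01_linear a f g : cont01 f -> cont01 g ->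
  int01 (fun t => a * f t + g t) = a * int01 f + int01 g.
Proof.
move=> fc gc; have fi := cont01_integrable fc; have gi := cont01_integrable gc.
rewrite /int01 RintegralD//; last first.
  apply: (@cont01_integrable (fun t => a * f t)) => t /fc ft.
  by apply: cvgM => //; exact: cvg_cst.
by rewrite RintegralZl.
Qed.

Lemma cont01_lin a f g : cont01 f -> cont01 g -> cont01 (fun t => a * f t + g t).
Proof.
move=> fc gc t t01; apply: cvgD; last exact: gc.
by apply: cvgM; [exact: cvg_cst|exact: fc].
Qed.

Lemma int01_cst (c : R) : int01 (fun=> c) = c.
Proof.
by rewrite /int01 Rintegral_cst//= lebesgue_measure_itv /= lte_fin ltr01 /= subr0 mulr1.
Qed.

Lemma cont01_cst (c : R) : cont01 (fun=> c).
Proof. by move=> t _; apply: cvg_cst. Qed.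

Lemma int01_le f g : cont01 f -> cont01 g ->
  (forall t, 0 <= t <= 1 -> f t <= g t) -> int01 f <= int01 g.
Proof.
move=> fc gc fg; apply: le_Rintegral => //; exact: cont01_integrable.
Qed.

Lemma int01_norm_le f (c : R) : cont01 f ->
  (forall t, 0 <= t <= 1 -> `|f t| <= c) -> `|int01 f| <= c.
Proof.
move=> fc h; rewrite ler_norml; apply/andP; split.
  rewrite -(int01_cst (- c)); apply: int01_le => //; first exact: cont01_cst.
  by move=> t /h; rewrite ler_norml => /andP[].
rewrite -[X in _ <= X](int01_cst c); apply: int01_le => //; first exact: cont01_cst.
by move=> t /h; rewrite ler_norml => /andP[].
Qed.

Lemma int01_derive f (F : R -> R) : cont01 f ->
  (forall t : R, 0 <= t <= 1 -> is_derive t 1 F (f t)) -> int01 f = F 1 - F 0.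
Proof.
move=> fc dF.
have Fc t : 0 <= t <= 1 -> {for t, continuous F}.
  by move=> /dF [d _]; apply: differentiable_continuous; apply/derivable1_diffP.
rewrite /int01 /Rintegral (@continuous_FTC2 _ f F)//; first exact: cont01_within.
  split=> [t| |].
  - by rewrite in_itv /= => /andP[t0 t1]; have /dF[] : 0 <= t <= 1 by rewrite !ltW.
  - by apply: cvg_at_right_filter; apply: Fc; rewrite lexx ler01.
  - by apply: cvg_at_left_filter; apply: Fc; rewrite lexx ler01.
move=> t; rewrite in_itv /= => /andP[t0 t1]; rewrite derive1E.
by have /dF[_ ->] : 0 <= t <= 1 by rewrite !ltW.
Qed.

End Integral01.

Section Param.
Context (R : realType).
Implicit Types E F : normedModType R.

Lemma prod_ball E F (p : E * F) (P : set (E * F)) : nbhs p P ->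
  exists2 r : R, 0 < r & forall a b, `|p.1 - a| < r -> `|p.2 - b| < r -> P (a, b).
Proof.
move=> /nbhs_normP[r /= r0 h]; exists r => // a b ha hb.
by apply: h; rewrite /= prod_normE /= gt_max ha.
Qed.

(** The tube lemma for the compact interval [0, 1]. *)
Lemma near01 E (x : E) (P : E -> R -> Prop) :
  (forall t, 0 <= t <= 1 -> exists2 r : R, 0 < r &
     forall t' y, `|t - t'| < r -> `|x - y| < r -> P y t') ->
  \forall y \near x, forall t, 0 <= t <= 1 -> P y t.
Proof.
move=> h.
have /compact_near_coveringP cc := @segment_compact R 0 1.
have : \near x, `[0, 1] `<=` P x.
  apply: (cc E (nbhs x) P) => t; rewrite /= in_itv /= => /h[r r0 hr].
  exists ([set t' | `|t - t'| < r], [set y | `|x - y| < r]).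
    by split; apply/nbhs_normP; exists r.
  by move=> [t' y] [/= ? ?]; exact: hr.
by apply: filterS => y hy t t01; apply: hy; rewrite /= in_itv.
Qed.

Lemma slice_cont E F (f : R^o * E -> F) t x : {for (t, x), continuous f} ->
  {for t, continuous (fun t => f (t, x))}.
Proof.
move=> fc; apply: (@continuous_comp _ _ _ (fun t : R => (t, x) : R^o * E) f) => //.
apply: (@differentiable_continuous R R^o (R^o * E)%type t (fun t => (t, x))).
exact: differentiable_pair.
Qed.

Lemma slice_cont01 E (W : set (R^o * E)) (f : R^o * E -> R^o) x :
  (forall t, 0 <= t <= 1 -> W (t, x)) ->
  (forall p, W p -> {for p, continuous f}) -> cont01 (fun t => f (t, x)).
Proof. by move=> hW fc t t01; exact: (slice_cont (fc _ (hW t t01))). Qed.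

Lemma param_cont E (W : set (R^o * E)) (f : R^o * E -> R^o) x :
  open W -> (forall t, 0 <= t <= 1 -> W (t, x)) ->
  (forall p, W p -> {for p, continuous f}) ->
  {for x, continuous (fun x => int01 (fun t => f (t, x)) : R^o)}.
Proof.
move=> Wo hW fc.
have N (eps : R) : 0 < eps -> \forall y \near x, forall t, 0 <= t <= 1 ->
    W (t, y) /\ `|f (t, x) - f (t, y)| <= eps.
  move=> eps0; apply: near01 => t /hW Wt.
  have e2 : 0 < eps / 2 by rewrite divr_gt0.
  have /prod_ball[r r0 h] : nbhs ((t, x) : R^o * E)
      [set p | W p /\ `|f (t, x) - f p| < eps / 2].
    apply: filterI; first exact: (open_near Wo Wt).
    by have /cvgrPdist_lt := fc _ Wt; apply.
  exists r => // t' y tt' xy; have [] := h t' y tt' xy; split=> //.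
  have [_ h1] : W (t', x) /\ `|f (t, x) - f (t', x)| < eps / 2.
    by apply: h => //=; rewrite subrr normr0.
  rewrite [eps]splitr.
  apply: le_trans (ler_distD (f (t, x)) _ _) _.
  by rewrite lerD//; apply: ltW => //; rewrite distrC.
apply/cvgrPdist_le => eps eps0; have := N _ eps0.
apply: filterS => y hy.
have cx := slice_cont01 hW fc.
have cy : cont01 (fun t => f (t, y)) by apply: (slice_cont01 _ fc) => t /hy[].
have -> : int01 (fun t => f (t, x)) - int01 (fun t => f (t, y)) =
    int01 (fun t => -1 * f (t, y) + f (t, x)).
  by rewrite int01_linear// mulN1r addrC.
apply: int01_norm_le => [t t01|t /hy[_]]; last by rewrite mulN1r addrC.
by apply: cvgD; [apply: cvgM; [exact: cvg_cst|exact: cy]|exact: cx].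
Qed.

Lemma linear_bounded E (l : E -> R^o) : linear l -> continuous l ->
  exists2 k : R, 0 < k & forall x, `|l x| <= k * `|x|.
Proof.
move=> ll lc; pose lM := GRing.isLinear.Build _ _ _ _ _ ll.
pose lL : {linear E -> R^o} := HB.pack l lM.
exact: (@linear_lipschitz _ _ _ lL lc).
Qed.

(** Differentiation under the integral sign.  By the mean value theorem and
    continuity of the partial derivatives, each t has a neighbourhood on which the
    first-order error is at most eps |y - x|; by [near01] the same y work for all t
    at once, and the bound is integrated. *)
Lemma param_diff E (W : set (R^o * E)) (f : R^o * E -> R^o) x :
  finite_dim E -> open W -> (forall t, 0 <= t <= 1 -> W (t, x)) -> Ck 1 W f ->
  let g := fun x => int01 (fun t => f (t, x)) : R^o in
  differentiable g x /\ forall v, 'D_v g x = int01 (fun t => 'D_(0, v) f (t, x)).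
Proof.
move=> [I [e [l [ll le]]]] Wo hW [f1 f2] g.
have fc p : W p -> {for p, continuous f}.
  by move=> /f1; exact: differentiable_continuous.
pose c i := int01 (fun t => 'D_(0, e i) f (t, x)).
pose L h : R^o := \sum_i l i h *: (c i : R^o).
have Llin : linear L.
  move=> a u v; rewrite /L scaler_sumr -big_split; apply: eq_bigr => i _ /=.
  by have [-> _] := ll i; rewrite scalerDl scalerA.
have Lcont : continuous L.
  move=> h; have := @Ck_sum _ E R^o 0 setT I (index_enum I) (fun i h => l i h *: (c i : R^o)) openT.
  move=> H; apply: (H _ h) => // i y _.
  by have [_ lc] := ll i; apply: cvgZr_tmp; exact: lc.
have dD p (h : E) : W p -> 'D_(0, h) f p = \sum_i l i h *: ('D_(0, e i) f p).
  move=> Wp; rewrite [in LHS](le h).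
  apply: (@linear_sum_coord _ _ _ _ (fun v => 'D_(0, v) f p)) => a u v.
  have dl := derive_linear (f1 p Wp).
  rewrite -dl; congr ('D__ f p).
  by apply/pair_equal_spec; split => //=; rewrite scaler0 addr0.
have gc (v : E) : cont01 (fun t => 'D_(0, v) f (t, x)).
  by exact: (slice_cont01 hW (f2 (0, v))).
have LE v : L v = int01 (fun t => 'D_(0, v) f (t, x)).
  have il : linear (fun v : E => int01 (fun t => 'D_(0, v) f (t, x)) : R^o).
    move=> a u w; rewrite -int01_linear//; apply: int01_ext => t /hW Wt.
    have dl := derive_linear (f1 _ Wt).
    rewrite -dl; congr ('D__ f _).
    by apply/pair_equal_spec; split => //=; rewrite scaler0 addr0.
  by rewrite [in RHS](le v) (linear_sum_coord _ _ il).
pose LM := GRing.isLinear.Build _ _ _ _ _ Llin.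
pose LL : {linear E -> R^o} := HB.pack L LM.
suff h : forall eps : R, 0 < eps ->
     \forall h \near (0 : E), `|g (h + x) - g x - LL h| <= eps * `|h|.
  have [dg dgE] := diff_intro (L := LL) Lcont h.
  by split=> // v; rewrite deriveE// dgE /= LE.
move=> eps eps0.
have [k hk] : exists k : I -> R, forall i, 0 < k i /\ forall v, `|l i v| <= k i * `|v|.
  have /choice[k hk] : forall i, exists k : R, 0 < k /\ forall v, `|l i v| <= k * `|v|.
    by move=> i; have [ll1 ll2] := ll i; have [k k0 hk] := linear_bounded ll1 ll2; exists k.
  by exists k.
(* K exceeds the sum of the norms of the coordinates of E, so that the partial
   increments, each below eps / K, add up to at most eps |y - x|. *)
pose K := \sum_i k i + 1.
have K0 : 0 < K by rewrite ltr_wpDl// sumr_ge0// => i _; rewrite ltW// (hk i).1.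
have eK : 0 < eps / K / 2 by rewrite !divr_gt0.
pose P y := forall t, 0 <= t <= 1 -> W (t, y) /\
    `|f (t, y) - f (t, x) - 'D_(0, y - x) f (t, x)| <= eps * `|y - x|.
have N : \forall y \near x, P y.
  apply: near01 => t /hW Wt.
  have /prod_ball[r r0 hr] : nbhs ((t, x) : R^o * E) [set p | W p /\
      forall i, `|'D_(0, e i) f (t, x) - 'D_(0, e i) f p| < eps / K / 2].
    apply: filterI; first exact: (open_near Wo Wt).
    have gi i : nbhs ((t, x) : R^o * E)
        [set p | `|'D_(0, e i) f (t, x) - 'D_(0, e i) f p| < eps / K / 2].
      by move/cvgrPdist_lt : (f2 (0, e i) _ Wt) => /(_ _ eK).
    exact: (@filter_forall _ _ _ _ (nbhs_filter ((t, x) : R^o * E)) gi).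
  exists r => // t' y tt' xy; split; first by have [] := hr t' y tt' xy.
  have xs (s : R) : 0 <= s <= 1 -> `|x - (x + s *: (y - x))| < r.
    move=> /andP[s0 s1]; rewrite opprD addNKr normrN normrZ ger0_norm//.
    by rewrite distrC in xy; apply: le_lt_trans xy; rewrite ler_piMl.
  have seg (s : R) : (t', x) + s *: (0, y - x) = (t', x + s *: (y - x)) :> R^o * E.
    by apply/pair_equal_spec; split => //=; rewrite scaler0 addr0.
  have Wx : W (t', x) by have [] := hr t' x tt' _; rewrite //= subrr normr0.
  have [|s /andP[/ltW c0 /ltW c1]] := @mvt_line R (R^o * E)%type f (t', x) (0, y - x) 1 ltr01.
    by move=> s /xs xsr; apply: f1; rewrite seg; have [] := hr t' _ tt' xsr.
  rewrite !seg scale1r subrKC mul1r => ->.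
  have xc := xs s; rewrite c0 c1 in xc; have {}xc := xc isT.
  have [Wc gcc] := hr t' _ tt' xc.
  have xx : `|x - x| < r by rewrite subrr normr0.
  have [_ gx] := hr t' x tt' xx.
  rewrite !dD// -sumrB.
  apply: le_trans (ler_norm_sum _ _ _) _.
  apply: (@le_trans _ _ (\sum_i k i * (eps / K * `|y - x|))); last first.
    rewrite -mulr_suml mulrA mulrCA; rewrite ler_wpM2r//.
    by rewrite ger_pMr// ler_pdivrMr// mul1r lerDl.
  apply: ler_sum => i _; have [k0 hki] := hk i.
  rewrite -scalerBr normrM [eps / K * _]mulrC mulrA ler_pM//.
  rewrite [leRHS]splitr; apply: le_trans (ler_distD ('D_(0, e i) f (t, x)) _ _) _.
  by rewrite lerD// ltW// 1?distrC.
have sh : (fun h : E => h + x) @ (0 : E) --> x.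
  by rewrite -[X in _ --> X](add0r x); apply: cvgD; [exact: cvg_id|exact: cvg_cst].
have N0 : \forall h \near (0 : E), P (h + x) := sh _ N.
apply: filterS N0 => h hh.
rewrite -[LL h]/(L h) LE /g.
have cx : cont01 (fun t => f (t, x)) by exact: (slice_cont01 hW fc).
have ch : cont01 (fun t => f (t, h + x)).
  by apply: (slice_cont01 (W := W) _ fc) => t /hh[].
have -> : int01 (fun t => f (t, h + x)) - int01 (fun t => f (t, x)) -
    int01 (fun t => 'D_(0, h) f (t, x)) =
   int01 (fun t => -1 * f (t, x) + (-1 * 'D_(0, h) f (t, x) + f (t, h + x))).
  rewrite int01_linear//; last exact: cont01_lin.
  by rewrite int01_linear//; ring.
apply: int01_norm_le => [|t /hh[_]]; first by do 2 apply: cont01_lin => //.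
rewrite addrK; apply: le_trans; rewrite le_eqVlt; apply/orP; left; apply/eqP.
by congr (`|_|); rewrite !mulN1r addrC addrAC addrC addrCA addrC.
Qed.

Lemma Ck_param E (W : set (R^o * E)) (U : set E) (f : R^o * E -> R^o) k :
  finite_dim E -> open W -> open U -> (forall t x, 0 <= t <= 1 -> U x -> W (t, x)) ->
  Ck k W f -> Ck k U (fun x => int01 (fun t => f (t, x)) : R^o).
Proof.
move=> Ef Wo Uo hW; elim: k f => [|k IH] f hf.
  by move=> x Ux; apply: (param_cont Wo) => // t /hW; apply.
have [f1 f2] := hf.
have hf1 : Ck 1 W f.
  split=> // v p Wp; exact: (Ck_le0 (f2 v) Wp).
have d x (Ux : U x) := param_diff Ef Wo (fun t t01 => hW t x t01 Ux) hf1.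
split=> [x /d[]//|v].
by apply: Ck_ext Uo _ (IH _ (f2 (0, v))) => x /d[_ ->].
Qed.

End Param.

(** * Smooth maps between manifolds *)

Section Csmooth.
Context (R : realType).
Implicit Types E F H : normedModType R.

Lemma Csmooth_sub E F (U V : set E) (f : E -> F) :
  U `<=` V -> Csmooth V f -> Csmooth U f.
Proof. by move=> UV h k; apply: Ck_sub UV (h k). Qed.

Lemma Csmooth_ext E F (U : set E) (f g : E -> F) :
  open U -> (forall x, U x -> f x = g x) -> Csmooth U f -> Csmooth U g.
Proof. by move=> Uo fg h k; apply: Ck_ext Uo fg (h k). Qed.

Lemma Csmooth_local E F (U : set E) (f : E -> F) :
  (forall x, U x -> exists V, V x /\ Csmooth V f) -> Csmooth U f.
Proof.
by move=> h k; apply: Ck_local => x /h[V [Vx hV]]; exists V.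
Qed.

Lemma Csmooth_lin E F (U : set E) (L : E -> F) :
  linear L -> continuous L -> Csmooth U L.
Proof. by move=> h1 h2 k; apply: Ck_lin. Qed.

Lemma Csmooth_cst E F (U : set E) (a : F) : Csmooth U (fun=> a).
Proof. by move=> k; apply: Ck_cst. Qed.

Lemma Csmooth_pair E F H (U : set E) (f : E -> F) (g : E -> H) :
  open U -> Csmooth U f -> Csmooth U g -> Csmooth U (fun x => (f x, g x)).
Proof. by move=> Uo hf hg k; apply: Ck_pair. Qed.

Lemma Csmooth_comp E F H (U : set E) (V : set F) (f : E -> F) (g : F -> H) :
  finite_dim F -> finite_dim H -> open U -> open V -> (forall x, U x -> V (f x)) ->
  Csmooth U f -> Csmooth V g -> Csmooth U (g \o f).
Proof. by move=> ? ? Uo Vo UV hf hg k; apply: (Ck_comp _ _ Uo Vo UV). Qed.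

Lemma Csmooth_diff E F (U : set E) (f : E -> F) x :
  Csmooth U f -> U x -> differentiable f x.
Proof. by move=> h; apply: (Ck_diff (h 1)). Qed.

Lemma Csmooth_derive E F (U : set E) (f : E -> F) v :
  Csmooth U f -> Csmooth U ('D_v f).
Proof. by move=> h k; have [_ /(_ v)] := h k.+1. Qed.

End Csmooth.

Section Manifolds.
Context (R : realType).
Implicit Types E F H : normedModType R.

(** What the analysis of maps uses of a smooth manifold, together with a
    finite-dimensional model, which reduces composition to [Ck_comp]. *)
Definition smooth_atlas E (M : charted E) :=
  [/\ finite_dim E,
      forall p : M, atlas (chart_at p) /\ cdom (chart_at p) p,
      forall c : chart M E, atlas c -> is_chart c &
      forall c c' : chart M E, atlas c -> atlas c' ->
        Csmooth (cimg c `&` cfrom c @^-1` cdom c') (cto c' \o cfrom c)].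

Lemma open_preim (T U : topologicalType) (f : T -> U) (A : set T) (B : set U) :
  open A -> (forall x, A x -> {for x, continuous f}) -> open B ->
  open (A `&` f @^-1` B).
Proof.
move=> Ao fc Bo; rewrite openE => x [Ax Bx]; apply: filterI.
  exact: open_nbhs_nbhs.
have Bn : nbhs (f x) B by exact: open_nbhs_nbhs.
exact: (fc x Ax _ Bn).
Qed.

Section Charts.
Context E (M : charted E).
Hypothesis gM : smooth_atlas M.
Implicit Types (c : chart M E) (p : M).

Lemma atlas_at p : atlas (chart_at p).
Proof. by have [_ h _ _] := gM; have [] := h p. Qed.

Lemma cdom_at p : cdom (chart_at p) p.
Proof. by have [_ h _ _] := gM; have [] := h p. Qed.

Lemma open_cdom c : atlas c -> open (cdom c).
Proof. by have [_ _ h _] := gM; move=> /h[]. Qed.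

Lemma open_cimg c : atlas c -> open (cimg c).
Proof. by have [_ _ h _] := gM; move=> /h[]. Qed.

Lemma ctoK c p : atlas c -> cdom c p -> cfrom c (cto c p) = p.
Proof. by have [_ _ h _] := gM; move=> /h[_ _ h' _ _]; apply: h'. Qed.

Lemma cto_cont c p : atlas c -> cdom c p -> {for p, continuous (cto c)}.
Proof. by have [_ _ h _] := gM; move=> /h[_ _ _ h' _]; apply: h'. Qed.

Lemma cfrom_cont c x : atlas c -> cimg c x -> {for x, continuous (cfrom c)}.
Proof. by have [_ _ h _] := gM; move=> /h[_ _ _ _ h']; apply: h'. Qed.

Lemma cimg_cto c p : cdom c p -> cimg c (cto c p).
Proof. by move=> h; exists p. Qed.

Lemma cfromK c x : atlas c -> cimg c x -> cto c (cfrom c x) = x.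
Proof. by move=> ac [p cp <-]; rewrite ctoK. Qed.

Lemma open_chart c (O : set M) : atlas c -> open O ->
  open (cimg c `&` cfrom c @^-1` O).
Proof.
move=> ac Oo; apply: open_preim => //; first exact: open_cimg.
by move=> x; apply: cfrom_cont.
Qed.

Lemma cimg_at p : cimg (chart_at p) (cto (chart_at p) p).
Proof. by apply: cimg_cto; exact: cdom_at. Qed.

Lemma ctoK_at p : cfrom (chart_at p) (cto (chart_at p) p) = p.
Proof. by apply: ctoK; [exact: atlas_at|exact: cdom_at]. Qed.

Lemma finite_dim_model : finite_dim E. Proof. by have [] := gM. Qed.

End Charts.

Lemma cimg_vchart E : cimg (vchart E) = setT.
Proof. by apply/seteqP; split=> // x _; exists x. Qed.

Lemma smooth_atlas_vec E : finite_dim E -> smooth_atlas (vec E).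
Proof.
move=> Ef; split=> //; last by move=> c c' -> -> k; exact: Ck_id.
move=> c ->; split=> //=.
- exact: openT.
- by rewrite cimg_vchart; exact: openT.
- by move=> p _; exact: cvg_id.
- by move=> p _; exact: cvg_id.
Qed.

Lemma open_smooth_preim E F (M : charted E) (N : charted F) (O : set M) (f : M -> N)
   (B : set N) : smooth_on O f -> open O -> open B -> open (O `&` f @^-1` B).
Proof. by move=> [fc _] Oo Bo; apply: open_preim. Qed.

Lemma smooth_on_sub E F (M : charted E) (N : charted F) (O O' : set M) (f : M -> N) :
  O `<=` O' -> smooth_on O' f -> smooth_on O f.
Proof.
move=> OO [fc fs]; split=> [p /OO/fc//|a b aa ab].
by apply: Csmooth_sub (fs a b aa ab) => x [h1 [/OO h2 h3]].
Qed.

Lemma smooth_on_vec E F (O : set E) (f : E -> F) : open O ->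
  (@smooth_on R E F (vec E) (vec F) O f <-> Csmooth O f).
Proof.
move=> Oo; split=> [[_ /(_ (vchart E) (vchart F) erefl erefl)] | h].
  by apply: Csmooth_sub => x Ox; rewrite cimg_vchart.
split=> [x Ox|a b -> ->]; first exact: (Ck_le0 (h 0) Ox).
by apply: Csmooth_sub h => x [_ []].
Qed.

(** Smoothness of g o f in two given charts is local: near each point a chart of
    the intermediate manifold is inserted, and the composite of chart expressions
    is smooth. *)
Lemma smooth_on_comp E F H (M : charted E) (N : charted F) (P : charted H)
    (O : set M) (O' : set N) (f : M -> N) (g : N -> P) :
  smooth_atlas M -> smooth_atlas N -> smooth_atlas P -> open O -> open O' ->
  smooth_on O f -> smooth_on O' g ->
  smooth_on (O `&` f @^-1` O') (g \o f).
Proof.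
move=> gM gN gP Oo O'o sf sg; have [fc fs] := sf; have [gc gs] := sg; split.
  by move=> p [/fc pc /gc qc]; apply: continuous_comp.
move=> a b aa ab; apply: Csmooth_local => x [ax [[Ox O'x] bx]].
pose q := f (cfrom a x); pose d := chart_at q.
have ad : atlas d by exact: atlas_at.
have dq : cdom d q by exact: cdom_at.
pose B := O' `&` g @^-1` cdom b.
have Bo : open B by apply: open_smooth_preim => //; exact: open_cdom.
pose V := cimg a `&` cfrom a @^-1` (O `&` f @^-1` (cdom d `&` B)).
have Vo : open V.
  apply: open_chart => //; apply: open_smooth_preim => //.
  by apply: openI => //; exact: open_cdom.
exists V; split=> //.
have h := Csmooth_comp (finite_dim_model gN) (finite_dim_model gP) Vo (open_chart gN ad Bo)
  _ (Csmooth_sub _ (fs a d aa ad)) (gs d b ad ab).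
apply: Csmooth_ext Vo _ (h _ _) => [y [ay [Oy [dy By]]]|y [ay [Oy [dy By]]]|y [ay [Oy [dy By]]]].
- by rewrite /= ctoK.
- split; first exact: cimg_cto.
  by rewrite /preimage /= ctoK.
- by [].
Qed.

Lemma smooth_on_cto E (M : charted E) (c : chart M E) : smooth_atlas M -> atlas c ->
  @smooth_on R E E M (vec E) (cdom c) (cto c).
Proof.
move=> gM ac; split=> [p cp|a b aa ->]; first exact: (cto_cont gM).
have [_ _ _ h] := gM; apply: Csmooth_sub (h a c aa ac) => x [ax [cx _]] //.
Qed.

Lemma smooth_on_cfrom E (M : charted E) (c : chart M E) : smooth_atlas M -> atlas c ->
  @smooth_on R E E (vec E) M (cimg c) (cfrom c).
Proof.
move=> gM ac; split=> [p cp|a b -> ab]; first exact: (cfrom_cont gM).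
have [_ _ _ h] := gM; apply: Csmooth_sub (h c b ac ab) => x [ax [cx _]] //.
Qed.

Lemma smooth_on_cst E F (M : charted E) (N : charted F) (O : set M) (q : N) :
  smooth_on O (fun _ : M => q).
Proof.
by split=> [p _|a b _ _]; [exact: cst_continuous|exact: Csmooth_cst].
Qed.

Lemma smooth_on_id E (M : charted E) (O : set M) : smooth_atlas M ->
  smooth_on O (fun p : M => p).
Proof.
move=> [_ _ _ h]; split=> [p _|a b aa ab]; first exact: cvg_id.
by apply: Csmooth_sub (h a b aa ab) => x [ax []].
Qed.

End Manifolds.

(** * Products of manifolds *)

Section Products.
Context (R : realType).
Implicit Types E F H : normedModType R.

Lemma cont_pair (T U V : topologicalType) (f : T -> U) (g : T -> V) (p : T) :
  {for p, continuous f} -> {for p, continuous g} ->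
  {for p, continuous (fun x => (f x, g x))}.
Proof. by move=> fc gc; apply: cvg_pair. Qed.

Lemma cont_fst (T U V : topologicalType) (f : T -> V) (p : T * U) :
  {for p.1, continuous f} -> {for p, continuous (fun x : T * U => f x.1)}.
Proof. by move=> fc; apply: (@continuous_comp _ _ _ fst f) => //; exact: cvg_fst. Qed.

Lemma cont_snd (T U V : topologicalType) (f : U -> V) (p : T * U) :
  {for p.2, continuous f} -> {for p, continuous (fun x : T * U => f x.2)}.
Proof. by move=> fc; apply: (@continuous_comp _ _ _ snd f) => //; exact: cvg_snd. Qed.

Lemma open_prod (T U : topologicalType) (A : set T) (B : set U) :
  open A -> open B -> open (A `*` B).
Proof.
move=> Ao Bo; rewrite openE => -[x y] [/= Ax By].
by exists (A, B) => //; split => /=; exact: open_nbhs_nbhs.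
Qed.

Lemma cimg_prod (M N E F : Type) (c : chart M E) (d : chart N F) :
  cimg (prod_chart c d) = cimg c `*` cimg d.
Proof.
apply/seteqP; split=> [_ [[p q] [/= cp dq] <-]|[x y] [/= [p cp <-] [q dq <-]]].
  by split; [exists p|exists q].
by exists (p, q).
Qed.

Lemma fst_linear E F : linear (fst : E * F -> E). Proof. by []. Qed.
Lemma snd_linear E F : linear (snd : E * F -> F). Proof. by []. Qed.
Lemma fst_continuous E F : continuous (fst : E * F -> E).
Proof. by move=> p; exact: cvg_fst. Qed.
Lemma snd_continuous E F : continuous (snd : E * F -> F).
Proof. by move=> p; exact: cvg_snd. Qed.

Lemma Csmooth_comp_fst E F H (U : set (E * F)) (V : set E) (f : E -> H) :
  finite_dim E -> finite_dim H -> open U -> open V -> (forall x, U x -> V x.1) ->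
  Csmooth V f -> Csmooth U (fun x => f x.1).
Proof.
move=> Ef Hf Uo Vo UV hf; apply: (Csmooth_comp (f := fst) Ef Hf Uo Vo) => //.
by apply: Csmooth_lin; [exact: fst_linear|exact: fst_continuous].
Qed.

Lemma Csmooth_comp_snd E F H (U : set (E * F)) (V : set F) (f : F -> H) :
  finite_dim F -> finite_dim H -> open U -> open V -> (forall x, U x -> V x.2) ->
  Csmooth V f -> Csmooth U (fun x => f x.2).
Proof.
move=> Ef Hf Uo Vo UV hf; apply: (Csmooth_comp (f := snd) Ef Hf Uo Vo) => //.
by apply: Csmooth_lin; [exact: snd_linear|exact: snd_continuous].
Qed.

Lemma smooth_atlas_prod E F (M : charted E) (N : charted F) :
  smooth_atlas M -> smooth_atlas N -> smooth_atlas (prod_mfd M N).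
Proof.
move=> gM gN; have Ef := finite_dim_model gM; have Ff := finite_dim_model gN; split.
- exact: finite_dim_prod.
- move=> p; split; last by split; exact: cdom_at.
  by exists (chart_at p.1), (chart_at p.2); split => //; exact: atlas_at.
- move=> _ [c [d [ac ad ->]]]; split.
  + by apply: open_prod; [exact: open_cdom ac|exact: open_cdom ad].
  + by rewrite cimg_prod; apply: open_prod; [exact: open_cimg ac|exact: open_cimg ad].
  + by move=> [p q] [/= cp dq]; rewrite !ctoK.
  + move=> [p q] [/= cp dq]; apply: cont_pair.
      by apply: cont_fst => /=; exact: cto_cont ac cp.
    by apply: cont_snd => /=; exact: cto_cont ad dq.
  + move=> [x y]; rewrite cimg_prod => -[/= cx dy]; apply: cont_pair.
      by apply: cont_fst => /=; exact: cfrom_cont ac cx.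
    by apply: cont_snd => /=; exact: cfrom_cont ad dy.
- move=> _ _ [c [d [ac ad ->]]] [c' [d' [ac' ad' ->]]].
  have [_ _ _ hM] := gM; have [_ _ _ hN] := gN.
  rewrite cimg_prod.
  rewrite (_ : _ `&` _ = (cimg c `&` cfrom c @^-1` cdom c') `*`
                         (cimg d `&` cfrom d @^-1` cdom d')); last first.
    by apply/seteqP; split=> [[x y] [[? ?] [? ?]]|[x y] [[? ?] [? ?]]].
  have oc := open_chart gM ac (open_cdom gM ac').
  have od := open_chart gN ad (open_cdom gN ad').
  have oo := open_prod oc od.
  apply: Csmooth_pair => //.
    by apply: (Csmooth_comp_fst Ef Ef oo oc _ (hM c c' ac ac')) => x [].
  by apply: (Csmooth_comp_snd Ff Ff oo od _ (hN d d' ad ad')) => x [].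
Qed.

Lemma smooth_on_fst E F (M : charted E) (N : charted F) (O : set (prod_mfd M N)) :
  smooth_atlas M -> smooth_atlas N -> open O ->
  smooth_on O (fun p : prod_mfd M N => p.1 : M).
Proof.
move=> gM gN Oo; have Ef := finite_dim_model gM; have Ff := finite_dim_model gN; split.
  by move=> p _; exact: cvg_fst.
move=> a b aa ab; have [c [d [ac ad ae]]] := aa; subst a.
have [_ _ _ hM] := gM.
have oc := open_chart gM ac (open_cdom gM ab).
have oo : open ((cimg c `&` cfrom c @^-1` cdom b) `*` cimg d).
  by apply: open_prod => //; exact: open_cimg ad.
apply: (Csmooth_sub _ (Csmooth_comp_fst (F := F) Ef Ef oo oc _ (hM c b ac ab))).
  by rewrite cimg_prod => -[x y] [[/= ? ?] [_ /= ?]].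
by move=> x [].
Qed.

Lemma smooth_on_snd E F (M : charted E) (N : charted F) (O : set (prod_mfd M N)) :
  smooth_atlas M -> smooth_atlas N -> open O ->
  smooth_on O (fun p : prod_mfd M N => p.2 : N).
Proof.
move=> gM gN Oo; have Ef := finite_dim_model gM; have Ff := finite_dim_model gN; split.
  by move=> p _; exact: cvg_snd.
move=> a b aa ab; have [c [d [ac ad ae]]] := aa; subst a.
have [_ _ _ hN] := gN.
have od := open_chart gN ad (open_cdom gN ab).
have oo : open (cimg c `*` (cimg d `&` cfrom d @^-1` cdom b)).
  by apply: open_prod => //; exact: open_cimg ac.
apply: (Csmooth_sub _ (Csmooth_comp_snd (E := E) Ff Ff oo od _ (hN d b ad ab))).
  by rewrite cimg_prod => -[x y] [[/= ? ?] [_ /= ?]].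
by move=> x [].
Qed.

Lemma smooth_on_pair E F H (M : charted E) (N : charted F) (P : charted H)
    (O : set M) (f : M -> N) (g : M -> P) :
  smooth_atlas M -> smooth_atlas N -> smooth_atlas P -> open O ->
  smooth_on O f -> smooth_on O g ->
  @smooth_on R E (F * H)%type M (prod_mfd N P) O (fun p => (f p, g p)).
Proof.
move=> gM gN gP Oo sf sg; have [fc fs] := sf; have [gc gs] := sg; split.
  by move=> p Op; apply: cont_pair; [exact: fc|exact: gc].
move=> a b aa ab; have [c [d [ac ad ae]]] := ab; subst b.
have o1 := open_chart gM aa (open_smooth_preim sf Oo (open_cdom gN ac)).
have o2 := open_chart gM aa (open_smooth_preim sg Oo (open_cdom gP ad)).
pose V := (cimg a `&` cfrom a @^-1` (O `&` f @^-1` cdom c)) `&`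
  (cimg a `&` cfrom a @^-1` (O `&` g @^-1` cdom d)).
have Vo : open V by exact: openI.
apply: (@Csmooth_sub _ _ _ _ V).
  by move=> x [ax [Ox [/= cx dx]]].
apply: Csmooth_pair => //.
  by apply: Csmooth_sub (fs a c aa ac) => x [].
by apply: Csmooth_sub (gs a d aa ad) => x [].
Qed.

End Products.

(** * Tangent maps *)

Section Tangent.
Context (R : realType).
Implicit Types E F H : normedModType R.

Lemma smooth_on_chart_diff E F (M : charted E) (N : charted F) (O : set M) (f : M -> N) p :
  smooth_atlas M -> smooth_atlas N -> smooth_on O f -> O p ->
  differentiable (cto (chart_at (f p)) \o f \o cfrom (chart_at p)) (cto (chart_at p) p).
Proof.
move=> gM gN [fc fs] Op.
apply: (Csmooth_diff (fs _ _ (atlas_at gM p) (atlas_at gN (f p)))).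
split; first exact: cimg_at.
by rewrite /preimage /= ctoK_at//; split=> //; exact: cdom_at.
Qed.

Lemma tmap_linear E F (M : charted E) (N : charted F) (f : M -> N) p :
  linear (tmap f p).
Proof. by move=> a u v; rewrite /tmap linearP. Qed.

Lemma near_chart E (M : charted E) (O : set M) p :
  smooth_atlas M -> open O -> O p ->
  \forall x \near cto (chart_at p) p, cimg (chart_at p) x /\ O (cfrom (chart_at p) x).
Proof.
move=> gM Oo Op; have ap := atlas_at gM p.
apply: (open_near (open_chart gM ap Oo)); split; first exact: cimg_at.
by rewrite /preimage /= ctoK_at.
Qed.

(** The chain rule for chart expressions; they compose only near the base point,
    where the inserted chart is inverted by its parametrization. *)
Lemma tmap_comp E F H (M : charted E) (N : charted F) (P : charted H)
    (O : set M) (O' : set N) (f : M -> N) (g : N -> P) p v :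
  smooth_atlas M -> smooth_atlas N -> smooth_atlas P -> open O ->
  smooth_on O f -> smooth_on O' g -> O p -> O' (f p) ->
  tmap (g \o f) p v = tmap g (f p) (tmap f p v).
Proof.
move=> gM gN gP Oo sf sg Op O'p.
have df := smooth_on_chart_diff gM gN sf Op.
have dg := smooth_on_chart_diff gN gP sg O'p.
pose cp := chart_at p; pose cf := chart_at (f p).
pose f' := cto cf \o f \o cfrom cp; pose g' := cto (chart_at (g (f p))) \o g \o cfrom cf.
have e : f' (cto cp p) = cto cf (f p) by rewrite /f' /= ctoK_at.
have dg' : differentiable g' (f' (cto cp p)) by rewrite e.
have n : \forall x \near cto cp p,
    (g' \o f') x = (cto (chart_at (g (f p))) \o (g \o f) \o cfrom cp) x.
  have := near_chart gM (open_smooth_preim sf Oo (open_cdom gN (atlas_at gN (f p)))) (conj Op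
    (cdom_at gN (f p))).
  apply: filterS => x [_ [_ cx]].
  by rewrite /g' /f' /= ctoK//; exact: atlas_at.
have [_ nE] := near_eq_diff n (differentiable_comp df dg').
have cE : 'd (g' \o f') (cto cp p) = 'd g' (f' (cto cp p)) \o 'd f' (cto cp p) :> (E -> H).
  exact: diff_comp.
rewrite -[LHS]/('d (cto (chart_at (g (f p))) \o (g \o f) \o cfrom cp) (cto cp p) v).
by rewrite nE cE /= e.
Qed.

Lemma tmap_ext E F (M : charted E) (N : charted F) (O O' : set M) (f g : M -> N) p v :
  smooth_atlas M -> smooth_atlas N -> open O -> O p -> smooth_on O' f -> O' p ->
  (forall x, O x -> f x = g x) -> tmap f p v = tmap g p v.
Proof.
move=> gM gN Oo Op sf O'p fg.
have df := smooth_on_chart_diff gM gN sf O'p.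
rewrite /tmap -(fg p Op).
have n : \forall x \near cto (chart_at p) p,
    (cto (chart_at (f p)) \o f \o cfrom (chart_at p)) x =
    (cto (chart_at (f p)) \o g \o cfrom (chart_at p)) x.
  by apply: filterS (near_chart gM Oo Op) => x [_ Ox] /=; rewrite (fg _ Ox).
by have [_ ->] := near_eq_diff n df.
Qed.

Lemma tmap_id E (M : charted E) (p : M) v : smooth_atlas M ->
  tmap (fun x : M => x) p v = v.
Proof.
move=> gM; rewrite /tmap.
have n : \forall x \near cto (chart_at p) p,
    id x = (cto (chart_at p) \o (fun x => x) \o cfrom (chart_at p)) x.
  apply: filterS (near_chart gM openT (I : setT p)) => x [cx _] /=.
  by rewrite cfromK//; exact: atlas_at.
have [_ ->] := near_eq_diff n (@ex_diff _ _ _ _ _ _ _ (is_diff_id _)).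
by rewrite diff_val.
Qed.

(** Tangent vectors at p are coordinates in the preferred chart at p, so the
    parametrization of that chart has the identity as tangent map. *)
Lemma tmap_cfrom E (M : charted E) (p : M) v : smooth_atlas M ->
  @tmap R E E (vec E) M (cfrom (chart_at p)) (cto (chart_at p) p) v = v.
Proof.
move=> gM; rewrite /tmap /= ctoK_at//.
have n : \forall x \near cto (chart_at p) p,
    id x = (cto (chart_at p) \o cfrom (chart_at p) \o id) x.
  apply: filterS (near_chart gM openT (I : setT p)) => x [cx _] /=.
  by rewrite cfromK//; exact: atlas_at.
have [_ ->] := near_eq_diff n (@ex_diff _ _ _ _ _ _ _ (is_diff_id _)).
by rewrite diff_val.
Qed.

Lemma tmap_vec E F (f : E -> F) x v : differentiable f x ->
  @tmap R E F (vec E) (vec F) f x v = 'D_v f x.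
Proof. by move=> df; rewrite deriveE. Qed.

Lemma tmap_fst E F (M : charted E) (N : charted F) (z : prod_mfd M N) w :
  smooth_atlas M -> smooth_atlas N -> tmap (fun p : prod_mfd M N => p.1 : M) z w = w.1.
Proof.
move=> gM gN; have gMN := smooth_atlas_prod gM gN; rewrite /tmap.
have n : \forall x \near cto (chart_at z) z,
    fst x = (cto (chart_at z.1) \o (fun p : prod_mfd M N => p.1 : M) \o cfrom (chart_at z)) x.
  apply: filterS (near_chart gMN openT (I : setT z)) => x [cx _] /=.
  by move: cx; rewrite cimg_prod => -[cx _]; rewrite cfromK//; exact: atlas_at.
have [df dfE] := linear_diff (cto (chart_at z) z) (@fst_linear R E F) (@fst_continuous R E F).
by have [_ ->] := near_eq_diff n df; rewrite dfE.
Qed.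

Lemma tmap_snd E F (M : charted E) (N : charted F) (z : prod_mfd M N) w :
  smooth_atlas M -> smooth_atlas N -> tmap (fun p : prod_mfd M N => p.2 : N) z w = w.2.
Proof.
move=> gM gN; have gMN := smooth_atlas_prod gM gN; rewrite /tmap.
have n : \forall x \near cto (chart_at z) z,
    snd x = (cto (chart_at z.2) \o (fun p : prod_mfd M N => p.2 : N) \o cfrom (chart_at z)) x.
  apply: filterS (near_chart gMN openT (I : setT z)) => x [cx _] /=.
  by move: cx; rewrite cimg_prod => -[_ cx]; rewrite cfromK//; exact: atlas_at.
have [df dfE] := linear_diff (cto (chart_at z) z) (@snd_linear R E F) (@snd_continuous R E F).
by have [_ ->] := near_eq_diff n df; rewrite dfE.
Qed.

End Tangent.

(** * Matrix-valued functions *)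

Section FdimLinear.
Context (R : realType) (E F : normedModType R).

Lemma finite_dim_linear_continuous (f : E -> F) : finite_dim E -> linear f -> continuous f.
Proof.
move=> [I [e [l [ll le]]]] fl x.
have h i : Ck 0 setT ( *:%R^~ (f (e i)) \o l i).
  have [lli lci] := ll i.
  move=> y _; apply: continuous_comp; first exact: lci.
  exact: scalel_continuous.
have := Ck_ext openT _ (Ck_sum (index_enum I) openT h) => /(_ f) hf.
apply: (hf _ x) => // y _ /=.
by rewrite [in RHS](le y) linear_sum_coord.
Qed.

End FdimLinear.

Section MatrixCalculus.
Context (R : realType) (X : normedModType R).

(** Differentiability of matrix functions is taken entrywise, so that rules for
    products of matrices reduce to those for products of scalars. *)
Definition mx_differentiable m n (A : X -> 'M[R]_(m, n)) x :=
  forall i j, differentiable (fun y => A y i j : R^o) x.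

Definition mx_derive m n w (A : X -> 'M[R]_(m, n)) x : 'M[R]_(m, n) :=
  \matrix_(i, j) 'D_w (fun y => A y i j : R^o) x.

Lemma mx_differentiable_cst m n (A : 'M[R]_(m, n)) x : mx_differentiable (fun=> A) x.
Proof. by move=> i j; exact: differentiable_cst. Qed.

Lemma mx_derive_cst m n w (A : 'M[R]_(m, n)) x : mx_derive w (fun=> A) x = 0.
Proof. by apply/matrixP => i j; rewrite !mxE derive_cst. Qed.

Lemma mx_derive_near m n w (A B : X -> 'M[R]_(m, n)) x :
  (\forall y \near x, A y = B y) -> mx_derive w A x = mx_derive w B x.
Proof.
move=> AB; apply/matrixP => i j; rewrite !mxE; apply: near_eq_derive.
by apply: filterS AB => y ->.
Qed.

Lemma mulmx_entry m n p (A : X -> 'M[R]_(m, n)) (B : X -> 'M[R]_(n, p)) i j :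
  (fun y => (A y *m B y) i j : R^o) = (fun y => \sum_k A y i k * B y k j : R^o).
Proof. by apply/funext => y; rewrite mxE. Qed.

Lemma mx_differentiable_mul m n p (A : X -> 'M[R]_(m, n)) (B : X -> 'M[R]_(n, p)) x :
  mx_differentiable A x -> mx_differentiable B x -> mx_differentiable (fun y => A y *m B y) x.
Proof.
move=> dA dB i j; rewrite mulmx_entry; apply: differentiable_bigsum => k.
exact: differentiable_mul (dA i k) (dB k j).
Qed.

Lemma mx_derive_mul m n p w (A : X -> 'M[R]_(m, n)) (B : X -> 'M[R]_(n, p)) x :
  mx_differentiable A x -> mx_differentiable B x ->
  mx_derive w (fun y => A y *m B y) x = mx_derive w A x *m B x + A x *m mx_derive w B x.
Proof.
move=> dA dB; apply/matrixP => i j; rewrite !mxE mulmx_entry derive_bigsum.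
  rewrite -big_split; apply: eq_bigr => k _ /=.
  by rewrite derive_mul// !mxE.
by move=> k; exact: differentiable_mul (dA i k) (dB k j).
Qed.

(** Differentiate A A^-1 = 1. *)
Lemma mx_derive_inv n w (A : X -> 'M[R]_n) x :
  (\forall y \near x, A y \in unitmx) -> mx_differentiable A x ->
  mx_differentiable (fun y => invmx (A y)) x ->
  mx_derive w (fun y => invmx (A y)) x =
  - (invmx (A x) *m mx_derive w A x *m invmx (A x)).
Proof.
move=> Au dA dI; have Ax := nbhs_singleton Au.
have h : mx_derive w A x *m invmx (A x) + A x *m mx_derive w (fun y => invmx (A y)) x = 0.
  rewrite -mx_derive_mul// -(mx_derive_cst w 1%:M x); apply: mx_derive_near.
  by apply: filterS Au => y Ay; rewrite mulmxV.
apply/eqP; rewrite -addr_eq0 -[X in X + _](mulKmx Ax) -mulmxA -mulmxDr addrC h mulmx0.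
by [].
Qed.

Lemma Ck_det k n (U : set X) (A : X -> 'M[R]_n) : open U ->
  (forall i j, Ck k U (fun x => A x i j : R^o)) ->
  Ck k U (fun x => \det (A x) : R^o).
Proof.
move=> Uo hA; rewrite /determinant; apply: Ck_sum => // s.
have h := @Ck_prod R X k U _ (index_enum 'I_n) _ Uo (fun i => hA i (s i)).
exact: (CkM Uo (Ck_cst k U ((-1) ^+ s : R^o)) h).
Qed.

(** Cramer: the inverse is the adjugate, polynomial in the entries, divided by the
    determinant. *)
Lemma Ck_invmx k n (U : set X) (A : X -> 'M[R]_n) : open U ->
  (forall i j, Ck k U (fun x => A x i j : R^o)) ->
  (forall x, U x -> A x \in unitmx) ->
  forall i j, Ck k U (fun x => invmx (A x) i j : R^o).
Proof.
move=> Uo hA Au i j.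
have hd : Ck k U (fun x => (\det (A x))^-1 : R^o).
  apply: CkV => //; last exact: Ck_det.
  by move=> x /Au; rewrite unitmxE unitfE.
have hc : Ck k U (fun x => \adj (A x) i j : R^o).
  rewrite (_ : (fun x => _) =
      (fun x => (-1) ^+ (j + i) * \det (row' j (col' i (A x))) : R^o)); last first.
    by apply/funext => x; rewrite mxE.
  apply: (CkM Uo (Ck_cst k U ((-1) ^+ (j + i) : R^o))).
  apply: Ck_det => // a b.
  rewrite (_ : (fun x => _) = (fun x => A x (lift j a) (lift i b) : R^o))//.
  by apply/funext => x; rewrite !mxE.
apply: Ck_ext Uo _ (CkM Uo hd hc) => x /Au Ax.
by rewrite /invmx Ax [RHS]mxE.
Qed.

Definition Ck_mx m n k (U : set X) (A : X -> 'M[R]_(m, n)) :=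
  forall i j, Ck k U (fun x => A x i j : R^o).

Lemma Ck_mx_cst m n k U (A : 'M[R]_(m, n)) : Ck_mx k U (fun=> A).
Proof. by move=> i j; exact: Ck_cst. Qed.

Lemma Ck_mx_mul m n p k U (A : X -> 'M[R]_(m, n)) (B : X -> 'M[R]_(n, p)) :
  open U -> Ck_mx k U A -> Ck_mx k U B -> Ck_mx k U (fun x => A x *m B x).
Proof.
move=> Uo hA hB i j; rewrite mulmx_entry.
apply: Ck_sum => // l; exact: (CkM Uo (hA i l) (hB l j)).
Qed.

Lemma Ck_mx_differentiable m n k U (A : X -> 'M[R]_(m, n)) x :
  Ck_mx k.+1 U A -> U x -> mx_differentiable A x.
Proof. by move=> hA Ux i j; exact: (Ck_diff (hA i j) Ux). Qed.

End MatrixCalculus.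

Section Bounds.
Context (R : realType).

Lemma entry_le_norm m n (A : 'M[R]_(m, n)) i j : `|A i j| <= `|A|.
Proof.
rewrite [leRHS]/Num.norm /= mx_normrE; apply/bigmax_geP; right => /=.
by exists (i, j).
Qed.

Lemma mx_norm_le m n (A : 'M[R]_(m, n)) (c : R) : 0 <= c ->
  (forall i j, `|A i j| <= c) -> `|A| <= c.
Proof.
move=> c0 h; rewrite [leLHS]/Num.norm /= mx_normrE; apply/bigmax_leP; split=> //.
Qed.

Lemma mx_norm_tr m n (A : 'M[R]_(m, n)) : `|A^T| = `|A|.
Proof.
apply/eqP; rewrite eq_le !mx_norm_le// => i j.
  by have := entry_le_norm A^T j i; rewrite mxE.
by rewrite mxE; exact: entry_le_norm.
Qed.

Lemma mx11P (A B : 'M[R]_1) : A 0 0 = B 0 0 -> A = B.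
Proof. by move=> h; apply/matrixP => i j; rewrite !ord1. Qed.

Lemma tr_mx11 (A : 'M[R]_1) : A^T = A.
Proof. by apply: mx11P; rewrite mxE. Qed.

Lemma mx11_norm_le n (x : 'rV[R]_n) (S : 'M[R]_n) (y : 'cV[R]_n) (eps : R) :
  (forall i j, `|S i j| <= eps) ->
  `|(x *m S *m y) 0 0| <= eps * n%:R ^+ 2 * `|x| * `|y|.
Proof.
move=> hS; rewrite mxE; apply: le_trans (ler_norm_sum _ _ _) _.
apply: (@le_trans _ _ (\sum_(j < n) \sum_(i < n) (eps * `|x| * `|y|))).
  apply: ler_sum => j _; rewrite mxE mulr_suml.
  apply: le_trans (ler_norm_sum _ _ _) _; apply: ler_sum => i _.
  rewrite !normrM (mulrC `|x 0 i|); apply: ler_pM => //.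
    by apply: ler_pM => //; exact: entry_le_norm.
  exact: entry_le_norm.
rewrite !sumr_const card_ord -mulr_natr -mulr_natr.
rewrite le_eqVlt; apply/orP; left; apply/eqP; ring.
Qed.

End Bounds.

(** * A primitive of the inverse of a pencil of forms *)

Section Primitive.
Context (R : realType) (n : nat).
Local Notation E := 'cV[R]_n.
Variables (P0 : 'M[R]_n) (L : E -> 'M[R]_n).
Variable (C : 'rV[R]_n -> 'rV[R]_n -> 'rV[R]_n).
Hypothesis P0_anti : P0^T = - P0.
Hypothesis P0_unit : P0 \in unitmx.
Hypothesis L_lin : linear L.
Hypothesis L_anti : forall w, (L w)^T = - L w.
Hypothesis CL : forall x y w, C x y *m w = x *m L w *m y^T.
Hypothesis jacobi : forall mu x y z,
  C x y *m (P0 + L mu) *m z^T + C y z *m (P0 + L mu) *m x^T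
  + C z x *m (P0 + L mu) *m y^T = 0.

(** The bilinear form P0 + t L(mu) at the pair (t, mu): the values of the pencil
    along rays.  Keeping t and mu apart makes the integrand of the radial primitive
    a function on a product, to which differentiation under the integral applies. *)
Definition pencil (p : R^o * E) : 'M[R]_n := P0 + p.1 *: L p.2.
Definition pencil_inv (p : R^o * E) : 'M[R]_n := invmx (pencil p).
Definition pencil_dom : set (R^o * E) := [set p | pencil p \in unitmx].

Lemma pencil_linearZ a w : L (a *: w) = a *: L w.
Proof.
by have := L_lin a w 0; rewrite addr0 (linear_at0 L_lin) addr0.
Qed.

Lemma pencilE p : pencil p = P0 + L (p.1 *: p.2).
Proof. by rewrite pencil_linearZ. Qed.

Lemma pencil_anti p : (pencil p)^T = - pencil p.
Proof. by rewrite /pencil linearD linearZ /= P0_anti L_anti opprD scalerN. Qed.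

Lemma pencil_inv_anti p : pencil_dom p -> (pencil_inv p)^T = - pencil_inv p.
Proof.
move=> up; rewrite /pencil_inv trmx_inv pencil_anti.
apply: (can_inj (mulKmx up)); rewrite mulmxN mulmxV//.
rewrite -[X in X *m _]opprK mulNmx mulmxV//.
by rewrite -scaleN1r unitmxZ// unitrN1.
Qed.

Lemma Ck_fst k U : Ck k U (fst : R^o * E -> R^o).
Proof. by apply: Ck_lin => // p; exact: cvg_fst. Qed.

Lemma Ck_pencil k U i j : open U -> Ck k U (fun p => pencil p i j : R^o).
Proof.
move=> Uo.
have h : Ck k U (fun p => L p.2 i j : R^o).
  apply: Ck_lin => [a u v|].
    by rewrite /= L_lin !mxE.
  apply: finite_dim_linear_continuous; first by apply: finite_dim_prod;
    [exact: finite_dim_real|exact: finite_dim_mx].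
  by move=> a u v; rewrite /= L_lin !mxE.
apply: Ck_ext Uo _ (CkD Uo (Ck_cst k U (P0 i j : R^o)) (CkM Uo (Ck_fst k U) h)) => p _.
by rewrite !mxE.
Qed.

Lemma open_pencil_dom : open pencil_dom.
Proof.
have h := Ck_det openT (fun i j => @Ck_pencil 0 setT i j openT).
rewrite (_ : pencil_dom = setT `&` (fun p => \det (pencil p) : R^o) @^-1` [set x | x != 0]).
  apply: open_preim; [exact: openT|exact: h|].
  exact: open_neq.
by apply/seteqP; split=> p; rewrite /pencil_dom /= unitmxE unitfE; [|case].
Qed.

Lemma Ck_pencil_inv k i j : Ck k pencil_dom (fun p => pencil_inv p i j : R^o).
Proof.
apply: Ck_invmx => //; first exact: open_pencil_dom.
by move=> a b; apply: Ck_pencil; exact: open_pencil_dom.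
Qed.

Lemma mx_differentiable_pencil p : mx_differentiable pencil p.
Proof.
by move=> i j; exact: (Ck_diff (@Ck_pencil 1 setT i j openT) (I : setT p)).
Qed.

Lemma mx_differentiable_pencil_inv p : pencil_dom p -> mx_differentiable pencil_inv p.
Proof. by move=> up i j; exact: (Ck_diff (Ck_pencil_inv 1 i j) up). Qed.

Lemma mx_derive_pencil p s w : mx_derive (s, w) pencil p = s *: L p.2 + p.1 *: L w.
Proof.
apply/matrixP => i j; rewrite mxE.
have d1 : differentiable (fst : R^o * E -> R^o) p.
  exact: (Ck_diff (Ck_fst 1 setT) (I : setT p)).
have Ll : linear (fun q : R^o * E => L q.2 i j : R^o).
  by move=> a u v; rewrite /= L_lin !mxE.
have Lc : continuous (fun q : R^o * E => L q.2 i j : R^o).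
  apply: finite_dim_linear_continuous Ll; apply: finite_dim_prod;
    [exact: finite_dim_real|exact: finite_dim_mx].
have [d2 _] := linear_diff p Ll Lc.
rewrite (_ : (fun y => _) = (fun q : R^o * E => P0 i j : R^o) + (fun q =>
  q.1 * L q.2 i j : R^o)); last first.
  by apply/funext => q; rewrite !mxE.
rewrite deriveD; [|exact: derivable_cst|exact: diff_derivable (differentiable_mul d1 d2)].
rewrite derive_cst add0r derive_mul// (derive_lin _ _ Ll Lc) derive_lin//;
  last exact: fst_continuous.
by rewrite !mxE.
Qed.

Lemma mx_derive_pencil_inv p s w : pencil_dom p ->
  mx_derive (s, w) pencil_inv p =
  - (pencil_inv p *m (s *: L p.2 + p.1 *: L w) *m pencil_inv p).
Proof.
move=> up; rewrite mx_derive_inv ?mx_derive_pencil//.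
- exact: (open_near open_pencil_dom up).
- exact: mx_differentiable_pencil.
- exact: mx_differentiable_pencil_inv.
Qed.

(** The opposite of the 2-form inverse to the pencil, kept as a 1 x 1 matrix so that
    the derivative rules for matrix products apply. *)
Definition form (u v : E) (p : R^o * E) : 'M[R]_1 := u^T *m pencil_inv p *m v.

(** The integrand t Omega_(t mu)(mu, v) of the radial primitive. *)
Definition integrand (v : E) (p : R^o * E) : R^o := - (p.1 * form p.2 v p 0 0).

Lemma Ck_mx_snd_tr k U : Ck_mx k U (fun p : R^o * E => p.2^T).
Proof.
move=> i j; have Ll : linear (fun q : R^o * E => q.2^T i j : R^o).
  by move=> a u v; rewrite !mxE.
apply: Ck_lin => //; apply: finite_dim_linear_continuous Ll.
by apply: finite_dim_prod; [exact: finite_dim_real|exact: finite_dim_mx].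
Qed.

Lemma Ck_mx_pencil_inv k : Ck_mx k pencil_dom pencil_inv.
Proof. by move=> i j; exact: Ck_pencil_inv. Qed.

Lemma Ck_mx_form k u v : Ck_mx k pencil_dom (form u v).
Proof.
apply: Ck_mx_mul; [exact: open_pencil_dom| |exact: Ck_mx_cst].
apply: Ck_mx_mul; [exact: open_pencil_dom|exact: Ck_mx_cst|exact: Ck_mx_pencil_inv].
Qed.

Lemma Ck_mx_form_snd k v : Ck_mx k pencil_dom (fun p => form p.2 v p).
Proof.
apply: Ck_mx_mul; [exact: open_pencil_dom| |exact: Ck_mx_cst].
apply: Ck_mx_mul; [exact: open_pencil_dom|exact: Ck_mx_snd_tr|exact: Ck_mx_pencil_inv].
Qed.

Lemma Ck_integrand k v : Ck k pencil_dom (integrand v).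
Proof.
have Wo := open_pencil_dom.
have h := CkM Wo (Ck_cst k pencil_dom (-1 : R^o))
  (CkM Wo (Ck_fst k pencil_dom) (Ck_mx_form_snd k v 0 0)).
by apply: Ck_ext Wo _ h => p _; rewrite mulN1r.
Qed.

Lemma mx_derive_snd_tr p s w : mx_derive (s, w) (fun p : R^o * E => p.2^T) p = w^T.
Proof.
apply/matrixP => i j; rewrite mxE.
have Ll : linear (fun q : R^o * E => q.2^T i j : R^o).
  by move=> a u v; rewrite !mxE.
rewrite derive_lin//; apply: finite_dim_linear_continuous Ll.
by apply: finite_dim_prod; [exact: finite_dim_real|exact: finite_dim_mx].
Qed.

Lemma mx_derive_form u v p s w : pencil_dom p ->
  mx_derive (s, w) (form u v) p =
  - (u^T *m pencil_inv p *m (s *: L p.2 + p.1 *: L w) *m pencil_inv p *m v).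
Proof.
move=> up; have dI := mx_differentiable_pencil_inv up.
rewrite mx_derive_mul ?mx_derive_cst ?mulmx0 ?addr0; [|exact: mx_differentiable_mul
  (mx_differentiable_cst _ _) dI|exact: mx_differentiable_cst].
rewrite mx_derive_mul ?mx_derive_cst ?mul0mx ?add0r; [|exact: mx_differentiable_cst|exact: dI].
by rewrite mx_derive_pencil_inv// mulmxN mulNmx !mulmxA.
Qed.

Lemma mx_derive_form_snd v p s w : pencil_dom p ->
  mx_derive (s, w) (fun p => form p.2 v p) p = form w v p
  - (p.2^T *m pencil_inv p *m (s *: L p.2 + p.1 *: L w) *m pencil_inv p *m v).
Proof.
move=> up; have dI := mx_differentiable_pencil_inv up.
have dT : mx_differentiable (fun p : R^o * E => p.2^T) p.
  exact: Ck_mx_differentiable (Ck_mx_snd_tr 1 setT) I.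
rewrite mx_derive_mul ?mx_derive_cst ?mulmx0 ?addr0; [|exact: mx_differentiable_mul dT
  dI|exact: mx_differentiable_cst].
rewrite mx_derive_mul//.
by rewrite mx_derive_snd_tr mx_derive_pencil_inv// mulmxN mulmxDl mulNmx !mulmxA.
Qed.

Lemma derive_integrand v p w : pencil_dom p ->
  'D_(0, w) (integrand v) p =
  - (p.1 * form w v p 0 0)
  + p.1 * p.1 * (p.2^T *m pencil_inv p *m L w *m pencil_inv p *m v) 0 0.
Proof.
move=> up.
have d1 : differentiable (fst : R^o * E -> R^o) p.
  exact: (Ck_diff (Ck_fst 1 setT) (I : setT p)).
have d2 : differentiable (fun p => form p.2 v p 0 0 : R^o) p.
  exact: (Ck_mx_differentiable (Ck_mx_form_snd 1 v) up 0 0).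
rewrite /integrand deriveN; last exact: diff_derivable (differentiable_mul d1 d2).
rewrite derive_mul// derive_lin//; last exact: fst_continuous.
rewrite mul0r add0r.
have := mx_derive_form_snd v 0 w up => /matrixP/(_ 0 0); rewrite mxE => ->.
rewrite scale0r add0r -scalemxAr -!scalemxAl !mxE mulrDr opprD; congr (_ + _).
by rewrite mulrN opprK mulrA.
Qed.

Lemma derive_form u v p : pencil_dom p ->
  'D_(1, 0) (fun p : R^o * E => - (p.1 * (p.1 * form u v p 0 0)) : R^o) p =
  - (p.1 * form u v p 0 0) *+ 2
  + p.1 * p.1 * (u^T *m pencil_inv p *m L p.2 *m pencil_inv p *m v) 0 0.
Proof.
move=> up.
have d1 : differentiable (fst : R^o * E -> R^o) p.
  exact: (Ck_diff (Ck_fst 1 setT) (I : setT p)).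
have d2 : differentiable (fun p => form u v p 0 0 : R^o) p.
  exact: (Ck_mx_differentiable (Ck_mx_form 1 u v) up 0 0).
have d3 := differentiable_mul d1 d2.
rewrite deriveN; last exact: diff_derivable (differentiable_mul d1 d3).
rewrite (derive_mul _ d1 d3) (derive_mul _ d1 d2) derive_lin//; last exact: fst_continuous.
have := mx_derive_form u v 1 0 up => /matrixP/(_ 0 0); rewrite mxE => ->.
have L0 := linear_at0 L_lin.
have nE (M : 'M[R]_1) : (- M) 0 0 = - M 0 0 by rewrite mxE.
rewrite L0 scaler0 addr0 scale1r nE.
move: (form u v p 0 0 : R) (p.1 : R) ((_ *m v) 0 0 : R) => q t q'.
rewrite mulr2n /=; ring.
Qed.

(** Each term is C(x, y) paired with a covector, where w^T P^-1 is, up to sign,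
    the vector that P turns into w; so the cyclic identity for P at the vectors of u, v
    and mu is the statement.  It expresses that the inverse form is closed. *)
Lemma closed_inverse u v p : pencil_dom p ->
  p.2^T *m pencil_inv p *m L u *m pencil_inv p *m v
  - p.2^T *m pencil_inv p *m L v *m pencil_inv p *m u
  = u^T *m pencil_inv p *m L p.2 *m pencil_inv p *m v.
Proof.
move=> up.
pose x (w : E) := w^T *m pencil_inv p.
have xT (w : E) : pencil_inv p *m w = - (x w)^T.
  by rewrite /x trmx_mul trmxK pencil_inv_anti// mulNmx opprK.
have cE (a b c : E) : a^T *m pencil_inv p *m L b *m pencil_inv p *m c = - (C (x a) (x c) *m b).
  by rewrite -mulmxA xT mulmxN CL -/(x a).
have bE (b : E) : b = - (pencil p *m (x b)^T).
  by rewrite -mulmxN -xT mulKVmx.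
rewrite !cE.
have := jacobi (p.1 *: p.2) (x u) (x v) (x p.2); rewrite -pencilE.
rewrite -!mulmxA.
have e (b : E) : pencil p *m (x b)^T = - b by rewrite [in RHS](bE b) opprK.
have Canti a b (w : E) : C a b *m w = - (C b a *m w).
  by rewrite !CL -[LHS]tr_mx11 !trmx_mul trmxK L_anti mulNmx mulmxN mulmxA.
rewrite !e !mulmxN (Canti (x v)) opprK => /eqP.
rewrite addrAC -opprD addrC subr_eq0 => /eqP ->.
by rewrite opprK opprD subrK.
Qed.

(** The primitive of a closed 2-form that the homotopy of the Poincare lemma
    provides. *)
Definition primitive (mu v : E) : R := int01 (fun t => integrand v (t, mu)).

Section Ball.
Variable U : set E.
Hypothesis U_open : open U.
Hypothesis U_dom : forall (t : R) mu, 0 <= t <= 1 -> U mu -> pencil_dom (t, mu).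

Lemma form_linear_r u p : linear (fun v => form u v p 0 0 : R^o).
Proof. by move=> a v w; rewrite /form mulmxDr -scalemxAr !mxE. Qed.

Lemma Csmooth_primitive v : Csmooth U (fun mu => primitive mu v : R^o).
Proof.
move=> k; apply: (Ck_param _ open_pencil_dom U_open U_dom (Ck_integrand k v)).
exact: finite_dim_mx.
Qed.

Lemma cont_integrand v mu : U mu -> cont01 (fun t => integrand v (t, mu)).
Proof.
move=> Umu; apply: (slice_cont01 (W := pencil_dom)) => [t t01|p Wp].
  exact: U_dom.
exact: (Ck_le0 (Ck_integrand 0 v) Wp).
Qed.

Lemma primitive_linear mu : U mu -> linear (primitive mu : E -> R^o).
Proof.
move=> Umu a v w; rewrite -[RHS]/(a * primitive mu v + primitive mu w).
rewrite /primitive -int01_linear; [|exact: cont_integrand|exact: cont_integrand].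
apply: int01_ext => t t01; rewrite /integrand.
rewrite (form_linear_r _ _ a v w) -[a *: _]/(a * _).
by rewrite mulrDr opprD mulrN mulrCA.
Qed.

(** The Poincare lemma: by closedness the exterior derivative of the integrand is
    the t-derivative of - t^2 u^T P_(t mu)^-1 v, whose integral is its value at
    t = 1. *)
Lemma dvec1_primitive mu u v : U mu ->
  dvec1 (primitive : form1 (vec E)) mu u v = - form u v (1, mu) 0 0.
Proof.
move=> Umu; have hW (t : R) : 0 <= t <= 1 -> pencil_dom (t, mu) by move=> t01; exact: U_dom.
have [_ d1] := param_diff (finite_dim_mx R n 1) open_pencil_dom hW (Ck_integrand 1 v).
have [_ d2] := param_diff (finite_dim_mx R n 1) open_pencil_dom hW (Ck_integrand 1 u).
have c1 : cont01 (fun t => 'D_(0, u) (integrand v) (t, mu)).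
  by have [_ h] := Ck_integrand 1 v; exact: (slice_cont01 hW (h (0, u))).
have c2 : cont01 (fun t => 'D_(0, v) (integrand u) (t, mu)).
  by have [_ h] := Ck_integrand 1 u; exact: (slice_cont01 hW (h (0, v))).
rewrite /dvec1 d1 d2.
(* An antiderivative in t of the exterior derivative of the integrand. *)
pose G (p : R^o * E) : R^o := - (p.1 * (p.1 * form u v p 0 0)).
have GC k : Ck k pencil_dom G.
  have Wo := open_pencil_dom.
  have h := CkM Wo (Ck_cst k pencil_dom (-1 : R^o))
   (CkM Wo (Ck_fst k pencil_dom) (CkM Wo (Ck_fst k pencil_dom) (Ck_mx_form k u v 0 0))).
  by apply: Ck_ext Wo _ h => p _; rewrite mulN1r.
have lineE (t : R) : ((0, mu) : R^o * E) + t *: ((1, 0) : R^o * E) = (t, mu).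
  by apply/pair_equal_spec; split; rewrite /= ?scaler0 ?addr0// add0r; exact: mulr1.
transitivity (int01 (fun t => 'D_(1, 0) G (t, mu))).
  have sub (x y : R) : x - y = -1 * y + x by rewrite mulN1r addrC.
  rewrite sub -int01_linear//.
  apply: int01_ext => t /hW ut; rewrite derive_form// !derive_integrand//=.
  have := closed_inverse u v ut => /matrixP/(_ 0 0) /=; rewrite [X in X = _ -> _]mxE => <-.
  have ne (M : 'M[R]_1) : (- M) 0 0 = - M 0 0 by rewrite mxE.
  have -> : form v u (t, mu) = - form u v (t, mu).
    by rewrite -[LHS]tr_mx11 /form !trmx_mul trmxK pencil_inv_anti// mulNmx mulmxN mulmxA.
  rewrite !ne mulr2n.
  ring.
have c3 : cont01 (fun t => 'D_(1, 0) G (t, mu)).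
  by have [_ h] := GC 1; exact: (slice_cont01 hW (h (1, 0))).
have dGt (t : R) : 0 <= t <= 1 ->
    is_derive t 1 (fun t : R => G (t, mu) : R) ('D_(1, 0) G (t, mu)).
  move=> t01; have dG : differentiable G (((0, mu) : R^o * E) + t *: ((1, 0) : R^o * E)).
    by rewrite lineE; exact: (Ck_diff (GC 1) (hW _ t01)).
  have := line_is_derive dG; rewrite lineE.
  rewrite (_ : (fun s : R => _) = (fun t : R => G (t, mu)))//.
  by apply/funext => s; rewrite lineE.
rewrite (int01_derive c3 dGt).
by rewrite /G /= !mul1r mul0r oppr0 subr0.
Qed.

End Ball.

(** Since P_mu = P_(t mu) + (1 - t) L(mu), the integrand at P_mu B mu is
    - t (mu^T B mu + (1 - t) mu^T S mu) with S = P_(t mu)^-1 L(mu) B.  As S vanishes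
    at mu = 0, uniformly for t in [0, 1], the second term is at most half the first
    on a small ball, and the integral is at most - (mu^T B mu) / 4. *)
Lemma exists_primitive_ball (B : 'M[R]_n) (c0 : R) : 0 < c0 ->
  (forall mu : E, c0 * `|mu| ^+ 2 <= (mu^T *m B *m mu) 0 0) ->
  exists2 r : R, 0 < r &
    (forall (t : R) (mu : E), 0 <= t <= 1 -> `|mu| < r -> pencil_dom (t, mu)) /\
    (forall mu : E, `|mu| < r -> mu != 0 ->
       primitive mu ((P0 + L mu) *m B *m mu) < 0).
Proof.
move=> c00 hB; have L0 := linear_at0 L_lin.
pose S (p : R^o * E) := pencil_inv p *m L p.2 *m B.
(* A bilinear form with n^2 entries below eps is below c0 / 2 on unit vectors. *)
pose eps := c0 / 2 / (n%:R ^+ 2 + 1).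
have n0 : 0 < n%:R ^+ 2 + 1 :> R by rewrite ltr_wpDl// exprn_ge0.
have eps0 : 0 < eps by rewrite !divr_gt0.
have CS i j : Ck 0 pencil_dom (fun p => S p i j : R^o).
  have h : Ck_mx 0 pencil_dom (fun p : R^o * E => L p.2).
    move=> a b; have Ll : linear (fun q : R^o * E => L q.2 a b : R^o).
      by move=> s u v; rewrite /= L_lin !mxE.
    apply: Ck_lin => //; apply: finite_dim_linear_continuous Ll.
    by apply: finite_dim_prod; [exact: finite_dim_real|exact: finite_dim_mx].
  have Wo := open_pencil_dom.
  exact: (Ck_mx_mul Wo (Ck_mx_mul Wo (Ck_mx_pencil_inv 0) h) (Ck_mx_cst _ _ B)).
pose P (mu : E) (t : R) := pencil_dom (t, mu) /\ forall i j, `|S (t, mu) i j| <= eps.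
have N : \forall mu \near (0 : E), forall t, 0 <= t <= 1 -> P mu t.
  apply: near01 => t t01.
  have d0 : pencil_dom (t, 0) by rewrite /pencil_dom /= /pencil /= L0 scaler0 addr0.
  have nb : nbhs ((t, 0) : R^o * E)
      [set p | pencil_dom p /\ forall q : 'I_n * 'I_n, `|S (t, 0) q.1 q.2 - S p q.1 q.2| < eps].
    apply: filterI; first exact: (open_near open_pencil_dom d0).
    have gi (q : 'I_n * 'I_n) : nbhs ((t, 0) : R^o * E)
        [set p | `|S (t, 0) q.1 q.2 - S p q.1 q.2| < eps].
      by move/cvgrPdist_lt : (CS q.1 q.2 _ d0) => /(_ _ eps0).
    exact: (@filter_forall _ _ _ _ (nbhs_filter ((t, 0) : R^o * E)) gi).
  have [r r0 hr] := prod_ball nb.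
  exists r => // t' mu tt' mu0; have [h1 h2] := hr t' mu tt' mu0.
  split=> // i j; have := h2 (i, j) => /=.
  by rewrite /S /= L0 mulmx0 mul0mx [(0 : 'M[R]_n) i j]mxE sub0r normrN => /ltW.
have [r /= r0 hr] := (nbhs_normP _ _).1 N.
have {}hr mu t : `|mu| < r -> 0 <= t <= 1 -> P mu t.
  by move=> mur; apply: (hr mu); rewrite /= sub0r normrN.
exists r => //; split=> [t mu t01 mur|mu mur mu0].
  by have [] := hr mu t mur t01.
pose q : R := (mu^T *m B *m mu) 0 0.
have q0 : 0 < q.
  by apply: lt_le_trans (hB mu); rewrite mulr_gt0// exprn_gt0// normr_gt0.
pose U := [set mu : E | `|mu| < r].
have Udom (t : R) nu : 0 <= t <= 1 -> U nu -> pencil_dom (t, nu).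
  by move=> t01 nur; have [] := hr nu t nur t01.
set v := (P0 + L mu) *m B *m mu.
have bd (t : R) : 0 <= t <= 1 -> integrand v (t, mu) <= (- (q / 2)) * t + 0.
  move=> t01; have [ut hS] := hr mu t mur t01; have /andP[t0 t1] := t01.
  have fE : form mu v (t, mu) 0 0 = q + (1 - t) * (mu^T *m S (t, mu) *m mu) 0 0.
    have pE : P0 + L mu = pencil (t, mu) + (1 - t) *: L mu.
      by rewrite /pencil /= scalerBl scale1r addrA addrAC addrK.
    rewrite /form /v pE -!mulmxA (mulmxA (pencil_inv _)) mulmxDr mulVmx//.
    rewrite mulmxDl mul1mx mulmxDr mxE /q -mulmxA; congr (_ + _).
      by rewrite mulmxA.
    by rewrite -scalemxAl -!scalemxAr mxE.
  rewrite /integrand fE addr0 mulNr lerN2 /= [q / 2 * t]mulrC ler_wpM2l//.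
  have hn : `|(mu^T *m S (t, mu) *m mu) 0 0| <= q / 2.
    apply: le_trans (mx11_norm_le _ _ hS) _.
    have -> : `|mu^T| = `|mu| by exact: mx_norm_tr.
    apply: (@le_trans _ _ (c0 / 2 * `|mu| ^+ 2)); last first.
      by rewrite mulrAC ler_pM2r// ?invr_gt0//; exact: hB.
    rewrite -mulrA -[`|mu| * _]expr2 ler_wpM2r ?exprn_ge0// /eps.
    by rewrite mulrAC ler_pdivrMr// ler_pM2l ?divr_gt0// lerDl.
  move: hn; rewrite ler_norml => /andP[hn _].
  set x := (_ *m mu) 0 0 in hn *.
  have h1 : (1 - t) * - (q / 2) <= (1 - t) * x by rewrite ler_wpM2l// subr_ge0.
  have h2 : 0 <= t * (q / 2) by rewrite mulr_ge0// divr_ge0// ltW.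
  lra.
have idc : cont01 (id : R -> R) by move=> t _; exact: cvg_id.
have c1 := cont_integrand Udom (v := v) (mur : U mu).
have c2 : cont01 (fun t : R => (- (q / 2)) * t + 0).
  by apply: cont01_lin => //; exact: cont01_cst.
have le1 := int01_le c1 c2 bd.
apply: le_lt_trans le1 _.
rewrite int01_linear//; last exact: cont01_cst.
rewrite int01_cst addr0.
have dF (t : R) : 0 <= t <= 1 -> is_derive t 1 (fun t : R => t * t / 2) t.
  move=> _; apply: is_derive_eq; rewrite /GRing.scale /=; lra.
rewrite (int01_derive idc dF); lra.
Qed.

End Primitive.

Lemma smooth_manifold_atlas (R : realType) (E : normedModType R) (M : charted E) :
  finite_dim E -> smooth_manifold M -> smooth_atlas M.
Proof. by move=> Ef [_ _ h1 h2 h3]; split. Qed.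

(** * The Maurer-Cartan form *)

Section LieGroup.
Context (R : realType) (n : nat) (G : lie_group R n).
Local Notation E := 'rV[R]_n.

Lemma smooth_atlas_lie : smooth_atlas G.
Proof. by apply: smooth_manifold_atlas; [exact: finite_dim_mx|exact: lie_smooth]. Qed.

Lemma finite_dim_rV : finite_dim E. Proof. exact: finite_dim_mx. Qed.

Lemma lmulgV (x : G) : lmul x (linv x) = lone G.
Proof.
rewrite -[LHS]lmul1g -{1}(lmulVg (linv x)) -lmulA (lmulA (linv x)).
by rewrite lmulVg lmul1g lmulVg.
Qed.

Lemma lmulg1 (x : G) : lmul x (lone G) = x.
Proof. by rewrite -(lmulVg x) lmulA lmulgV lmul1g. Qed.

Lemma lmulKg (g x : G) : lmul (linv g) (lmul g x) = x.
Proof. by rewrite lmulA lmulVg lmul1g. Qed.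

Lemma lmulVKg (g x : G) : lmul g (lmul (linv g) x) = x.
Proof. by rewrite lmulA lmulgV lmul1g. Qed.

Lemma linvM (g h : G) : linv (lmul g h) = lmul (linv h) (linv g).
Proof.
rewrite -[RHS](lmulKg (lmul g h)) -(lmulA g h) lmulVKg lmulgV.
by rewrite lmulg1.
Qed.

Lemma smooth_lmul (g : G) : smooth_on setT (lmul g).
Proof.
have gG := smooth_atlas_lie.
have h := smooth_on_pair gG gG gG openT (smooth_on_cst (M := G) setT g) (smooth_on_id setT gG).
have := smooth_on_comp gG (smooth_atlas_prod gG gG) gG openT openT h (lmul_smooth G).
by apply: smooth_on_sub.
Qed.

Definition maurer_cartan (g : G) (w : E) : E := tmap (lmul (linv g)) g w.

Lemma maurer_cartan_linear g : linear (maurer_cartan g).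
Proof. exact: tmap_linear. Qed.

Lemma tmap_lmul (g h : G) (x : G) w :
  tmap (lmul g) (lmul h x) (tmap (lmul h) x w) = tmap (lmul (lmul g h)) x w.
Proof.
have gG := smooth_atlas_lie.
apply: etrans (esym (tmap_comp w gG gG gG openT (smooth_lmul h) (smooth_lmul g) I I)) _.
suff -> : lmul g \o lmul h = lmul (lmul g h) by [].
by apply/funext => y; rewrite /= lmulA.
Qed.

Lemma tmap_lmul1 (x : G) w : tmap (lmul (lone G)) x w = w.
Proof.
rewrite (_ : lmul (lone G) = id); first exact: (tmap_id _ _ smooth_atlas_lie).
by apply/funext => y; rewrite lmul1g.
Qed.

Lemma maurer_cartan_translate h g w :
  maurer_cartan (lmul h g) (tmap (lmul h) g w) = maurer_cartan g w.
Proof. by rewrite /maurer_cartan tmap_lmul linvM -lmulA lmulVg lmulg1. Qed.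

Lemma linv1 : linv (lone G) = lone G.
Proof. by rewrite -[LHS]lmulg1 lmulVg. Qed.

Lemma maurer_cartan1 w : maurer_cartan (lone G) w = w.
Proof. by rewrite /maurer_cartan linv1 tmap_lmul1. Qed.

Lemma maurer_cartanK g w : tmap (lmul g) (lone G) (maurer_cartan g w) = w.
Proof.
by have := tmap_lmul g (linv g) g w; rewrite lmulVg lmulgV tmap_lmul1.
Qed.

Lemma maurer_cartanVK g w : maurer_cartan g (tmap (lmul g) (lone G) w) = w.
Proof. by rewrite -[in maurer_cartan g](lmulg1 g) maurer_cartan_translate maurer_cartan1. Qed.

Lemma left_invariant2_maurer_cartan (sigma : form2 G) g u v : left_invariant2 sigma ->
  sigma g u v = sigma (lone G) (maurer_cartan g u) (maurer_cartan g v).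
Proof.
by move=> inv; rewrite -[in LHS](inv (linv g)) /pull2 lmulVg.
Qed.

Definition chart1 : chart G E := chart_at (lone G).
Definition origin : E := cto chart1 (lone G).

Lemma chart1_atlas : atlas chart1. Proof. exact: atlas_at smooth_atlas_lie _. Qed.
Lemma open_chart1 : open (cimg chart1).
Proof. exact: open_cimg smooth_atlas_lie _ chart1_atlas. Qed.
Lemma chart1_origin : cimg chart1 origin. Proof. exact: cimg_at smooth_atlas_lie _. Qed.
Lemma cfrom_origin : cfrom chart1 origin = lone G. Proof. exact: ctoK_at smooth_atlas_lie _. Qed.

Definition mc_form (y : E) (v : E) : E :=
  maurer_cartan (cfrom chart1 y) (@tmap R E E (vec E) G (cfrom chart1) y v).

Lemma mc_form_linear y : linear (mc_form y).
Proof. by move=> a u v; rewrite /mc_form tmap_linear maurer_cartan_linear. Qed.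

Lemma mc_form_origin v : mc_form origin v = v.
Proof. by rewrite /mc_form cfrom_origin maurer_cartan1 tmap_cfrom//; exact: smooth_atlas_lie. Qed.

(** The map (x, y) |-> x^-1 y in the chart at the identity.  Its derivative in y on
    the diagonal is the Maurer-Cartan form ([mc_form_coord_quotient]), which is
    thereby smooth. *)
Definition coord_quotient (p : E * E) : E :=
  cto chart1 (lmul (linv (cfrom chart1 p.1)) (cfrom chart1 p.2)).
Definition coord_quotient_dom : set (E * E) :=
  (cimg chart1 `*` cimg chart1) `&`
  [set p | cdom chart1 (lmul (linv (cfrom chart1 p.1)) (cfrom chart1 p.2))].

Lemma smooth_on_quotient : @smooth_on R _ _ (vec (E * E)%type) G (cimg chart1 `*` cimg chart1)
  (fun p => lmul (linv (cfrom chart1 p.1)) (cfrom chart1 p.2)).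
Proof.
have gG := smooth_atlas_lie; have gE := smooth_atlas_vec finite_dim_rV.
have gEE := smooth_atlas_vec (finite_dim_prod finite_dim_rV finite_dim_rV).
have Wo : open (cimg chart1 `*` cimg chart1 : set (E * E)).
  by apply: open_prod; exact: open_chart1.
have sc := smooth_on_cfrom gG chart1_atlas.
have s1 : @smooth_on R _ _ (vec (E * E)%type) (vec E) (cimg chart1 `*` cimg chart1) fst.
  apply/smooth_on_vec => //; apply: Csmooth_lin; [exact: fst_linear|exact: fst_continuous].
have s2 : @smooth_on R _ _ (vec (E * E)%type) (vec E) (cimg chart1 `*` cimg chart1) snd.
  apply/smooth_on_vec => //; apply: Csmooth_lin; [exact: snd_linear|exact: snd_continuous].
have f1 := smooth_on_comp gEE gE gG Wo open_chart1 s1 sc.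
have f2 := smooth_on_comp gEE gE gG Wo open_chart1 s2 sc.
have {}f1 : @smooth_on R _ _ (vec (E * E)%type) G (cimg chart1 `*` cimg chart1)
    (cfrom chart1 \o fst).
  by apply: smooth_on_sub f1 => p [].
have {}f2 : @smooth_on R _ _ (vec (E * E)%type) G (cimg chart1 `*` cimg chart1)
    (cfrom chart1 \o snd).
  by apply: smooth_on_sub f2 => p [].
have f3 := smooth_on_comp gEE gG gG Wo openT f1 (linv_smooth G).
have {}f3 : @smooth_on R _ _ (vec (E * E)%type) G (cimg chart1 `*` cimg chart1)
    (@linv R n G \o (cfrom chart1 \o fst)).
  by apply: smooth_on_sub f3.
have f4 := smooth_on_pair gEE gG gG Wo f3 f2.
have f5 := smooth_on_comp gEE (smooth_atlas_prod gG gG) gG Wo openT f4 (lmul_smooth G).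
by apply: smooth_on_sub f5.
Qed.

Lemma open_coord_quotient_dom : open coord_quotient_dom.
Proof.
apply: (open_smooth_preim smooth_on_quotient); first by apply: open_prod; exact: open_chart1.
exact: (open_cdom smooth_atlas_lie chart1_atlas).
Qed.

Lemma Csmooth_coord_quotient : Csmooth coord_quotient_dom coord_quotient.
Proof.
have gG := smooth_atlas_lie; have gE := smooth_atlas_vec finite_dim_rV.
have gEE := smooth_atlas_vec (finite_dim_prod finite_dim_rV finite_dim_rV).
have Wo : open (cimg chart1 `*` cimg chart1 : set (E * E)).
  by apply: open_prod; exact: open_chart1.
have h := smooth_on_comp gEE gG gE Wo (open_cdom gG chart1_atlas) smooth_on_quotient
  (smooth_on_cto gG chart1_atlas).
exact: (smooth_on_vec _ open_coord_quotient_dom).1 h.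
Qed.

Lemma coord_quotient_dom_diag y : cimg chart1 y -> coord_quotient_dom (y, y).
Proof.
by move=> cy; split=> //=; rewrite lmulVg; exact: cdom_at smooth_atlas_lie _.
Qed.

Lemma mc_form_coord_quotient y v : cimg chart1 y -> mc_form y v = 'D_(0, v) coord_quotient (y, y).
Proof.
move=> cy; have gG := smooth_atlas_lie; have gE := smooth_atlas_vec finite_dim_rV.
have sc := smooth_on_cfrom gG chart1_atlas.
rewrite /mc_form /maurer_cartan.
apply: etrans (esym (tmap_comp v gE gG gG open_chart1 sc (smooth_lmul _) cy I)) _.
rewrite /tmap /= lmulVg -/chart1.
pose j (z : E) : E * E := (y, z).
have dj : is_diff y j (fun v => (0, v)).
  by apply: is_diff_pair.
have dK : differentiable coord_quotient (j y) := Csmooth_diff Csmooth_coord_quotient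
  (coord_quotient_dom_diag cy).
have djK : differentiable (coord_quotient \o j) y by apply: differentiable_comp.
have jv : 'D_v j y = (0, v) by rewrite deriveE// diff_val.
have dj0 : differentiable j y by [].
apply: etrans (esym (deriveE v djK)) _.
by apply: etrans (derive_comp v dj0 dK) _; rewrite jv.
Qed.

(** A derivative of the smooth map [coord_quotient], restricted to the diagonal. *)
Lemma Csmooth_mc_form v : Csmooth (cimg chart1) (fun y => mc_form y v).
Proof.
have h := Csmooth_derive (0, v) Csmooth_coord_quotient.
have Eo := open_chart1.
have hd : Csmooth (cimg chart1) (fun y : E => (y, y)).
  by apply: Csmooth_pair => // k; exact: Ck_id.
have h2 := Csmooth_comp (finite_dim_prod finite_dim_rV finite_dim_rV) finite_dim_rV Eo
  open_coord_quotient_dom coord_quotient_dom_diag hd h.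
by apply: Csmooth_ext Eo _ h2 => y cy; rewrite mc_form_coord_quotient.
Qed.

Definition pull_maurer_cartan (F : normedModType R) (a : vec F -> G) (x : F) (v : F) : E :=
  maurer_cartan (a x) (tmap a x v).

(** By left invariance a may be replaced by a(x0)^-1 a, which takes values in the
    chart at the identity near x0.  So every pullback of the Maurer-Cartan form is
    locally a pullback of [mc_form], at a point over the identity. *)
Lemma pull_maurer_cartan_chart (F : normedModType R) (A : set F) (a : vec F -> G) (x0 : F) :
  finite_dim F -> open A -> A x0 -> @smooth_on R F E (vec F) G A a ->
  exists (V : set F) (phi : F -> E), [/\ open V, V x0, Csmooth V phi, phi x0 = origin &
    forall x, V x -> cimg chart1 (phi x) /\
      forall v, pull_maurer_cartan a x v = mc_form (phi x) ('D_v phi x)].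
Proof.
move=> Ff Ao Ax0 sa; have gG := smooth_atlas_lie; have gF := smooth_atlas_vec Ff.
have gE := smooth_atlas_vec finite_dim_rV.
pose h := linv (a x0); pose b : vec F -> G := lmul h \o a.
have sb : @smooth_on R F E (vec F) G A b.
  by apply: smooth_on_sub (smooth_on_comp gF gG gG Ao openT sa (smooth_lmul h)).
pose V := A `&` b @^-1` cdom chart1; pose phi : F -> E := cto chart1 \o b.
have Vo : open V := open_smooth_preim sb Ao (open_cdom gG chart1_atlas).
have bx0 : b x0 = lone G by rewrite /b /= /h lmulVg.
have Vx0 : V x0 by split=> //=; rewrite bx0; exact: cdom_at gG _.
have sphi : @smooth_on R F E (vec F) (vec E) V phi.
  exact: (smooth_on_comp gF gG gE Ao (open_cdom gG chart1_atlas) sb (smooth_on_cto gG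
    chart1_atlas)).
have hphi := (smooth_on_vec phi Vo).1 sphi.
exists V, phi; split=> //; first by rewrite /phi /= bx0.
move=> x Vx; have [Ax bx] := Vx.
have cphi : cimg chart1 (phi x) by exact: cimg_cto.
split=> // v.
have -> : pull_maurer_cartan a x v = maurer_cartan (b x) (tmap b x v).
  rewrite /pull_maurer_cartan -(maurer_cartan_translate h).
  by congr maurer_cartan; exact: esym (tmap_comp v gF gG gG Ao sa (smooth_lmul h) Ax I).
have bE : b x = cfrom chart1 (phi x) by rewrite /phi /= ctoK//; exact: chart1_atlas.
rewrite /mc_form -bE; congr maurer_cartan.
have sV : @smooth_on R F E (vec F) G V b by apply: smooth_on_sub sb => y [].
have be y : V y -> b y = (cfrom chart1 \o phi) y.
  by move=> [_ by1]; rewrite /phi /= ctoK//; exact: chart1_atlas.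
rewrite (tmap_ext v gF gG Vo Vx sV Vx be).
apply: etrans (tmap_comp v gF gE gG Vo sphi (smooth_on_cfrom gG chart1_atlas) Vx cphi) _.
by rewrite tmap_vec//; exact: Csmooth_diff hphi Vx.
Qed.

(** The differential of the Maurer-Cartan form at the identity, hence the opposite
    of the Lie bracket of left-invariant fields. *)
Definition bracket (u v : E) : E :=
  'D_u (fun y => mc_form y v) origin - 'D_v (fun y => mc_form y u) origin.

Lemma mc_form_differentiable v y : cimg chart1 y -> differentiable (fun y => mc_form y v) y.
Proof. by move=> cy; exact: Csmooth_diff (Csmooth_mc_form v) cy. Qed.

Lemma pairing_linear (mu : 'cV[R]_n) : linear (pairing mu : E -> R^o).
Proof. by move=> a u v; rewrite /pairing mulmxDl -scalemxAl !mxE. Qed.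

Lemma pairing_cont (mu : 'cV[R]_n) : continuous (pairing mu : E -> R^o).
Proof. exact: finite_dim_linear_continuous finite_dim_rV (pairing_linear mu). Qed.

Lemma pairingB mu u v : pairing mu (u - v : E) = pairing mu u - pairing mu v.
Proof. by rewrite /pairing mulmxBl !mxE. Qed.

Lemma dvec1_mc_form_origin mu u v :
  dvec1 ((fun y v => pairing mu (mc_form y v)) : form1 (vec E)) origin u v =
    pairing mu (bracket u v).
Proof.
have pl := pairing_linear mu; have pc := @pairing_cont mu.
have d w z : 'D_z (fun y => pairing mu (mc_form y w) : R^o) origin =
    pairing mu ('D_z (fun y => mc_form y w) origin).
  exact: (derive_lin_comp z pl pc (mc_form_differentiable w chart1_origin)).
by rewrite /dvec1 !d -pairingB.
Qed.

(** After the translation of [pull_maurer_cartan_chart], exterior differentiation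
    commutes with pullback and the identity is evaluated at the unit, where it is
    the definition of [bracket]. *)
Lemma maurer_cartan_equation (F : normedModType R) (A : set F) (a : vec F -> G) (x0 : F) mu u v :
  finite_dim F -> open A -> A x0 -> @smooth_on R F E (vec F) G A a ->
  dvec1 ((fun x v => pairing mu (pull_maurer_cartan a x v)) : form1 (vec F)) x0 u v =
  pairing mu (bracket (pull_maurer_cartan a x0 u) (pull_maurer_cartan a x0 v)).
Proof.
move=> Ff Ao Ax0 sa.
have [V [phi [Vo Vx0 hphi phi0 hV]]] := pull_maurer_cartan_chart Ff Ao Ax0 sa.
have e w : pull_maurer_cartan a x0 w = 'D_w phi x0.
  by have [_ ->] := hV _ Vx0; rewrite phi0 mc_form_origin.
pose al : form1 (vec E) := fun y v => pairing mu (mc_form y v).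
rewrite (@dvec1_near _ _ _ ((fun x v => al (phi x) ('D_v phi x)) : form1 (vec F))); last first.
  apply: filterS (open_near Vo Vx0) => x Vx; apply/funext => w.
  by have [_ ->] := hV _ Vx.
rewrite (@dvec1_pull _ _ _ V (cimg chart1) phi al x0 u v finite_dim_rV Vo Vx0 (hphi 2) open_chart1).
- by rewrite phi0 dvec1_mc_form_origin !e.
- by rewrite phi0; exact: chart1_origin.
- by move=> y cy s w z; rewrite /al mc_form_linear pairing_linear.
- move=> w; apply: (@differentiable_comp _ _ _ _ (fun y => mc_form y w) (pairing mu : E -> R^o)).
    by apply: mc_form_differentiable; rewrite phi0; exact: chart1_origin.
  by have [] := linear_diff (mc_form (phi x0) w) (pairing_linear mu) (@pairing_cont mu).
Qed.

End LieGroup.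

(** * The twisted Jacobi identity *)

Section ClosedForms.
Context (R : realType) (E : normedModType R).

Lemma dvec2_near (a b : form2 (vec E)) (x u v z : E) :
  (\forall y \near x, a y = b y) -> dvec2 a x u v z = dvec2 b x u v z.
Proof.
move=> ab.
have d p q r : 'D_p (fun y : E => a y q r : R^o) x = 'D_p (fun y : E => b y q r : R^o) x.
  by apply: near_eq_derive; apply: filterS ab => y ->.
by rewrite /dvec2 !d.
Qed.

Lemma dvec2D (a b : form2 (vec E)) (x u v z : E) :
  (forall q r, differentiable (fun y : E => a y q r : R^o) x) ->
  (forall q r, differentiable (fun y : E => b y q r : R^o) x) ->
  dvec2 (fun y q r => a y q r + b y q r) x u v z = dvec2 a x u v z + dvec2 b x u v z.
Proof.
move=> da db.
have d p q r : 'D_p (fun y : E => a y q r + b y q r : R^o) x =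
    'D_p (fun y : E => a y q r : R^o) x + 'D_p (fun y : E => b y q r : R^o) x.
  by rewrite -deriveD//; exact: diff_derivable.
rewrite /dvec2 !d.
move: ('D_u _ x : R) ('D_u _ x : R) ('D_v _ x : R) ('D_v _ x : R) ('D_z _ x : R) ('D_z _ x :
  R) => *.
ring.
Qed.

(** d d = 0, by symmetry of second derivatives. *)
Lemma dvec2_dvec1 (a : form1 (vec E)) (U : set E) (x u v z : E) :
  open U -> U x -> (forall w, Ck 2 U (fun y : E => a y w : R^o)) ->
  dvec2 (dvec1 a) x u v z = 0.
Proof.
move=> Uo Ux ha.
have d p q r : 'D_p (fun y : E => dvec1 a y q r : R^o) x =
    'D_p (fun y => 'D_q (fun y : E => a y r : R^o) y) x -
    'D_p (fun y => 'D_r (fun y : E => a y q : R^o) y) x.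
  rewrite -deriveB//; apply: diff_derivable.
    by have [_ /(_ q)[h _]] := ha r; exact: h.
  by have [_ /(_ r)[h _]] := ha q; exact: h.
rewrite /dvec2 !d (schwarz v u Uo Ux (ha z)) (schwarz z u Uo Ux (ha v)).
rewrite (schwarz z v Uo Ux (ha u)).
move: ('D_u _ x : R) ('D_u _ x : R) ('D_v _ x : R) => *.
ring.
Qed.

End ClosedForms.

Section Bilinear.
Context (R : realType) (n : nat).
Local Notation E := 'rV[R]_n.

Definition bilin_mx (f : E -> E -> R) : 'M[R]_n :=
  \matrix_(i, j) f (delta_mx 0 i) (delta_mx 0 j).

Lemma bilin_mxE (f : E -> E -> R) x y :
  (forall y, linear (fun x => f x y : R^o)) -> (forall x, linear (f x : E -> R^o)) ->
  f x y = (x *m bilin_mx f *m y^T) 0 0.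
Proof.
move=> fl fr.
rewrite [in LHS](row_sum_delta x) (linear_sum_coord _ _ (fl y)).
rewrite mxE.
under [RHS]eq_bigr => j _ do rewrite mxE mulr_suml.
rewrite exchange_big /=; apply: eq_bigr => i _.
rewrite [in LHS](row_sum_delta y) (linear_sum_coord _ _ (fr _)) scaler_sumr.
apply: eq_bigr => j _; rewrite !mxE /GRing.scale /=; ring.
Qed.

(** With a1 = D_x theta(y), a2 = D_x theta(z), b1 = D_y theta(x), b2 = D_y theta(z),
    d1 = D_z theta(x) and d2 = D_z theta(y), the hypothesis is d (M(theta, theta)) = 0
    expanded by Leibniz; grouping the six terms by skew symmetry gives the cyclic sum
    of M(d theta). *)
Lemma cyclic_sum (M : 'M[R]_n) (x y z a1 a2 b1 b2 d1 d2 : E) :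
  M^T = - M ->
  ((a1 *m M *m z^T) 0 0 + (y *m M *m a2^T) 0 0)
  - ((b1 *m M *m z^T) 0 0 + (x *m M *m b2^T) 0 0)
  + ((d1 *m M *m y^T) 0 0 + (x *m M *m d2^T) 0 0) = 0 ->
  (a1 - b1) *m M *m z^T + (b2 - d2) *m M *m x^T + (d1 - a2) *m M *m y^T = 0.
Proof.
move=> MT h0; apply: mx11P.
have xe (A B : 'M[R]_1) : (A + B) 0 0 = A 0 0 + B 0 0 by rewrite mxE.
have xn (A : 'M[R]_1) : (- A) 0 0 = - A 0 0 by rewrite mxE.
have sw (p q : E) : (p *m M *m q^T) 0 0 = - (q *m M *m p^T) 0 0.
  rewrite -xn; congr (fun_of_matrix _ 0 0).
  by rewrite -[LHS]tr_mx11 !trmx_mul trmxK MT mulNmx mulmxN mulmxA.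
rewrite !mulmxBl !xe !xn [RHS]mxE -[RHS]h0.
rewrite (sw y a2) (sw x b2) (sw x d2); ring.
Qed.

Lemma differentiable_entries (X : normedModType R) m p (A : X -> 'M[R]_(m, p)) x :
  differentiable A x -> mx_differentiable A x.
Proof.
move=> dA i j; apply: (@differentiable_comp _ _ _ _ A (fun M : 'M[R]_(m, p) => M i j : R^o)) => //.
exact: differentiable_coord.
Qed.

Lemma mx_derive_derive (X : normedModType R) m p (A : X -> 'M[R]_(m, p)) x w :
  differentiable A x -> mx_derive w A x = 'D_w A x.
Proof.
move=> dA; apply/matrixP => i j; rewrite mxE.
apply: (@derive_lin_comp _ _ _ _ A (fun M : 'M[R]_(m, p) => M i j : R^o)) => //.
  by move=> a u v; rewrite !mxE.
exact: coord_continuous.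
Qed.

Lemma mx_derive_tr (X : normedModType R) m p (A : X -> 'M[R]_(m, p)) x w :
  mx_derive w (fun y => (A y)^T) x = (mx_derive w A x)^T.
Proof.
apply/matrixP => i j; rewrite !mxE; congr ('D_w _ x).
by apply/funext => y; rewrite mxE.
Qed.

Lemma mx_differentiable_tr (X : normedModType R) m p (A : X -> 'M[R]_(m, p)) x :
  mx_differentiable A x -> mx_differentiable (fun y => (A y)^T) x.
Proof.
move=> dA i j; rewrite (_ : (fun y => _) = (fun y => A y j i : R^o)); first exact: dA.
by apply/funext => y; rewrite mxE.
Qed.

End Bilinear.

Section Structure.
Context (R : realType) (n : nat) (G : lie_group R n).
Local Notation E := 'rV[R]_n.
Local Notation bracket := (@bracket R n G).
Local Notation mc_form := (@mc_form R n G).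
Local Notation origin := (@origin R n G).
Local Notation chart1 := (@chart1 R n G).

Lemma bracket_anti u v : bracket v u = - bracket u v.
Proof. by rewrite /bracket opprB. Qed.

Lemma bracket_linear_l v : linear (fun u => bracket u v).
Proof.
move=> a u w; rewrite /bracket.
have l1 := derive_linear (mc_form_differentiable v (@chart1_origin R n G)).
rewrite l1.
have -> : (fun y => mc_form y (a *: u + w)) = a \*: (fun y => mc_form y u) + (fun y => mc_form y w).
  by apply/funext => y; rewrite mc_form_linear.
have d z := diff_derivable (v := v) (mc_form_differentiable z (@chart1_origin R n G)).
rewrite deriveD//; last exact: derivableZ.
rewrite deriveZ// scalerBr opprD; exact: addrACA.
Qed.

Lemma bracket_linear_r u : linear (bracket u).
Proof.
move=> a v w; have /= e := bracket_linear_l u a v w.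
rewrite (bracket_anti (a *: v + w) u) e (bracket_anti v u) (bracket_anti w u).
by rewrite opprD scalerN.
Qed.

Variable sigma : form2 G.
Hypothesis sinv : left_invariant2 sigma.
Hypothesis ssymp : symplectic sigma.

Definition form_at1 (u v : E) : R := sigma (lone G) u v.
(** The constant term of the pencil. *)
Definition form_at1_mx : 'M[R]_n := bilin_mx form_at1.
(** The linear term of the pencil, given by the structure constants. *)
Definition bracket_mx (mu : 'cV[R]_n) : 'M[R]_n :=
  bilin_mx (fun u v => pairing mu (bracket u v)).

Lemma form_at1_linear_r u : linear (form_at1 u : E -> R^o).
Proof. by have [[h _ _ _] _ _] := ssymp; exact: h. Qed.

Lemma form_at1_linear_l v : linear (fun u => form_at1 u v : R^o).
Proof. by have [[_ h _ _] _ _] := ssymp; exact: h. Qed.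

Lemma form_at1_anti u v : form_at1 v u = - form_at1 u v.
Proof.
have [[_ _ h _] _ _] := ssymp.
have := h (lone G) (u + v); rewrite -/(form_at1 _ _) => e.
have ll w : form_at1 (u + v) w = form_at1 u w + form_at1 v w.
  by have := form_at1_linear_l w 1 u v; rewrite !scale1r.
have lr w : form_at1 w (u + v) = form_at1 w u + form_at1 w v.
  by have := form_at1_linear_r w 1 u v; rewrite !scale1r.
move: e; rewrite ll !lr (h _ u : form_at1 u u = 0) (h _ v : form_at1 v v = 0) add0r addr0.
by move=> /eqP; rewrite addrC addr_eq0 => /eqP.
Qed.

Lemma form_at1E u v : form_at1 u v = (u *m form_at1_mx *m v^T) 0 0.
Proof. by apply: bilin_mxE; [exact: form_at1_linear_l|exact: form_at1_linear_r]. Qed.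

Lemma bracketE mu u v : pairing mu (bracket u v) = (u *m bracket_mx mu *m v^T) 0 0.
Proof.
apply: (bilin_mxE (f := fun u v => pairing mu (bracket u v))) => [y|x] a p q.
  by rewrite bracket_linear_l pairing_linear.
by rewrite bracket_linear_r pairing_linear.
Qed.

Lemma form_at1_mx_anti : form_at1_mx^T = - form_at1_mx.
Proof. by apply/matrixP => i j; rewrite !mxE form_at1_anti. Qed.

Lemma bracket_mx_anti mu : (bracket_mx mu)^T = - bracket_mx mu.
Proof.
apply/matrixP => i j; rewrite !mxE bracket_anti.
by rewrite /pairing mulNmx mxE.
Qed.

Lemma bracket_mx_linear : linear bracket_mx.
Proof.
by move=> a u v; apply/matrixP => i j; rewrite !mxE /pairing mulmxDr -scalemxAr !mxE.
Qed.

Lemma form_at1_mx_unit : form_at1_mx \in unitmx.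
Proof.
rewrite -row_free_unit -kermx_eq0; apply/rowV0P => x /sub_kermxP x0.
have [_ _ nd] := ssymp; apply: (nd (lone G)) => v.
by rewrite -/(form_at1 x v) form_at1E x0 mul0mx mxE.
Qed.

Lemma bracket_mxE x y w : bracket x y *m w = x *m bracket_mx w *m y^T.
Proof. by apply: mx11P; rewrite -bracketE. Qed.

(** By left invariance Pi_mu(theta, theta) is sigma plus mu o C(theta, theta), and
    the latter is d (mu o theta) by the Maurer-Cartan equation. *)
Lemma mc_form_pencil mu y u v : cimg chart1 y ->
  (mc_form y u *m (form_at1_mx + bracket_mx mu) *m (mc_form y v)^T) 0 0 =
  comp2 chart1 sigma y u v +
  dvec1 ((fun y v => pairing mu (mc_form y v)) : form1 (vec E)) y u v.
Proof.
move=> cy; rewrite mulmxDr mulmxDl mxE -form_at1E -bracketE; congr (_ + _).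
  by rewrite /comp2 /pull2 (left_invariant2_maurer_cartan (G := G) _ _ _ sinv).
have sc := smooth_on_cfrom (@smooth_atlas_lie R n G) (@chart1_atlas R n G).
exact: esym (maurer_cartan_equation mu u v (@finite_dim_rV R n) (@open_chart1 R n G) cy sc).
Qed.

Lemma derive_mc_form_pencil (M : 'M[R]_n) z u v :
  'D_z (fun y => (mc_form y u *m M *m (mc_form y v)^T) 0 0 : R^o) origin =
  ('D_z (fun y => mc_form y u) origin *m M *m v^T) 0 0 +
  (u *m M *m ('D_z (fun y => mc_form y v) origin)^T) 0 0.
Proof.
have d w := mc_form_differentiable w (@chart1_origin R n G).
have dm w := differentiable_entries (d w).
have := @mx_derive_mul R E 1 n 1 z (fun y => mc_form y u *m M) (fun y => (mc_form y v)^T) origin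
  (mx_differentiable_mul (dm u) (mx_differentiable_cst M origin)) (mx_differentiable_tr (dm v)).
move=> /matrixP/(_ 0 0); rewrite [LHS]mxE => ->.
rewrite (mx_derive_mul z (dm u) (mx_differentiable_cst M origin)) mx_derive_cst mulmx0 addr0
  mx_derive_tr !mx_derive_derive//.
by rewrite !mc_form_origin [LHS]mxE.
Qed.

(** The form sigma + d (mu o theta) is closed, and it is Pi_mu(theta, theta) by
    [mc_form_pencil].  At the identity theta is the identity map and the Leibniz
    rule turns closedness into the cyclic sum. *)
Lemma twisted_jacobi mu x y z :
  bracket x y *m (form_at1_mx + bracket_mx mu) *m z^T +
  bracket y z *m (form_at1_mx + bracket_mx mu) *m x^T +
  bracket z x *m (form_at1_mx + bracket_mx mu) *m y^T = 0.
Proof.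
have [[_ _ _ sm] cl _] := ssymp.
pose a : form1 (vec E) := fun y v => pairing mu (mc_form y v).
have ce := @chart1_origin R n G; have Uo := @open_chart1 R n G.
have aC k w : Ck k (cimg chart1) (fun y : E => a y w : R^o).
  apply: (@Ck_lin_comp R E E R^o k (cimg chart1) (fun y => mc_form y w) (pairing mu) Uo).
  - exact: pairing_linear.
  - exact: pairing_cont.
  - exact: Csmooth_mc_form.
have sC k q r : Ck k (cimg chart1) (fun y : E => comp2 chart1 sigma y q r : R^o).
  by apply: sm; exact: chart1_atlas.
set M := form_at1_mx + bracket_mx mu.
pose w2 : form2 (vec E) := fun y q r => (mc_form y q *m M *m (mc_form y r)^T) 0 0.
have h0 : dvec2 w2 origin x y z = 0.
  rewrite (@dvec2_near _ _ _ (fun y q r => comp2 chart1 sigma y q r + dvec1 a y q r)); last first.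
    apply: filterS (open_near Uo ce) => p cp; apply/funext => q; apply/funext => r.
    exact: mc_form_pencil.
  rewrite dvec2D.
  - rewrite (dvec2_dvec1 x y z Uo ce (aC 2)) addr0; exact: cl.
  - by move=> q r; exact: (Ck_diff (sC 1 q r) ce).
  - move=> q r; apply: differentiableB.
      by have [_ /(_ q)[h _]] := aC 2 r; exact: h.
    by have [_ /(_ r)[h _]] := aC 2 q; exact: h.
have MT : M^T = - M by rewrite /M linearD /= form_at1_mx_anti bracket_mx_anti opprD.
have E1 := derive_mc_form_pencil M x y z; have E2 := derive_mc_form_pencil M y x z.
have E3 := derive_mc_form_pencil M z x y.
have h1 : 'D_x (fun y0 => w2 y0 y z : R^o) origin - 'D_y (fun y0 => w2 y0 x z : R^o) origin +
   'D_z (fun y0 => w2 y0 x y : R^o) origin = 0 := h0.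
have h2 := etrans (esym (congr2 (fun s t => s + t) (congr2 (fun s t => s - t) E1 E2) E3)) h1.
exact: (cyclic_sum MT h2).
Qed.

End Structure.

Section PullMcSmooth.
Context (R : realType) (n : nat) (G : lie_group R n).
Local Notation E := 'rV[R]_n.

(** Expand the direction in the basis: only the finitely many functions
    [mc_form] y e_k need composing. *)
Lemma pull_maurer_cartan_differentiable (F : normedModType R) (A : set F)
    (a : vec F -> G) (x0 : F) v :
  finite_dim F -> open A -> A x0 -> @smooth_on R F E (vec F) G A a ->
  mx_differentiable (fun x : F => pull_maurer_cartan a x v) x0.
Proof.
move=> Ff Ao Ax0 sa.
have [V [phi [Vo Vx0 hphi _ hV]]] := pull_maurer_cartan_chart Ff Ao Ax0 sa.
move=> i j; apply: (@Ck_diff _ _ _ 0 V _ _ _ Vx0).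
have h k : Ck 1 V (fun x : F => 'D_v phi x 0 k * mc_form G (phi x) (delta_mx 0 k) i j : R^o).
  have hD : Ck 1 V (fun x : F => 'D_v phi x 0 k : R^o).
    apply: (@Ck_lin_comp _ _ _ _ 1 V ('D_v phi) (fun M : E => M 0 k : R^o) Vo).
    - by move=> s u w; rewrite !mxE.
    - exact: coord_continuous.
    - exact: Csmooth_derive hphi 1.
  have ht : Ck 1 (cimg (chart1 G)) (fun y : E => mc_form G y (delta_mx 0 k) i j : R^o).
    apply: (@Ck_lin_comp _ _ _ _ 1 (cimg (chart1 G)) (fun y => mc_form G y (delta_mx 0 k))
      (fun M : E => M i j : R^o) (@open_chart1 R n G)).
    - by move=> s u w; rewrite !mxE.
    - exact: coord_continuous.
    - exact: Csmooth_mc_form.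
  apply: (CkM Vo hD).
  apply: (Ck_comp (finite_dim_rV R n) (finite_dim_real R) Vo (@open_chart1 R n G) _ (hphi 1) ht).
  by move=> x Vx; have [] := hV _ Vx.
apply: Ck_ext Vo _ (Ck_sum _ Vo h) => x Vx.
have [_ ->] := hV _ Vx.
rewrite [in RHS](row_sum_delta ('D_v phi x)) (linear_sum_coord _ _ (@mc_form_linear R n G _)).
by rewrite summxE; apply: eq_bigr => k _; rewrite [RHS]mxE.
Qed.

End PullMcSmooth.

(** * The quotient manifold *)

Section Quotient.
Context (R : realType) (n : nat) (G : lie_group R n).
Local Notation E := 'rV[R]_n.
Variables (Gamma : set G) (Q : charted E) (pi : G -> Q).
Hypothesis quo : left_quotient Gamma pi.

Lemma smooth_atlas_quotient : smooth_atlas Q.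
Proof. by have [h _ _ _] := quo; apply: smooth_manifold_atlas => //; exact: finite_dim_rV. Qed.

Lemma smooth_pi : smooth_on setT pi.
Proof. by have [_ _ _ []] := quo. Qed.

Lemma pi_surj q : exists g, pi g = q.
Proof. by have [_ h _ _] := quo. Qed.

Lemma local_section g : exists (W : set G) (s : Q -> G),
  [/\ open W, W g, open (pi @` W), smooth_on (pi @` W) s &
      forall x, W x -> s (pi x) = x].
Proof. by have [_ _ _ [_ h]] := quo; exact: h. Qed.

Lemma tmap_pi_inj g : injective (tmap pi g).
Proof.
have gG := @smooth_atlas_lie R n G; have gQ := smooth_atlas_quotient.
have [W [s [Oo Og pOo ss sK]]] := local_section g.
suff K : forall w, tmap s (pi g) (tmap pi g w) = w.
  by move=> u v e; rewrite -[u]K e K.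
move=> w.
have Opg : (pi @` W) (pi g) by exists g.
apply: etrans (esym (tmap_comp w gG gQ gG openT smooth_pi ss I Opg)) _.
have sp : smooth_on (setT `&` pi @^-1` (pi @` W)) (s \o pi).
  exact: (smooth_on_comp gG gQ gG openT pOo smooth_pi ss).
rewrite (tmap_ext (g := fun x => x) w gG gG Oo Og sp (conj I Opg)) ?tmap_id//.
Qed.

Lemma tmap_pi_surj g w : exists w', tmap pi g w' = w.
Proof.
have gG := @smooth_atlas_lie R n G; have gQ := smooth_atlas_quotient.
have [W [s [Oo Og pOo ss sK]]] := local_section g.
exists (tmap s (pi g) w).
have Opg : (pi @` W) (pi g) by exists g.
have := tmap_comp w gQ gG gQ pOo ss smooth_pi Opg I; rewrite sK// => <-.
have sp : smooth_on ((pi @` W) `&` s @^-1` setT) (pi \o s).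
  exact: (smooth_on_comp gQ gG gQ pOo openT ss smooth_pi).
rewrite (tmap_ext (g := fun x => x) w gQ gQ pOo Opg sp (conj Opg I)) ?tmap_id//.
by move=> _ [x Ox <-]; rewrite /= sK.
Qed.

Lemma pi_translate g g' : pi g = pi g' -> pi \o lmul g = pi \o lmul g'.
Proof.
have [_ _ h _] := quo => /h[gamma Gg ->]; apply/funext => x /=.
by apply/h; exists gamma => //; rewrite lmulA.
Qed.

Lemma tmap_pi_lmul g xi :
  tmap (pi \o lmul g) (lone G) xi = tmap pi g (tmap (lmul g) (lone G) xi).
Proof.
have gG := @smooth_atlas_lie R n G; have gQ := smooth_atlas_quotient.
have := tmap_comp xi gG gG gQ openT (smooth_lmul g) smooth_pi (I : setT (lone G)) I.
by rewrite lmulg1.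
Qed.

(** Two lifts of a point of the quotient differ by a left translation, under which
    both pi and the Maurer-Cartan form are invariant; so the left trivialization is
    the Maurer-Cartan form of any lift. *)
Lemma ltrivE g w : ltriv pi (pi g) (tmap pi g w) = maurer_cartan g w.
Proof.
rewrite /ltriv; case: xgetP => [xi _ [g' e]|h].
  rewrite (pi_translate e) tmap_pi_lmul => /tmap_pi_inj <-.
  by rewrite maurer_cartanVK.
exfalso; apply: (h (maurer_cartan g w)); exists g => //.
by rewrite tmap_pi_lmul maurer_cartanK.
Qed.

Lemma ltriv_linear q : linear (ltriv pi q).
Proof.
have [g <-] := pi_surj q; move=> a u v.
have [u' <-] := tmap_pi_surj g u; have [v' <-] := tmap_pi_surj g v.
by rewrite -tmap_linear !ltrivE maurer_cartan_linear.
Qed.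

Lemma ltriv_inj0 q w : ltriv pi q w = 0 -> w = 0.
Proof.
have [g <-] := pi_surj q; have [u <-] := tmap_pi_surj g w.
rewrite ltrivE => h; rewrite -[u](maurer_cartanK g) h.
by rewrite (linear_at0 (tmap_linear _ _)) (linear_at0 (tmap_linear _ _)).
Qed.

Lemma ltriv_surj q xi : exists w, ltriv pi q w = xi.
Proof.
have [g <-] := pi_surj q; exists (tmap pi g (tmap (lmul g) (lone G) xi)).
by rewrite ltrivE maurer_cartanVK.
Qed.

Lemma descend2E (sigma : form2 G) q u v : left_invariant2 sigma ->
  descend2 pi sigma q u v = form_at1 sigma (ltriv pi q u) (ltriv pi q v).
Proof.
move=> sinv; rewrite /descend2; case: xgetP => [s _ [g [u' [v' [<- <- <- ->]]]]|h].
  by rewrite !ltrivE (left_invariant2_maurer_cartan (G := G) _ _ _ sinv).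
exfalso; have [g eg] := pi_surj q.
have [u' eu] := tmap_pi_surj g u; have [v' ev] := tmap_pi_surj g v.
by apply: (h (sigma g u' v')); exists g, u', v'.
Qed.

(** A local section of pi composed with the parametrization lifts the chart to G;
    the left trivialization is the pullback of the Maurer-Cartan form by that lift. *)
Lemma ltriv_chart (c : chart Q E) x0 : atlas c -> cimg c x0 ->
  exists (A : set E) (a : vec E -> G),
  [/\ open A, A x0, A `<=` cimg c, @smooth_on R E E (vec E) G A a &
    forall x v, A x -> ltriv pi (cfrom c x) (@tmap R E E (vec E) Q (cfrom c) x v) =
      pull_maurer_cartan a x v].
Proof.
move=> ac cx0; have gG := @smooth_atlas_lie R n G; have gQ := smooth_atlas_quotient.
have gE := smooth_atlas_vec (finite_dim_rV R n).
have [g eg] := pi_surj (cfrom c x0).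
have [W [s [Oo Og pOo ss sK]]] := local_section g.
have sc := smooth_on_cfrom gQ ac.
pose A := cimg c `&` cfrom c @^-1` (pi @` W).
have Ao : open A := open_chart gQ ac pOo.
have sa : @smooth_on R E E (vec E) G A (s \o cfrom c).
  exact: (smooth_on_comp gE gQ gG (open_cimg gQ ac) pOo sc ss).
exists A, (s \o cfrom c); split=> //.
- by split=> //=; rewrite -eg; exists g.
- by move=> x [].
move=> x v Ax; have [cx [y Oy ey]] := Ax.
have psA z : A z -> cfrom c z = (pi \o (s \o cfrom c)) z.
  by move=> [_ [y' Oy' ey']]; rewrite /= -ey' sK.
have e1 : pi ((s \o cfrom c) x) = cfrom c x by rewrite [RHS]psA.
have sc' : @smooth_on R E E (vec E) Q A (cfrom c) by apply: smooth_on_sub sc => z [].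
have -> : @tmap R E E (vec E) Q (cfrom c) x v =
    tmap pi ((s \o cfrom c) x) (@tmap R E E (vec E) G (s \o cfrom c) x v).
  rewrite (tmap_ext v gE gQ Ao Ax sc' Ax psA).
  exact: (tmap_comp v gE gG gQ Ao sa smooth_pi Ax I).
by rewrite -e1 ltrivE.
Qed.

End Quotient.

(** * The twisted form in the left trivialization *)

Section Twisted.
Context (R : realType) (n : nat) (G : lie_group R n).
Local Notation E := 'rV[R]_n.
Local Notation E' := 'cV[R]_n.
Variables (Gamma : set G) (Q : charted E) (pi : G -> Q).
Hypothesis quo : left_quotient Gamma pi.

Lemma finite_dim_cV : finite_dim E'. Proof. exact: finite_dim_mx. Qed.

Lemma smooth_atlas_cotangent : smooth_atlas (cotangent Q).
Proof.
by apply: smooth_atlas_prod; [exact: smooth_atlas_quotient quo|exact: smooth_atlas_vec finite_dim_cV].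
Qed.

Lemma tmap_tau (z : cotangent Q) w : tmap (@tau R n Q) z w = w.1.
Proof.
by apply: tmap_fst; [exact: smooth_atlas_quotient quo|exact: smooth_atlas_vec finite_dim_cV].
Qed.

(** A lift a of the chart of the quotient expresses the tautological form as
    mu o (pullback of theta by a), to which the Maurer-Cartan equation applies. *)
Lemma liouville_chart (z : cotangent Q) : exists (A : set E) (a : vec E -> G),
  [/\ open A, A (cto (chart_at z.1) z.1), @smooth_on R E E (vec E) G A a,
    (forall v, ltriv pi z.1 v = pull_maurer_cartan a (cto (chart_at z.1) z.1) v) &
    forall (X : E * E') W, A X.1 ->
      comp1 (chart_at z) (liouville pi) X W = pairing X.2 (pull_maurer_cartan a X.1 W.1)].
Proof.
have gQ := smooth_atlas_quotient quo; have gV := smooth_atlas_vec finite_dim_cV;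
  have gE := smooth_atlas_vec (finite_dim_rV R n).
have gC := smooth_atlas_cotangent.
pose c := chart_at z.1; have ac : atlas c by exact: atlas_at.
have [A [a [Ao Ax AC sa h]]] := ltriv_chart quo ac (cimg_at gQ z.1).
exists A, a; split=> //.
  move=> v; rewrite -h// ctoK_at//.
  by rewrite tmap_cfrom.
move=> X W AX; have cX := AC _ AX.
rewrite /comp1 /pull1 /liouville; congr (pairing _ _).
rewrite -h//; congr (ltriv pi _ _).
have cC : cimg (chart_at z) X by rewrite cimg_prod cimg_vchart.
have gEE := smooth_atlas_vec (finite_dim_prod (finite_dim_rV R n) finite_dim_cV).
have oC := open_cimg gC (atlas_at gC z).
have sC := smooth_on_cfrom gC (atlas_at gC z).
have sT := smooth_on_fst gQ gV (@openT (cotangent Q)).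
apply: etrans (esym (tmap_comp W gEE gC gQ oC sC sT cC I)) _.
have sfst : @smooth_on R _ _ (vec (E * E')%type) (vec E) setT fst.
  by apply/smooth_on_vec; [exact: openT|apply: Csmooth_lin;
    [exact: fst_linear|exact: fst_continuous]].
apply: etrans (tmap_comp (f := fst : vec (E * E')%type -> vec E)
  (g := cfrom c : vec E -> Q) W gEE gE gQ openT sfst (smooth_on_cfrom gQ ac) I cX) _.
congr tmap.
have [d1 d1E] := linear_diff X (@fst_linear R E E') (@fst_continuous R E E').
by rewrite tmap_vec// deriveE// d1E.
Qed.

Lemma derive_pairing_prod (xi : E -> E) (X U : E * E') : mx_differentiable xi X.1 ->
  'D_U (fun Y : E * E' => pairing Y.2 (xi Y.1) : R^o) X =
  'D_(U.1) (fun x => pairing X.2 (xi x) : R^o) X.1 + pairing U.2 (xi X.1).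
Proof.
move=> dxi.
have d1 : mx_differentiable (fun Y : E * E' => xi Y.1) X.
  move=> i j; apply: (@differentiable_comp _ _ _ _ fst (fun x => xi x i j : R^o)) => //.
  by have [] := linear_diff X (@fst_linear R E E') (@fst_continuous R E E').
have [ds dsE] := linear_diff X (@snd_linear R E E') (@snd_continuous R E E').
have d2 : mx_differentiable (fun Y : E * E' => Y.2) X by apply: differentiable_entries.
have := mx_derive_mul U d1 d2 => /matrixP/(_ 0 0); rewrite [LHS]mxE => ->.
have := mx_derive_mul U.1 dxi (mx_differentiable_cst X.2 X.1) => /matrixP/(_ 0 0);
  rewrite [LHS]mxE => ->.
rewrite mx_derive_cst mulmx0 addr0 mxE; congr (_ + _).
by rewrite mx_derive_derive// derive_lin//; exact: snd_continuous.
Qed.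

(** Differentiate p dq = mu o a^* theta: the derivatives of mu give the canonical
    terms and those of a^* theta the term mu o C, by the Maurer-Cartan equation. *)
Lemma twisted_formE (sigma : form2 G) (z : cotangent Q) w w' : left_invariant2 sigma ->
  twisted_form pi sigma z w w' =
  pairing w.2 (ltriv pi z.1 w'.1) - pairing w'.2 (ltriv pi z.1 w.1) +
  (pairing z.2 (bracket G (ltriv pi z.1 w.1) (ltriv pi z.1 w'.1)) +
   form_at1 sigma (ltriv pi z.1 w.1) (ltriv pi z.1 w'.1)).
Proof.
move=> sinv; rewrite /twisted_form /pull2 !tmap_tau (descend2E quo _ _ _ sinv).
rewrite [RHS]addrA; congr (_ + _).
have [A [a [Ao Ax sa lE h]]] := liouville_chart z.
rewrite !lE.
set x0 := cto (chart_at z.1) z.1 in Ax *.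
pose X0 : E * E' := (x0, z.2).
have D U W : 'D_U (fun X : E * E' => comp1 (chart_at z) (liouville pi) X W : R^o) X0 =
   'D_(U.1) (fun x => pairing z.2 (pull_maurer_cartan a x W.1) : R^o) x0 +
   pairing U.2 (pull_maurer_cartan a x0 W.1).
  rewrite (@near_eq_derive _ _ _ _ (fun X : E * E' => pairing X.2 (pull_maurer_cartan a X.1
    W.1) : R^o)); last first.
    have oA : open (A `*` setT : set (E * E')) by apply: open_prod => //; exact: openT.
    have X0A : (A `*` setT : set (E * E')) X0 by [].
    by apply: filterS (open_near oA X0A) => X [AX _]; apply: h.
  exact: (@derive_pairing_prod (fun x : E => pull_maurer_cartan a x W.1) X0 U
    (pull_maurer_cartan_differentiable W.1 (finite_dim_rV R n) Ao Ax sa)).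
have d := maurer_cartan_equation z.2 w.1 w'.1 (finite_dim_rV R n) Ao Ax sa.
rewrite -d /d1 /dvec1 -/X0.
have -> : cto (chart_at z) z = X0 by [].
rewrite !D.
move: ('D_(w.1) _ x0 : R) ('D_(w'.1) _ x0 : R) (pairing _ _ : R) (pairing _ _ : R) => *.
ring.
Qed.

End Twisted.

(** * Energy levels of an inner product *)

Section InnerProduct.
Context (R : realType) (n : nat).
Local Notation E' := 'cV[R]_n.
Variable b : E' -> E' -> R.
Hypothesis ib : inner_product b.

Lemma ipC x y : b x y = b y x. Proof. by have [] := ib. Qed.
Lemma ip_linear_l y : linear (fun x => b x y : R^o). Proof. by have [_ h _] := ib; exact: h. Qed.
Lemma ip_gt0 x : x <> 0 -> 0 < b x x. Proof. by have [_ _ h] := ib; exact: h. Qed.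

Definition ip_mx : 'M[R]_n := bilin_mx (fun x y => b x^T y^T).

Lemma ip_linear_r x : linear (b x : E' -> R^o).
Proof. by move=> a u v; rewrite !(ipC x) ip_linear_l. Qed.

Lemma ipE x y : b x y = (x^T *m ip_mx *m y) 0 0.
Proof.
rewrite -{2}[y]trmxK -(@bilin_mxE _ _ (fun x y => b x^T y^T)) ?trmxK// => [z|z] a u v.
  by rewrite linearP ip_linear_l.
by rewrite linearP ip_linear_r.
Qed.

Lemma ip_mx_sym : ip_mx^T = ip_mx.
Proof. by apply/matrixP => i j; rewrite !mxE ipC. Qed.

Lemma ipD x y z : b (x + y) z = b x z + b y z.
Proof. by rewrite !ipE linearD /= !mulmxDl mxE. Qed.

Lemma ipZ a x z : b (a *: x) z = a * b x z.
Proof. by rewrite !ipE linearZ /= -!scalemxAl mxE. Qed.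

Lemma ip0 z : b 0 z = 0.
Proof. by rewrite -(scale0r (0 : E')) ipZ mul0r. Qed.

Lemma ip_ge0 x : 0 <= b x x.
Proof.
have [->|/eqP x0] := eqVneq x 0; first by rewrite ip0.
exact/ltW/ip_gt0.
Qed.

Lemma ip_cauchy x y : b x y ^+ 2 <= b x x * b y y.
Proof.
have [->|/eqP y0] := eqVneq y 0; first by rewrite ipC !ip0 mulr0 expr2 mulr0.
have yy := ip_gt0 y0.
rewrite -(ler_pM2l yy) -subr_ge0.
have := ip_ge0 (b y y *: x + (- b x y) *: y).
rewrite !(ipD, ipZ, ipC _ (_ + _), ipC _ (_ *: _)) (ipC y x).
by congr (0 <= _); ring.
Qed.

Lemma ip_mx_unit : ip_mx \in unitmx.
Proof.
rewrite -row_free_unit -kermx_eq0; apply/rowV0P => x /sub_kermxP x0.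
apply: trmx_inj; rewrite trmx0.
have [//|/eqP/ip_gt0] := eqVneq x^T 0.
by rewrite ipE trmxK x0 mul0mx mxE ltxx.
Qed.

(** Each coordinate of mu is the inner product of mu with a vector f_i of the dual
    basis, so the Cauchy-Schwarz inequality bounds it by a multiple of the b-norm. *)
Lemma ip_coercive : exists2 c0 : R, 0 < c0 & forall mu : E', c0 * `|mu| ^+ 2 <= b mu mu.
Proof.
pose f i : E' := invmx ip_mx *m delta_mx i 0.
pose K := \sum_i b (f i) (f i) + 1.
have K0 : 0 < K by rewrite ltr_wpDl// sumr_ge0// => i _; exact: ip_ge0.
exists K^-1; first by rewrite invr_gt0.
move=> mu; rewrite mulrC ler_pdivrMr//.
have Kb : 0 <= b mu mu * K by rewrite mulr_ge0 ?ip_ge0// ltW.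
have h : `|mu| <= Num.sqrt (b mu mu * K).
  apply: mx_norm_le => [|i j]; first exact: sqrtr_ge0.
  rewrite -sqrtr_sqr ler_sqrt//.
  have -> : mu i j = b mu (f i).
    rewrite ipE /f mulmxA mulmxK ?ip_mx_unit// mxE (bigD1 i)//= big1 => [|k ki].
      by rewrite !mxE !eqxx mulr1 addr0 (ord1 j).
    by rewrite !mxE (negbTE ki) mulr0.
  apply: le_trans (ip_cauchy _ _) _; rewrite ler_wpM2l ?ip_ge0//.
  rewrite /K (bigD1 i)//= -addrA lerDl addr_ge0// sumr_ge0// => k _; exact: ip_ge0.
by rewrite -(sqr_sqrtr Kb) lerXn2r// nnegrE ?normr_ge0 ?sqrtr_ge0.
Qed.

Lemma Ck_ip k U : open U -> Ck k U (fun mu : E' => b mu mu : R^o).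
Proof.
move=> Uo.
have idC : Ck_mx k U (fun mu : E' => mu).
  move=> i j; apply: Ck_lin; first by move=> a u v; rewrite !mxE.
  exact: coord_continuous.
have trC : Ck_mx k U (fun mu : E' => mu^T).
  by move=> i j; rewrite (_ : (fun _ => _) = (fun mu : E' => mu j i : R^o))//;
    apply/funext => mu; rewrite mxE.
have h := Ck_mx_mul Uo (Ck_mx_mul Uo trC (Ck_mx_cst k U ip_mx)) idC.
by apply: Ck_ext Uo _ (h 0 0) => mu _; rewrite ipE.
Qed.

Lemma derive_ip mu nu : 'D_nu (fun mu : E' => b mu mu : R^o) mu = b mu nu *+ 2.
Proof.
rewrite (_ : (fun mu => _) = (fun mu : E' => (mu^T *m ip_mx *m mu) 0 0 : R^o)); last first.
  by apply/funext => x; rewrite ipE.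
have d1 : mx_differentiable (fun mu : E' => mu) mu by exact: differentiable_entries.
have d2 := mx_differentiable_tr d1.
have := mx_derive_mul nu (mx_differentiable_mul d2 (mx_differentiable_cst ip_mx mu)) d1 =>
  /matrixP/(_ 0 0).
rewrite [LHS]mxE => ->.
rewrite (mx_derive_mul nu d2 (mx_differentiable_cst ip_mx mu)) mx_derive_cst mulmx0 addr0
  mx_derive_tr.
rewrite mx_derive_derive// derive_id mxE -!ipE (ipC nu) mulr2n //.
Qed.

Lemma compact_ellipsoid (k : R) : compact [set mu : E' | b mu mu / 2 = k].
Proof.
have [c0 c00 hc] := ip_coercive.
pose S := [set x : 'rV[R]_n | b x^T x^T / 2 = k].
have trc : continuous (trmx : 'rV[R]_n -> E').
  apply: finite_dim_linear_continuous; first exact: finite_dim_mx.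
  by move=> a u v; rewrite linearP.
(* Bounded closed sets of row vectors are compact; transposition carries this over
   to column vectors. *)
have -> : [set mu : E' | b mu mu / 2 = k] = trmx @` S.
  apply/seteqP; split=> [mu h|_ [x h <-]] //.
  by exists mu^T; rewrite ?trmxK// /S /= trmxK.
apply: continuous_compact; first exact: continuous_subspaceT.
apply: bounded_closed_compact.
  pose M := Num.max 1 (2 * k / c0).
  exists M; split; first exact: num_real.
  move=> N MN x /= Sx; apply: ltW; apply: le_lt_trans MN.
  have h := hc x^T; rewrite mx_norm_tr in h.
  have [x1|x1] := leP `|x| 1; first by rewrite le_max x1.
  rewrite le_max; apply/orP; right.
  rewrite ler_pdivlMr// mulrC -Sx [2 * _]mulrC divfK//.
  apply: le_trans h; rewrite ler_pM2l// expr2 ler_peMr// ltW//.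
have -> : S = (fun x => b x^T x^T : R^o) @^-1` [set k * 2].
  apply/seteqP; split=> x.
    by rewrite /S /preimage /= => <-; rewrite divfK.
  by rewrite /S /preimage /= => ->; rewrite mulfK.
apply: closed_comp; last exact: closed_eq.
move=> x _.
apply: (@continuous_comp _ _ _ trmx (fun mu : E' => b mu mu : R^o)); first exact: (trc x).
exact: (@Ck_ip 0 setT openT x^T I).
Qed.

End InnerProduct.

(** * Characteristics of the levels *)

Section LinearAlgebra.
Context (R : realType) (n : nat).
Local Notation E := 'rV[R]_n.
Local Notation E' := 'cV[R]_n.

(** An injective image of dimension 2n - 1 inside a hyperplane of a space of
    dimension 2n fills that hyperplane.  It identifies the image of the differential
    of a patch with the tangent space of the level. *)
Lemma hyperplane_onto (T : 'rV[R]_(n + n).-1 -> E * E') (h : E') :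
  linear T -> injective T -> h != 0 ->
  (forall u, (h^T *m (T u).2) 0 0 = 0) ->
  forall W : E * E', (h^T *m W.2) 0 0 = 0 -> exists u, T u = W.
Proof.
move=> Tl Ti h0 Th W Wh.
pose f u : 'rV[R]_(n + n) := row_mx (T u).1 (T u).2^T.
have fl : linear f.
  move=> a u v; rewrite /f Tl /= linearP scale_row_mx add_row_mx //.
pose fM := GRing.isLinear.Build _ _ _ _ _ fl.
pose fL : {linear 'rV[R]_(n + n).-1 -> 'rV[R]_(n + n)} := HB.pack f fM.
pose A := lin1_mx fL.
have AE u : u *m A = f u by rewrite mul_rV_lin1.
have Af : row_free A.
  rewrite -kermx_eq0; apply/rowV0P => u /sub_kermxP; rewrite AE => fu0.
  apply: Ti; have T0 := linear_at0 Tl.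
  move: fu0; rewrite T0 -(row_mx0 _ 1 n n) => /eq_row_mx[e1 e2].
  apply: injective_projections => //=.
  by apply: trmx_inj; rewrite trmx0.
pose H : 'cV[R]_(n + n) := col_mx 0 h.
have fH (w : E * E') : row_mx w.1 w.2^T *m H = (h^T *m w.2)^T.
  by rewrite mul_row_col mulmx0 add0r trmx_mul trmxK.
have z11 (M : 'M[R]_1) : M 0 0 = 0 -> M = 0.
  by move=> M0; apply/matrixP => i j; rewrite !ord1 mxE.
have AH : A *m H = 0.
  apply/row_matrixP => i; rewrite row_mul row0 rowE AE /f fH.
  by rewrite (z11 _ (Th _)) trmx0.
have rH : \rank H = 1%N.
  apply/eqP; rewrite eqn_leq rank_leq_col lt0n mxrank_eq0.
  apply: contra h0 => /eqP H0; apply/eqP.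
  have := congr1 dsubmx H0; rewrite col_mxKd => ->.
  by apply/matrixP => i j; rewrite !mxE.
have AK : (A <= kermx H)%MS by apply/sub_kermxP.
have rAK : \rank A == \rank (kermx H).
  by rewrite mxrank_ker rH subn1; exact: Af.
have KA : (kermx H <= A)%MS.
  by have := mxrank_leqif_eq AK => -[_]; rewrite rAK => /esym/andP[].
have : (row_mx W.1 W.2^T <= A)%MS.
  apply: submx_trans KA; apply/sub_kermxP.
  by rewrite fH (z11 _ Wh) trmx0.
move=> /submxP[u]; rewrite AE /f => /eq_row_mx[e1 e2].
exists u; apply: injective_projections; first by rewrite -e1.
by apply: trmx_inj; rewrite -e2.
Qed.

(** The two hypotheses say that (xi, nu) is orthogonal, for the twisted form, to
    vectors (xi', 0) and to vectors (0, nu') tangent to the level; the former give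
    nu, the latter that xi vanishes on the b-orthogonal of mu and is therefore a
    multiple of its b-dual. *)
Lemma characteristic (P B : 'M[R]_n) (mu : E') (xi : E) (nu : E') :
  P^T = - P -> (mu^T *m B *m mu) 0 0 != 0 ->
  (forall xi' : E, (xi' *m nu) 0 0 + (xi *m P *m xi'^T) 0 0 = 0) ->
  (forall nu' : E', (mu^T *m B *m nu') 0 0 = 0 -> (xi *m nu') 0 0 = 0) ->
  exists c : R, xi = c *: (mu^T *m B) /\ nu = P *m xi^T.
Proof.
move=> PT q0 h1 h2.
exists ((xi *m mu) 0 0 / (mu^T *m B *m mu) 0 0); split.
  have xe (X Y : 'M[R]_1) : (X - Y) 0 0 = X 0 0 - Y 0 0 by rewrite !mxE.
  apply/matrixP => i j; rewrite (ord1 i).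
  pose nu' : E' := delta_mx j 0.
  pose t := (mu^T *m B *m nu') 0 0 / (mu^T *m B *m mu) 0 0.
  have := h2 (nu' - t *: mu).
  have ze (a : R) (X : 'M[R]_1) : (a *: X) 0 0 = a * X 0 0 by rewrite !mxE.
  rewrite !mulmxBr -!scalemxAr !xe !ze /t divfK// subrr => /(_ erefl).
  have colE (x : E) : (x *m nu') 0 0 = x 0 j by rewrite -colE mxE.
  move=> /eqP; rewrite subr_eq0 !colE => /eqP ->.
  rewrite [RHS]mxE; move: ((xi *m mu) 0 0 : R) ((mu^T *m B) 0 j : R) => x y.
  move: (_ 0 0 : R) => z; ring.
apply/matrixP => i j; rewrite (ord1 j).
have := h1 (delta_mx 0 i).
have -> : xi *m P *m (delta_mx 0 i)^T = - (delta_mx 0 i *m (P *m xi^T)).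
  by rewrite -[LHS]tr_mx11 !trmx_mul trmxK PT mulNmx mulmxN.
have xn (X : 'M[R]_1) : (- X) 0 0 = - X 0 0 by rewrite mxE.
have rE (y : E') : (row i y) 0 0 = y i 0 by rewrite mxE.
by rewrite -!rowE xn !rE => /eqP; rewrite subr_eq0 => /eqP.
Qed.

End LinearAlgebra.

Section Level.
Context (R : realType) (n : nat) (G : lie_group R n).
Local Notation E := 'rV[R]_n.
Local Notation E' := 'cV[R]_n.
Variables (Gamma : set G) (Q : charted E) (pi : G -> Q).
Hypothesis quo : left_quotient Gamma pi.
Variable b : E' -> E' -> R.
Hypothesis ib : inner_product b.

Definition level (k : R) : set (cotangent Q) := [set z | hamiltonian b z = k].

(** The level is the product of Q and an ellipsoid, and the derivative of the energy
    in the direction (0, mu) is b(mu, mu) = 2 k. *)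
Lemma level_closed_hypersurface k : compact [set: Q] -> 0 < k ->
  closed_hypersurface (level k).
Proof.
move=> Qc k0; split.
  rewrite (_ : level k = [set: Q] `*` [set mu : E' | b mu mu / 2 = k]); last first.
    by apply/seteqP; split=> [[q mu]|[q mu] []].
  by apply: compact_setX => //; exact: compact_ellipsoid.
move=> p Sp; have gQ := smooth_atlas_quotient quo; have gV := smooth_atlas_vec (finite_dim_cV R n).
have gC := smooth_atlas_cotangent quo; have gR := smooth_atlas_vec (finite_dim_real R).
pose h (mu : E') : R^o := b mu mu / 2 - k.
have hC : Csmooth setT h.
  move=> j; have h1 := CkM openT (Ck_ip ib j openT) (Ck_cst j setT (2^-1 : R^o)).
  exact: (CkD openT h1 (Ck_cst j setT (- k : R^o))).
have sh : @smooth_on R E' R^o (vec E') (vec R^o) setT h by apply/smooth_on_vec => //; exact: openT.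
have ss := smooth_on_snd gQ gV (@openT (cotangent Q)).
exists setT, (h \o (fun z : cotangent Q => z.2 : vec E')); split.
- exact: openT.
- by [].
- by apply: smooth_on_sub (smooth_on_comp gC gV gR openT openT ss sh).
- apply/seteqP; split=> z; rewrite /level /hamiltonian /h /=.
    by move=> [<- _]; rewrite subrr.
  by move=> [_ /eqP]; rewrite subr_eq0 => /eqP.
(* The radial direction is transverse to the level. *)
exists (0, p.2).
have -> : @tmap R (E * E')%type R^o (cotangent Q) (vec R^o)
    (h \o (fun z : cotangent Q => z.2 : vec E')) p (0, p.2) = 'D_(p.2) h p.2.
  apply: etrans (tmap_comp (0, p.2) gC gV gR openT ss sh I I) _.
  rewrite tmap_vec; last exact: (Csmooth_diff hC).
  by congr derive; exact: tmap_snd.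
have d1 : differentiable (fun mu : E' => b mu mu : R^o) p.2.
  exact: (Ck_diff (Ck_ip ib 1 openT) (I : setT p.2)).
have -> : 'D_(p.2) h p.2 = b p.2 p.2.
  have d2 := differentiable_mul d1 (differentiable_cst (2^-1 : R^o) p.2).
  rewrite [LHS]deriveD; [|exact: diff_derivable|exact: derivable_cst].
  rewrite derive_cst addr0 derive_mul// derive_cst mulr0 addr0 (derive_ip ib).
  by rewrite -(mulr_natr (b _ _)) mulfK.
move: Sp; rewrite /level /hamiltonian /= => e e0.
by move: k0; rewrite -e e0 mul0r ltxx.
Qed.

Section Patch.
Variables (m : nat) (k : R) (U : set 'rV[R]_m) (phi : vec 'rV[R]_m -> cotangent Q).
Hypothesis pp : patch (level k) U phi.
Let psi (x : 'rV[R]_m) : E' := (phi x).2.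

Lemma patch_open : open U. Proof. by have [] := pp. Qed.

Lemma patch_level x : U x -> b (psi x) (psi x) / 2 = k.
Proof. by move=> Ux; have [_ _ _ h] := pp; apply: (h (phi x)); exists x. Qed.

Lemma patch_smooth_snd : Csmooth U psi.
Proof.
have [Uo sp _ _] := pp.
have gQ := smooth_atlas_quotient quo; have gV := smooth_atlas_vec (finite_dim_cV R n).
have gC := smooth_atlas_cotangent quo; have gm := smooth_atlas_vec (finite_dim_mx R 1 m).
have ss := smooth_on_snd gQ gV (@openT (cotangent Q)).
apply/(smooth_on_vec _ Uo).
by apply: smooth_on_sub (smooth_on_comp gm gC gV Uo openT sp ss).
Qed.

Lemma patch_tmap_snd x v : U x -> (tmap phi x v).2 = 'D_v psi x.
Proof.
move=> Ux; have [Uo sp _ _] := pp.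
have gQ := smooth_atlas_quotient quo; have gV := smooth_atlas_vec (finite_dim_cV R n).
have gC := smooth_atlas_cotangent quo; have gm := smooth_atlas_vec (finite_dim_mx R 1 m).
have ss := smooth_on_snd gQ gV (@openT (cotangent Q)).
apply: etrans (esym (tmap_snd (phi x) (tmap phi x v) gQ gV)) _.
apply: etrans (esym (tmap_comp v gm gC gV Uo sp ss Ux I)) _.
by apply: tmap_vec; exact: (Csmooth_diff patch_smooth_snd).
Qed.

(** The energy is constant along the patch. *)
Lemma patch_tangent x v : U x -> b (psi x) ('D_v psi x) = 0.
Proof.
move=> Ux; have Uo := patch_open.
have dp := Csmooth_diff patch_smooth_snd Ux.
have d1 : differentiable (fun mu : E' => b mu mu : R^o) (psi x).
  exact: (Ck_diff (Ck_ip ib 1 openT) (I : setT (psi x))).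
have := derive_comp v dp d1; rewrite (derive_ip ib).
have -> : 'D_v ((fun mu : E' => b mu mu : R^o) \o psi) x = 0.
  rewrite (@near_eq_derive _ _ _ _ (cst (k * 2 : R^o))); first exact: derive_cst.
  apply: filterS (open_near Uo Ux) => y Uy.
  by rewrite /cst -(patch_level Uy) /= divfK.
by move=> /esym/eqP; rewrite mulrn_eq0 /= => /eqP.
Qed.

End Patch.

Variable sigma : form2 G.
Hypothesis sinv : left_invariant2 sigma.
Hypothesis ssymp : symplectic sigma.
Local Notation P0 := (form_at1_mx sigma).
Local Notation L := (bracket_mx G).

Lemma pencil_at1 mu : pencil P0 L (1, mu) = P0 + L mu.
Proof. by rewrite /pencil /= scale1r. Qed.

Lemma pencil_mx_anti mu : (P0 + L mu)^T = - (P0 + L mu).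
Proof. by rewrite linearD /= (form_at1_mx_anti ssymp) bracket_mx_anti opprD. Qed.

(** The tangent space of the level is a hyperplane containing all (xi', 0), so
    [characteristic] determines the kernel of omega on it; c = 0 would give
    xi = 0, nu = 0 and v = 0 by injectivity. *)
Lemma patch_kernel (k : R) (U : set 'rV[R]_(n + n).-1)
    (phi : vec 'rV[R]_(n + n).-1 -> cotangent Q) x v :
  0 < k -> patch (level k) U phi -> U x -> v <> 0 ->
  (forall u, pull2 phi (twisted_form pi sigma) x v u = 0) ->
  let mu := (phi x).2 in
  exists2 c : R, c != 0 & (tmap phi x v).2 = c *: ((P0 + L mu) *m ip_mx b *m mu).
Proof.
move=> k0 pp Ux v0 hv mu.
pose T := tmap phi x; pose w := T v; pose xi := ltriv pi (phi x).1 w.1.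
have Tl : linear T by exact: tmap_linear.
have Ti : injective T by have [_ _ h _] := pp; exact: h.
have bmu : b mu mu = k * 2 by rewrite -(patch_level pp Ux) divfK.
have bmu0 : (mu^T *m ip_mx b *m mu) 0 0 != 0.
  by rewrite -(ipE ib) bmu mulf_neq0// gt_eqF.
pose h : E' := ip_mx b *m mu.
have hE nu : (h^T *m nu) 0 0 = b mu nu.
  by rewrite (ipE ib) /h trmx_mul (ip_mx_sym ib).
have h0 : h != 0.
  apply: contraNneq bmu0 => e.
  by rewrite -(ipE ib) -hE e trmx0 mul0mx mxE.
have Th u : (h^T *m (T u).2) 0 0 = 0.
  by rewrite hE /T (patch_tmap_snd pp u Ux) (patch_tangent pp u Ux).
(* The differential of the patch fills the tangent space of the level, so the
   kernel condition holds against all tangent vectors of the level. *)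
have onto := hyperplane_onto Tl Ti h0 Th.
have om (W : E * E') : b mu W.2 = 0 ->
   pairing w.2 (ltriv pi (phi x).1 W.1) - pairing W.2 xi +
   (pairing mu (bracket G xi (ltriv pi (phi x).1 W.1)) +
     form_at1 sigma xi (ltriv pi (phi x).1 W.1)) = 0.
  rewrite -hE => /onto[u e].
  have := hv u; rewrite /pull2 -/T -/w e.
  by rewrite (twisted_formE quo _ _ _ sinv).
have h1 (xi' : E) : (xi' *m w.2) 0 0 + (xi *m (P0 + L mu) *m xi'^T) 0 0 = 0.
  have [a ea] := ltriv_surj quo (phi x).1 xi'.
  have := @om (a, 0); rewrite /= ea.
  have -> : b mu 0 = 0 by rewrite (ipC ib) (ip0 ib).
  have -> : pairing (0 : E') xi = 0 by rewrite /pairing mulmx0 mxE.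
  rewrite subr0 bracketE (form_at1E ssymp) => /(_ erefl) <-.
  by congr (_ + _); rewrite mulmxDr mulmxDl mxE addrC.
have h2 (nu' : E') : (mu^T *m ip_mx b *m nu') 0 0 = 0 -> (xi *m nu') 0 0 = 0.
  rewrite -(ipE ib) => bn; have := @om (0, nu') bn.
  rewrite /= (linear_at0 (ltriv_linear quo _)).
  rewrite bracketE (form_at1E ssymp) trmx0 !mulmx0.
  by rewrite /pairing mul0mx !mxE !addr0 sub0r => /eqP; rewrite oppr_eq0 => /eqP.
have [c [xiE nuE]] := characteristic (pencil_mx_anti mu) bmu0 h1 h2.
exists c.
  apply/eqP => c0; apply: v0.
  have xi0 : xi = 0 by rewrite xiE c0 scale0r.
  apply: Ti; rewrite -/T -/w (linear_at0 Tl).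
  apply: injective_projections => /=; first exact: (ltriv_inj0 quo xi0).
  by rewrite nuE xi0 trmx0 mulmx0.
rewrite -/T -/w nuE xiE linearZ /= trmx_mul trmxK (ip_mx_sym ib).
by rewrite -scalemxAr mulmxA.
Qed.

End Level.

(** * The stabilizing form *)

Section Main.
Context (R : realType) (n : nat) (G : lie_group R n).
Local Notation E := 'rV[R]_n.
Local Notation E' := 'cV[R]_n.
Variables (Gamma : set G) (Q : charted E) (pi : G -> Q).
Hypothesis quo : left_quotient Gamma pi.
Variable b : E' -> E' -> R.
Hypothesis ib : inner_product b.
Variable sigma : form2 G.
Hypothesis sinv : left_invariant2 sigma.
Hypothesis ssymp : symplectic sigma.
Local Notation P0 := (form_at1_mx sigma).
Local Notation L := (bracket_mx G).
Local Notation prim := (primitive P0 L).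

Section Radius.
Variable r : R.
Let B := [set mu : E' | `|mu| < r].
Hypothesis Bdom : forall (t : R) (mu : E'), 0 <= t <= 1 -> `|mu| < r -> pencil_dom P0 L (t, mu).
Hypothesis Bneg : forall mu : E', `|mu| < r -> mu != 0 ->
  prim mu ((P0 + L mu) *m ip_mx b *m mu) < 0.
Variable k : R.
Hypothesis k0 : 0 < k.
Hypothesis kr : forall mu : E', b mu mu / 2 = k -> `|mu| < r.

Definition stabilizer : form1 (cotangent Q) := fun z W => prim z.2 W.2.

Lemma open_normball : open B.
Proof.
rewrite (_ : B = ball (0 : E') r); first exact: ball_open.
by apply/seteqP; split=> mu; rewrite -ball_normE /B /= sub0r normrN.
Qed.

Variables (U : set 'rV[R]_(n + n).-1) (phi : vec 'rV[R]_(n + n).-1 -> cotangent Q).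
Hypothesis pp : patch (level b k) U phi.
Let psi (x : 'rV[R]_(n + n).-1) : E' := (phi x).2.

Lemma patch_ball x : U x -> B (psi x).
Proof. by move=> Ux; apply: kr; exact: (patch_level pp Ux). Qed.

Lemma pull_stabilizer x v : U x ->
  pull1 phi stabilizer x v = prim (psi x) ('D_v psi x).
Proof. by move=> Ux; rewrite /pull1 /stabilizer (patch_tmap_snd quo pp v Ux). Qed.

Lemma stabilizer_smooth v : Csmooth U (fun x : 'rV[R]_(n + n).-1 => pull1 phi stabilizer x v : R^o).
Proof.
have Uo := patch_open pp; have ps := patch_smooth_snd quo pp.
have L_lin := bracket_mx_linear G.
have pl := primitive_linear L_lin Bdom.
have pC w := Csmooth_primitive L_lin open_normball Bdom w.
move=> j.
have h i : Ck j U (fun x => ('D_v psi x) i 0 * prim (psi x) (delta_mx i 0) : R^o).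
  have h1 : Ck j U (fun x => ('D_v psi x) i 0 : R^o).
    apply: (@Ck_lin_comp _ _ _ _ j U ('D_v psi) (fun M : E' => M i 0 : R^o) Uo).
    - by move=> s u w; rewrite !mxE.
    - exact: coord_continuous.
    - exact: (Csmooth_derive v ps j).
  have h2 := Ck_comp (finite_dim_cV R n) (finite_dim_real R) Uo open_normball patch_ball (ps j)
    (pC (delta_mx i 0) j).
  exact: (CkM Uo h1 h2).
apply: Ck_ext Uo _ (Ck_sum (index_enum 'I_n) Uo h) => x Ux.
rewrite pull_stabilizer//.
have e : 'D_v psi x = \sum_i ('D_v psi x) i 0 *: delta_mx i 0.
  rewrite [LHS]matrix_sum_delta; apply: eq_bigr => i _.
  by rewrite big_ord1.
by rewrite [in RHS]e (linear_sum_coord _ _ (pl _ (patch_ball Ux))).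
Qed.

(** On a characteristic vector the form is c beta_mu(P_mu B mu), nonzero by the choice
    of the ball.  Its differential against another tangent vector v is
    Omega_mu(nu, v), which is a multiple of b(mu, v) and vanishes by [patch_tangent]. *)
Lemma stabilizer_stable x v : U x ->
  (forall u, pull2 phi (twisted_form pi sigma) x v u = 0) -> v <> 0 ->
  pull1 phi stabilizer x v <> 0 /\
  (forall u, dvec1 (pull1 phi stabilizer) x v u = 0).
Proof.
move=> Ux hv v0.
have Uo := patch_open pp; have ps := patch_smooth_snd quo pp.
have L_lin := bracket_mx_linear G.
have pl := primitive_linear L_lin Bdom.
have pC w := Csmooth_primitive L_lin open_normball Bdom w.
have [c c0 wE] := patch_kernel quo ib sinv ssymp k0 pp Ux v0 hv.
rewrite (patch_tmap_snd quo pp v Ux) -/(psi x) in wE.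
have Bx := patch_ball Ux.
split.
  rewrite pull_stabilizer// wE => e0.
  have mu0 : psi x != 0.
    apply/eqP => mu0; have := patch_level pp Ux.
    by rewrite -/(psi x) mu0 (ip0 ib) mul0r => k00; move: k0; rewrite -k00 ltxx.
  have := Bneg Bx mu0.
  have plx := pl _ Bx.
  have := plx c ((P0 + L (psi x)) *m ip_mx b *m psi x) 0.
  rewrite addr0 e0 (linear_at0 plx) addr0 => /esym/eqP.
  by rewrite mulf_eq0 (negbTE c0) /= => /eqP ->; rewrite ltxx.
move=> u.
rewrite (@dvec1_near _ _ _ ((fun y w => prim (psi y) ('D_w psi y)) :
  form1 (vec 'rV[R]_(n + n).-1))); last first.
  apply: filterS (open_near Uo Ux) => y Uy; apply/funext => w.
  exact: pull_stabilizer.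
rewrite (dvec1_pull (a := prim : form1 (vec E')) (f := psi) v u (finite_dim_cV R n) Uo Ux
  (ps 2) open_normball Bx pl).
  rewrite (dvec1_primitive (form_at1_mx_anti ssymp) L_lin (bracket_mx_anti G) (bracket_mxE G)
    (twisted_jacobi sinv ssymp) Bdom _ _ Bx).
  have ux : (P0 + L (psi x)) \in unitmx.
    by rewrite -pencil_at1; apply: Bdom; rewrite // ler01 lexx.
  rewrite /form /pencil_inv pencil_at1 wE linearZ /= !trmx_mul (pencil_mx_anti ssymp).
  rewrite (ip_mx_sym ib) -!scalemxAl !mulmxA mulmxN !mulNmx mulmxK//.
  have ze (a : R) (X : 'M[R]_1) : (a *: - X) 0 0 = - (a * X 0 0) by rewrite !mxE mulrN.
  by rewrite ze -(ipE ib) (patch_tangent quo ib pp u Ux) mulr0 !oppr0.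
by move=> w; exact: (Csmooth_diff (pC w) Bx).
Qed.

End Radius.

End Main.

Theorem proposition6p19 (R : realType) (n : nat) (G : lie_group R n)
    (Gamma : set G) (Q : charted 'rV[R]_n) (pi : G -> Q)
    (sigma : form2 G) (b : 'cV[R]_n -> 'cV[R]_n -> R) :
  discrete_subgroup Gamma ->
  left_quotient Gamma pi ->
  compact [set: Q] ->
  left_invariant2 sigma ->
  symplectic sigma ->
  inner_product b ->
  exists2 k0 : R, 0 < k0 &
    forall k : R, 0 < k < k0 ->
      stable (n + n).-1 (twisted_form pi sigma)
        [set z : cotangent Q | hamiltonian b z = k].
Proof.
move=> _ quo Qc sinv ssymp ib.
have [c0 c00 hc] := ip_coercive ib.
have hB (mu : 'cV[R]_n) : c0 * `|mu| ^+ 2 <= (mu^T *m ip_mx b *m mu) 0 0 by rewrite -(ipE ib).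
have L_lin := bracket_mx_linear G.
have [r r0 [Bdom Bneg]] := exists_primitive_ball (form_at1_mx_unit ssymp) L_lin c00 hB.
(* If b(mu, mu) = 2 k < c0 r^2, coercivity gives |mu| < r. *)
exists (c0 * r ^+ 2 / 2); first by rewrite divr_gt0// mulr_gt0// exprn_gt0.
move=> k /andP[k0 kk].
have kr (mu : 'cV[R]_n) : b mu mu / 2 = k -> `|mu| < r.
  move=> e; rewrite ltNge; apply/negP => rmu.
  have h1 : r ^+ 2 <= `|mu| ^+ 2.
    by rewrite lerXn2r// nnegrE ?normr_ge0// ltW.
  have h2 : c0 * r ^+ 2 <= c0 * `|mu| ^+ 2 by rewrite ler_pM2l.
  have h3 := le_trans h2 (hc mu).
  lra.
split; first exact: (level_closed_hypersurface quo ib Qc k0).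
exists (stabilizer sigma (Q := Q)); split.
  move=> z Sz a u v; rewrite /stabilizer /=.
  exact: (primitive_linear L_lin Bdom (kr _ Sz)).
move=> U phi pp; split=> [v|x v Ux hv v0].
  exact: (stabilizer_smooth quo Bdom kr pp).
exact: (stabilizer_stable quo ib sinv ssymp Bdom Bneg k0 kr pp Ux hv v0).
Qed.
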